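(* Fix an integer $M\ge 1$. Consider the family of generalized Jackson networks (GJNs) indexed by $r\in(0,1)$ described in the context, under the multi-scale heavy traffic condition $\mu_j^{(r)}=\lambda_j+r^j$ for $j=1,\dots,J$, and assume the stability assumption holds. Suppose \[ \mathbb{E}\big[T_{e,j}(1)^{M+1}\big]<\infty \ \text{ for } 1\le j\le M\wedge J,\qquad \mathbb{E}\big[T_{s,j}(1)^{M+1}\big]<\infty \ \text{ for } 1\le j\le J . \] Let $r_0$ be the constant \[ r_0=\min_{\{1\le k<j\le J:\ w_{jk}\neq 0\}}\left(\frac{1-w_{kk}}{J\,w_{jk}}\right)^{1/(j-k)} \] (taken to be $1$ if the index set is empty), where $(w_{jk})$ is the matrix defined in the context. Then for each $1\le k\le M\wedge J$ there is a finite constant $C_k>0$ such that for all $r\in(0,1)$ with $r<r_0$, \[ \mathbb{E}_\pi\Big[\big(r^k Z_k^{(r)}\big)^M\Big]\le C_k . \]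
   Context: Network model: there are $J$ single-server FCFS stations $\mathcal J=\{1,\dots,J\}$ with infinite buffers. On a probability space there are $3J$ mutually independent i.i.d. sequences $\{T_{e,j}(i)\}_{i\ge1}$, $\{T_{s,j}(i)\}_{i\ge1}$, $\{\phi^{j}(i)\}_{i\ge1}$, $j\in\mathcal J$, with $T_{e,j}(i),T_{s,j}(i)\ge 0$ and $\mathbb{E}[T_{e,j}(1)]=\mathbb{E}[T_{s,j}(1)]=1$. Constants $\alpha_j\ge0$ (external arrival rates) and $\mu_j>0$ (service rates) are given; $T_{e,j}(i)/\alpha_j$ is the $i$th external interarrival time to station $j$ and $T_{s,j}(i)/\mu_j$ the $i$th service time at station $j$. The routing vector $\phi^j(i)$ equals the unit vector $e^{(k)}\in\mathbb{R}^J$ with probability $P_{jk}$ (job goes to station $k$) and equals $0$ with probability $1-\sum_k P_{jk}$ (job leaves). $P=(P_{jk})$ is substochastic and $I-P$ is invertible (open network). The nominal arrival rates $\lambda_j$ solve $\lambda_j=\alpha_j+\sum_{\ell}\lambda_\ell P_{\ell j}$; they are assumed positive. State: $Z_j(t)$ = number of jobs at station $j$, $R_{e,j}(t)$ = residual time to next external arrival at $j$, $R_{s,j}(t)$ = residual service time of the job in service at $j$ (or service time of next job if $Z_j(t)=0$); $X(t)=(Z(t),R_e(t),R_s(t))\in\mathbb{Z}_+^J\times\mathbb{R}_+^J\times\mathbb{R}_+^J$ is a Markov process with RCLL paths. Multi-scale family: for $r\in(0,1)$ the $r$th network has the same $\alpha_j$, unitized times, and routing, but service rates $\mu_j^{(r)}=\lambda_j+r^j$.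 Stability assumption: for each $r\in(0,1)$, $X^{(r)}$ is positive Harris recurrent with unique stationary distribution $\pi^{(r)}$; $X^{(r)}=(Z^{(r)},R_e^{(r)},R_s^{(r)})$ denotes a random vector with law $\pi^{(r)}$ and $\mathbb{E}_\pi$ denotes expectation under it. The matrix $(w_{jk})_{j,k\in\mathcal J}$ is the unique solution in $[0,1]^{J\times J}$ of $w_{jk}=P_{jk}+\sum_{\ell=1}^{k-1}P_{j\ell}w_{\ell k}$ for all $j,k$; it satisfies $w_{kk}<1$. $a\wedge b=\min(a,b)$. *)

(* Defs.v *)
From HB Require Import structures.
From mathcomp Require Import all_boot all_order all_algebra.
From mathcomp Require Import all_classical all_reals all_analysis.
Import Order.TTheory GRing.Theory Num.Theory.
Import numFieldNormedType.Exports.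
Local Open Scope classical_set_scope.
Local Open Scope ring_scope.

Set Implicit Arguments.
Unset Strict Implicit.
Unset Printing Implicit Defensive.

(* State space  Z_+^J x R^J x R^J  (stations are indexed by 'I_J, i.e.
   station j of the paper is the ordinal j-1).                               *)
Definition state (R : realType) (J : nat) : Type :=
  (('I_J -> nat) * ('I_J -> R) * ('I_J -> R))%type.

Definition Zof {R : realType} {J : nat} (x : state R J) : 'I_J -> nat := x.1.1.
Definition Reof {R : realType} {J : nat} (x : state R J) : 'I_J -> R := x.1.2.
Definition Rsof {R : realType} {J : nat} (x : state R J) : 'I_J -> R := x.2.

Definition valid_state {R : realType} {J : nat} (x : state R J) : Prop :=
  forall j, 0 <= Reof x j /\ 0 <= Rsof x j.

Definition state_gen (R : realType) (J : nat) : set (set (state R J)) :=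
  [set A | (exists (j : 'I_J) (n : nat), A = [set x | Zof x j = n])
        \/ (exists (j : 'I_J) (B : set R), measurable B /\
              A = (fun x : state R J => Reof x j) @^-1` B)
        \/ (exists (j : 'I_J) (B : set R), measurable B /\
              A = (fun x : state R J => Rsof x j) @^-1` B)].

Definition stateM (R : realType) (J : nat) := g_sigma_algebraType (@state_gen R J).

(* Pathwise dynamics.  Given the primitive data of one sample point
   te j n = T_{e,j}(n+1), ts j n = T_{s,j}(n+1), ph j n = phi^j(n+1)
   (ph j n = Some k : the job goes to station k ; None : it leaves),
   the trajectory from an initial state is built event by event.            *)

(* events: inl j = external arrival at j ; inr j = service completion at j *)
Definition ev_enabled {R : realType} {J : nat} (alpha : 'I_J -> R)
  (x : state R J) (e : 'I_J + 'I_J) : bool :=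
  match e with inl j => 0 < alpha j | inr j => (0 < Zof x j)%N end.

Definition ev_time {R : realType} {J : nat} (x : state R J) (e : 'I_J + 'I_J) : R :=
  match e with inl j => Reof x j | inr j => Rsof x j end.

Definition next_event {R : realType} {J : nat} (alpha : 'I_J -> R)
  (x : state R J) : option ('I_J + 'I_J) :=
  [pick e | ev_enabled alpha x e &&
            [forall e', ev_enabled alpha x e' ==> (ev_time x e <= ev_time x e')]].

(* deterministic evolution during s time units without events: residual
   interarrival times decrease (for alpha_j = 0 there are no external
   arrivals and that coordinate is driven to 0), residual service times
   decrease only at busy stations *)
Definition flow {R : realType} {J : nat} (alpha : 'I_J -> R)
  (x : state R J) (s : R) : state R J :=
  (Zof x,
   (fun j => if 0 < alpha j then Reof x j - s else Num.max (Reof x j - s) 0),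
   (fun j => if (0 < Zof x j)%N then Rsof x j - s else Rsof x j)).

Definition updf {A : Type} {J : nat} (f : 'I_J -> A) (j : 'I_J) (v : A) :
  'I_J -> A := fun i => if i == j then v else f i.

(* augmented state: state, number of external arrivals used so far at each
   station, number of service completions so far at each station *)
Definition aug (R : realType) (J : nat) : Type :=
  (state R J * ('I_J -> nat) * ('I_J -> nat))%type.

Definition gjn_step {R : realType} {J : nat} (alpha mu : 'I_J -> R)
  (te ts : 'I_J -> nat -> R) (ph : 'I_J -> nat -> option 'I_J)
  (a : R * aug R J) : option (R * aug R J) :=
  let: (t, (x, ce, cs)) := a in
  match next_event alpha x with
  | None => None
  | Some e =>
    let dt := ev_time x e in
    let y := flow alpha x dt in
    match e with
    | inl j =>
        Some (t + dt,
              ((updf (Zof y) j (Zof y j).+1,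
                updf (Reof y) j (te j (ce j) / alpha j),
                Rsof y),
               updf ce j (ce j).+1, cs))
    | inr j =>
        let z1 := updf (Zof y) j (Zof y j).-1 in
        let z2 := match ph j (cs j) with
                  | Some k => updf z1 k (z1 k).+1
                  | None => z1 end in
        Some (t + dt,
              ((z2, Reof y, updf (Rsof y) j (ts j (cs j) / mu j)),
               ce, updf cs j (cs j).+1))
    end
  end.

Definition gjn_chain {R : realType} {J : nat} (alpha mu : 'I_J -> R)
  (te ts : 'I_J -> nat -> R) (ph : 'I_J -> nat -> option 'I_J)
  (x0 : state R J) (n : nat) : option (R * aug R J) :=
  iter n (fun o => obind (gjn_step alpha mu te ts ph) o)
       (Some (0, (x0, (fun _ => 0%N), (fun _ => 0%N)))).

Definition gjn_path {R : realType} {J : nat} (alpha mu : 'I_J -> R)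
  (te ts : 'I_J -> nat -> R) (ph : 'I_J -> nat -> option 'I_J)
  (x0 : state R J) (t : R) : state R J :=
  let c := gjn_chain alpha mu te ts ph x0 in
  let N := [set n | exists a, c n = Some a /\ a.1 <= t /\
                     (forall b, c n.+1 = Some b -> t < b.1)] in
  match c (xget 0%N N) with
  | Some (tn, (x, _, _)) => flow alpha x (t - tn)
  | None => x0
  end.

Definition Xproc {R : realType} {J : nat} {d : measure_display} {Om : measurableType d}
  (alpha mu : 'I_J -> R) (Te Ts : 'I_J -> nat -> Om -> R)
  (Phi : 'I_J -> nat -> Om -> option 'I_J) (x : state R J) (t : R) (om : Om) :
  state R J :=
  gjn_path alpha mu (fun j n => Te j n om) (fun j n => Ts j n om)
    (fun j n => Phi j n om) x t.

Definition mutually_independent {R : realType} {d : measure_display}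
  {Om : measurableType d} {I : eqType} (P : probability Om R)
  (F : I -> set (set Om)) : Prop :=
  forall (s : seq I) (E : I -> set Om), uniq s ->
    (forall i, i \in s -> F i (E i)) ->
    P (\bigcap_(i in [set i | i \in s]) E i) = (\prod_(i <- s) P (E i))%E.

(* events generated by each primitive random variable; index (c, j, n) :
   c = 0 : T_{e,j}(n+1), c = 1 : T_{s,j}(n+1), c = 2 : phi^j(n+1) *)
Definition prim_events {R : realType} {J : nat} {d : measure_display}
  {Om : measurableType d} (Te Ts : 'I_J -> nat -> Om -> R)
  (Phi : 'I_J -> nat -> Om -> option 'I_J) (i : 'I_3 * 'I_J * nat) :
  set (set Om) :=
  let: (c, j, n) := i in
  if val c == 0%N then [set Te j n @^-1` B | B in [set B : set R | measurable B]]
  else if val c == 1%N then [set Ts j n @^-1` B | B in [set B : set R | measurable B]]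
  else [set Phi j n @^-1` B | B in [set: set (option 'I_J)]].

Definition gjn_primitives {R : realType} {J : nat} {d : measure_display}
  {Om : measurableType d} (P : probability Om R) (Pm : 'M[R]_J)
  (Te Ts : 'I_J -> nat -> Om -> R) (Phi : 'I_J -> nat -> Om -> option 'I_J) :
  Prop :=
  [/\
      (forall j n, measurable_fun setT (Te j n)) /\
      (forall j n, measurable_fun setT (Ts j n)) /\
      (forall j n (A : set (option 'I_J)), measurable (Phi j n @^-1` A)),
      (forall j n om, 0 <= Te j n om) /\ (forall j n om, 0 <= Ts j n om),
      (forall j n (B : set R), measurable B ->
          P (Te j n @^-1` B) = P (Te j 0%N @^-1` B)) /\
      (forall j n (B : set R), measurable B ->
          P (Ts j n @^-1` B) = P (Ts j 0%N @^-1` B)),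
      (forall j, (\int[P]_om (Te j 0%N om)%:E = 1%:E)%E) /\
      (forall j, (\int[P]_om (Ts j 0%N om)%:E = 1%:E)%E) /\
      (forall j n k, P (Phi j n @^-1` [set Some k]) = (Pm j k)%:E) /\
      (forall j n, P (Phi j n @^-1` [set None]) = (1 - \sum_k Pm j k)%:E)
    &
      mutually_independent P (prim_events Te Ts Phi)].

Definition network_data {R : realType} {J : nat} (alpha : 'I_J -> R)
  (Pm : 'M[R]_J) (lambda : 'I_J -> R) : Prop :=
  [/\ forall j k, 0 <= Pm j k,
      forall j, \sum_k Pm j k <= 1,
      (1%:M - Pm) \in unitmx,
      forall j, 0 <= alpha j
    & forall j, lambda j = alpha j + \sum_l lambda l * Pm l j /\ 0 < lambda j].

Definition w_matrix {R : realType} {J : nat} (Pm w : 'M[R]_J) : Prop :=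
  forall j k, 0 <= w j k <= 1 /\
    w j k = Pm j k + \sum_(l < J | (l < k)%N) Pm j l * w l k.

(* r_0 = min over k < j with w_jk <> 0 of ((1 - w_kk)/(J w_jk))^(1/(j-k)),
   (folded with 1, which equals 1 on the empty index set and does not change
   the set of admissible r in (0,1)) *)
Definition r0 {R : realType} {J : nat} (w : 'M[R]_J) : R :=
  \big[Num.min/1]_(j : 'I_J) \big[Num.min/1]_(k : 'I_J | (k < j)%N && (w j k != 0))
     powR ((1 - w k k) / (J%:R * w j k)) ((j - k)%:R)^-1.

(* service rates of the r-th network: mu_j^(r) = lambda_j + r^j (1-based j) *)
Definition mu_r {R : realType} {J : nat} (lambda : 'I_J -> R) (r : R) : 'I_J -> R :=
  fun j => lambda j + r ^+ j.+1.

Definition is_stationary {R : realType} {J : nat} {d : measure_display}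
  {Om : measurableType d} (P : probability Om R) (alpha mu : 'I_J -> R)
  (Te Ts : 'I_J -> nat -> Om -> R) (Phi : 'I_J -> nat -> Om -> option 'I_J)
  (pi : probability (stateM R J) R) : Prop :=
  pi [set x | valid_state x] = 1%:E /\
  forall (A : set (stateM R J)), measurable A -> forall t : R, 0 <= t ->
    pi A = (\int[pi]_x P ((Xproc alpha mu Te Ts Phi x t) @^-1` A))%E.

Definition harris_recurrent {R : realType} {J : nat} {d : measure_display}
  {Om : measurableType d} (P : probability Om R) (alpha mu : 'I_J -> R)
  (Te Ts : 'I_J -> nat -> Om -> R) (Phi : 'I_J -> nat -> Om -> option 'I_J) :
  Prop :=
  exists phi : {measure set (stateM R J) -> \bar R},
    sigma_finite setT phi /\ (0 < phi setT)%E /\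
    forall (A : set (stateM R J)), measurable A -> (0 < phi A)%E ->
      forall x : state R J, valid_state x ->
        {ae P, forall om,
          (\int[lebesgue_measure]_(t in `[0%R, +oo[%classic)
              (\1_A (Xproc alpha mu Te Ts Phi x t om))%:E = +oo)%E}.

Definition stability {R : realType} {J : nat} {d : measure_display}
  {Om : measurableType d} (P : probability Om R) (alpha mu : 'I_J -> R)
  (Te Ts : 'I_J -> nat -> Om -> R) (Phi : 'I_J -> nat -> Om -> option 'I_J)
  (pi : probability (stateM R J) R) : Prop :=
  [/\ harris_recurrent P alpha mu Te Ts Phi,
      is_stationary P alpha mu Te Ts Phi pi
    & forall pi' : probability (stateM R J) R,
        is_stationary P alpha mu Te Ts Phi pi' ->
        forall A, measurable A -> pi' A = pi A].

(* Main.v *)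
(** Fix a station k and put u_j = w_jk for j < k, u_k = 1 and
      V = sum_(j <= k) u_j (Z_j - alpha_j R_(e,j)) + (1 - w_kk) mu_k R_(s,k)
          - sum_(j > k) w_jk mu_j R_(s,j).
    By the equations defining w, the mean increment of V over one unit of time is
      sum_(j > k) w_jk r^j - (1 - w_kk) r^k + (1 - w_kk) mu_k P(H),
    where H is the event that station k is empty at some time of the unit interval; for
    r < r_0 the first two terms are at most - (1 - w_kk) r^k / J.  On H, the positive part
    V^+ is bounded by the queues at the stations j < k, the number of services at k during
    the unit interval and the residual service time at k if k is idle.  A Taylor expansion
    of (V^+)^(M+1) and stationarity therefore give
      r^k E (V^+)^M <= C (r^(-k(M-1)) + sum_(j < k) E Z_j^M + 1),
    and induction on k concludes because r^(-jM) <= r^(-k(M-1)) for j < k <= M.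

    The increments over a unit of time have moments bounded uniformly in the initial state
    and in r: whether the n-th primitive variable of a stream is consumed before a given
    time does not depend on that variable, so Wald's identity applies to every stream.
    The same independence gives the stationary moments of the residual times. *)
Require Import Defs.
From HB Require Import structures.
From mathcomp Require Import all_boot all_order all_algebra.
From mathcomp Require Import all_classical all_reals all_analysis.
From mathcomp Require Import measurable_realfun.
From mathcomp Require Import lra ring zify.
Import Order.TTheory GRing.Theory Num.Theory.
Import numFieldNormedType.Exports.
Import HBNNSimple.
Local Open Scope classical_set_scope.
Local Open Scope ring_scope.

Set Implicit Arguments.
Unset Strict Implicit.
Unset Printing Implicit Defensive.

(** * Event-by-event dynamics *)

(** The residual times in [V] are compensators. On average a completion at j < k leaves the weighted
    job count unchanged, because u_j = sum_l P_jl u_l there. A completion at k loses 1 - w_kk; the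
    term with R_(s,k) converts completions into elapsed time, exactly while k stays busy and with an
    error of at most mu_k otherwise, which is where H comes from. A completion at j > k gains w_jk;
    the term with R_(s,j) bounds these gains by those of a server that never idles, so idleness
    above k only helps. External residuals occur only for j <= k, which matches the moments that are
    available. Two obstacles shape the rest. Integrability of V^+ under the stationary law is not
    known beforehand, so a drift inequality cannot simply be integrated. And the residual service
    time of an idle station stands still, so no drift over one unit of time controls it: its moments
    come from letting time tend to infinity, once every station is known to complete a service
    almost surely, which in turn follows from the traffic equations. *)

Notation event J := ('I_J + 'I_J)%type.

Definition clk {R : realType} {J : nat} (a : R * aug R J) : R := a.1.
Definition stt {R : realType} {J : nat} (a : R * aug R J) : state R J := a.2.1.1.
Definition cnt {R : realType} {J : nat} (a : R * aug R J) (e : event J) : nat :=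
  match e with inl j => a.2.1.2 j | inr j => a.2.2 j end.
Definition rate {R : realType} {J : nat} (alpha mu : 'I_J -> R) (e : event J) : R :=
  match e with inl j => alpha j | inr j => mu j end.
Definition dat {A : Type} {J : nat} (te ts : 'I_J -> A) (e : event J) : A :=
  match e with inl j => te j | inr j => ts j end.

Definition fire {R : realType} {J : nat} (alpha mu : 'I_J -> R)
  (te ts : 'I_J -> nat -> R) (ph : 'I_J -> nat -> option 'I_J)
  (e : event J) (a : R * aug R J) : R * aug R J :=
  let dt := ev_time (stt a) e in
  let y := flow alpha (stt a) dt in
  match e with
  | inl j => (clk a + dt,
      ((updf (Zof y) j (Zof y j).+1,
        updf (Reof y) j (te j (a.2.1.2 j) / alpha j), Rsof y),
        updf a.2.1.2 j (a.2.1.2 j).+1, a.2.2))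
  | inr j =>
      let z1 := updf (Zof y) j (Zof y j).-1 in
      let z2 := if ph j (a.2.2 j) is Some k then updf z1 k (z1 k).+1 else z1 in
      (clk a + dt,
        ((z2, Reof y, updf (Rsof y) j (ts j (a.2.2 j) / mu j)),
         a.2.1.2, updf a.2.2 j (a.2.2 j).+1))
  end.

(* As soon as one external arrival stream is active some event is always enabled, so the
   option in [gjn_chain] is never [None]; [gC] is the resulting total chain. *)
Definition gstep {R : realType} {J : nat} (alpha mu : 'I_J -> R)
  (te ts : 'I_J -> nat -> R) (ph : 'I_J -> nat -> option 'I_J)
  (a : R * aug R J) : R * aug R J :=
  if next_event alpha (stt a) is Some e then fire alpha mu te ts ph e a else a.

Definition gC {R : realType} {J : nat} (alpha mu : 'I_J -> R)
  (te ts : 'I_J -> nat -> R) (ph : 'I_J -> nat -> option 'I_J)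
  (x0 : state R J) (n : nat) : R * aug R J :=
  iter n (gstep alpha mu te ts ph) (0, (x0, fun=> 0%N, fun=> 0%N)).

(** The interval is half-open so that, among several events at the same time [t], the last one is
    selected; this is what makes the index unique. *)
Definition gidx {R : realType} {J : nat} (C : nat -> R * aug R J) (t : R) (n : nat) :=
  clk (C n) <= t < clk (C n.+1).

Section Chain.
Context {R : realType} {J : nat} (alpha mu : 'I_J -> R).
Context (te ts : 'I_J -> nat -> R) (ph : 'I_J -> nat -> option 'I_J).
Hypothesis alpha_ge0 : forall j, 0 <= alpha j.
Hypothesis mu_gt0 : forall j, 0 < mu j.
Hypothesis alpha_pos : exists i, 0 < alpha i.

Local Notation rate := (rate alpha mu).
Local Notation dat := (dat te ts).
Local Notation fire := (fire alpha mu te ts ph).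
Local Notation gstep := (gstep alpha mu te ts ph).
Local Notation gC := (gC alpha mu te ts ph).

Lemma next_eventP (x : state R J) : exists2 e, next_event alpha x = Some e &
  ev_enabled alpha x e /\
  (forall e', ev_enabled alpha x e' -> ev_time x e <= ev_time x e').
Proof.
rewrite /next_event; case: pickP => [e /andP[He /forallP Hm]|H].
  by exists e => //; split => // e' He'; have := Hm e'; rewrite He'.
case: alpha_pos => i Hi.
have Hin : ev_enabled alpha x (inl i) by [].
case: (@Order.TotalTheory.arg_minP _ _ _ (inl i) (ev_enabled alpha x) (ev_time x) Hin) => e He Hm.
have /negP[] := negbT (H e); rewrite He /=.
by apply/forallP => e'; apply/implyP => /Hm.
Qed.

Lemma gjn_stepE a : gjn_step alpha mu te ts ph a = Some (gstep a).
Proof.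
case: a => t [[x ce] cs]; rewrite /gjn_step /gstep /stt /=.
have [e -> _] := next_eventP x.
by case: e => j.
Qed.

Lemma gjn_chainE x0 n : gjn_chain alpha mu te ts ph x0 n = Some (gC x0 n).
Proof. by elim: n => // n IH; rewrite /gjn_chain iterS -/(gjn_chain _ _ _ _ _ _ _) IH /= gjn_stepE. Qed.

Lemma gCS x0 n : gC x0 n.+1 = gstep (gC x0 n). Proof. by []. Qed.

Lemma gstepP a : exists e, [/\ next_event alpha (stt a) = Some e,
   gstep a = fire e a, ev_enabled alpha (stt a) e &
   forall e', ev_enabled alpha (stt a) e' -> ev_time (stt a) e <= ev_time (stt a) e'].
Proof.
by have [e E [? ?]] := next_eventP (stt a); exists e; split=> //; rewrite /gstep E.
Qed.

Lemma clk_fire e a : clk (fire e a) = clk a + ev_time (stt a) e.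
Proof. by case: e. Qed.

Lemma cnt_fire e a e' : cnt (fire e a) e' = (cnt a e' + (e' == e))%N.
Proof.
case: e => i; case: e' => j; rewrite /cnt /= ?addn0 // /updf.
- rewrite (_ : (inl j == inl i) = (j == i)) //.
  by case: eqP => [->|_]; rewrite ?addn1 ?addn0.
- rewrite (_ : (inr j == inr i) = (j == i)) //.
  by case: eqP => [->|_]; rewrite ?addn1 ?addn0.
Qed.

Lemma ev_time_fire e a e' : ev_time (stt (fire e a)) e' =
  if e' == e then dat e (cnt a e) / rate e
  else ev_time (flow alpha (stt a) (ev_time (stt a) e)) e'.
Proof.
by case: e => i; case: e' => j.
Qed.

(** Additive form, since subtraction in [nat] truncates; enabledness makes [.-1] a true predecessor.
    The identity also covers a job routed back to the station that it leaves. *)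
Lemma Zof_fire e a j : ev_enabled alpha (stt a) e ->
  (Zof (stt (fire e a)) j + (e == inr j) = Zof (stt a) j + (e == inl j) +
    (if e is inr i then (ph i (cnt a e) == Some j) else false))%N.
Proof.
case: e => i /= He.
  rewrite /Zof /= /updf addn0.
  rewrite (_ : (inl i == inl j) = (j == i)); last by rewrite eq_sym.
  by case: eqP => [->|_]; rewrite ?addn1 ?addn0.
rewrite /cnt /= addn0.
have E k : ((updf (Zof (stt a)) i (Zof (stt a) i).-1) k + (inr i == inr k :> event J) = Zof (stt a) k)%N.
  rewrite /updf (_ : (inr i == inr k) = (k == i)); last by rewrite eq_sym.
  by case: eqP => [->|_]; rewrite ?addn1 ?prednK ?addn0.
rewrite -(E j); case: (ph i _) => [k|] /=; rewrite {1}/Zof /=; last by rewrite addn0.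
rewrite {1}/updf (_ : (Some k == Some j) = (j == k)); last by rewrite eq_sym.
by case: eqP => [->|_]; rewrite ?addn1 ?addSn ?addn0.
Qed.

Lemma ev_time_flow x s e : ev_enabled alpha x e ->
  ev_time (flow alpha x s) e = ev_time x e - s.
Proof. by case: e => j /= H; rewrite /Reof /Rsof /= H. Qed.

Lemma rate_gt0 x e : ev_enabled alpha x e -> 0 < rate e.
Proof. by case: e => j //= _; exact: mu_gt0. Qed.

Lemma rate_ge0 e : 0 <= rate e.
Proof. by case: e => j /=; [exact: alpha_ge0|exact: ltW (mu_gt0 j)]. Qed.

(** Multiplication by the rate treats all clocks alike: a stream of rate 0 contributes nothing, the
    service clock of an empty station is frozen, and every other clock attains the lower bound. *)
Lemma rate_ev_time_flow x s e : 0 <= s ->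
  rate e * ev_time x e - rate e * s <= rate e * ev_time (flow alpha x s) e <= rate e * ev_time x e.
Proof.
move=> s0; have [He|He] := boolP (ev_enabled alpha x e).
  rewrite ev_time_flow // mulrBr lexx /= gerBl mulr_ge0 //; exact: rate_ge0.
case: e He => j /=; rewrite /Reof /Rsof /=.
  move=> aj; rewrite (_ : alpha j = 0) ?mul0r ?subr0 ?lexx //.
  by apply/eqP; rewrite eq_le alpha_ge0 leNgt aj.
move=> /negbTE ->; rewrite lexx andbT gerBl mulr_ge0 //; exact: ltW.
Qed.

Section Invariants.
Variable x0 : state R J.
Hypothesis x0_valid : valid_state x0.
Hypothesis te_ge0 : forall j n, 0 <= te j n.
Hypothesis ts_ge0 : forall j n, 0 <= ts j n.

Local Notation C := (gC x0).

Lemma dat_ge0 e n : 0 <= dat e n.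
Proof. by case: e => j /=. Qed.

(** A time budget in unitized time. The initial residual runs out at the first firing, so after
    [m.+1] firings the data [0, ..., m-1] have elapsed and datum [m] is still running; this is why
    the fourth clause omits the last datum. The second clause is only an inequality because a
    stopped clock uses up no time. *)
Definition inv_at (t : R) (y : state R J) (c : event J -> nat) (e : event J) : Prop :=
  [/\ 0 <= ev_time y e,
      rate e * ev_time x0 e - rate e * t + \sum_(i < c e) dat e i <= rate e * ev_time y e,
      rate e * ev_time y e <= (if c e is m.+1 then dat e m else rate e * ev_time x0 e)
    & forall m, c e = m.+1 ->
       rate e * ev_time x0 e + \sum_(i < m) dat e i <= rate e * t].

Lemma inv_flow t y c s : 0 <= s ->
  (forall e, ev_enabled alpha y e -> s <= ev_time y e) ->
  (forall e, inv_at t y c e) -> forall e, inv_at (t + s) (flow alpha y s) c e.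
Proof.
move=> s0 Hs H e; have [h1 h2 h3 h4] := H e.
have /andP[f1 f2] := rate_ev_time_flow y e s0.
have rs : 0 <= rate e * s by rewrite mulr_ge0 // rate_ge0.
split; rewrite ?mulrDr.
- have [He|He] := boolP (ev_enabled alpha y e).
    by rewrite ev_time_flow // subr_ge0 Hs.
  case: e h1 He {H h2 h3 h4 f1 f2 rs} => j /=; rewrite /Reof /Rsof /=.
    by move=> _ /negbTE ->; rewrite le_max lexx orbT.
  by move=> h /negbTE ->.
- lra.
- exact: le_trans h3.
- by move=> m /h4; lra.
Qed.

Lemma inv_fire a e : ev_enabled alpha (stt a) e ->
  (forall e', inv_at (clk a + ev_time (stt a) e) (flow alpha (stt a) (ev_time (stt a) e)) (cnt a) e') ->
  forall e', inv_at (clk (fire e a)) (stt (fire e a)) (cnt (fire e a)) e'.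
Proof.
move=> He H e'; have [h1 h2 h3 h4] := H e'.
rewrite clk_fire /inv_at ev_time_fire cnt_fire.
have [E|ne] := eqVneq e' e; last by rewrite addn0; split.
rewrite {e'}E in h1 h2 h3 h4 *.
have rp := rate_gt0 He.
have rn : rate e != 0 by rewrite gt_eqF.
have E0 : ev_time (flow alpha (stt a) (ev_time (stt a) e)) e = 0.
  by rewrite ev_time_flow // subrr.
rewrite E0 mulr0 in h2.
rewrite addn1 big_ord_recr /=.
have Er : rate e * (dat e (cnt a e) / rate e) = dat e (cnt a e).
  by rewrite mulrCA divff ?mulr1.
rewrite Er; split.
- by rewrite divr_ge0 ?dat_ge0 // ltW.
- rewrite addrA; move: h2; lra.
- by [].
- by move=> m [<-]; move: h2; lra.
Qed.

Lemma inv_gC n e : inv_at (clk (C n)) (stt (C n)) (cnt (C n)) e.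
Proof.
elim: n e => [|n IH] e.
  rewrite /inv_at /=; have -> : cnt (C 0) e = 0%N by case: e.
  rewrite big_ord0 /clk /= mulr0 subr0 addr0 lexx; split=> //.
  by case: e => j; have [] := x0_valid j.
rewrite gCS; have [f [_ -> Hf Hm]] := gstepP (C n).
apply: inv_fire => //; apply: inv_flow => //.
by have [] := IH f.
Qed.

Lemma clk_leS n : clk (C n) <= clk (C n.+1).
Proof.
rewrite gCS; have [f [_ -> Hf Hm]] := gstepP (C n).
by rewrite clk_fire lerDl; have [] := inv_gC n f.
Qed.

Lemma clk_le m n : (m <= n)%N -> clk (C m) <= clk (C n).
Proof. by apply: (homo_leq (fun x => lexx x) le_trans clk_leS). Qed.

Lemma cnt_leS n e : (cnt (C n) e <= cnt (C n.+1) e)%N.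
Proof.
rewrite gCS; have [f [_ -> Hf Hm]] := gstepP (C n).
by rewrite cnt_fire leq_addr.
Qed.

Lemma cnt_le m n e : (m <= n)%N -> (cnt (C m) e <= cnt (C n) e)%N.
Proof. move=> mn; exact: (@homo_leq _ (fun n => cnt (C n) e) leq (@leqnn) leq_trans (fun n => cnt_leS n e)). Qed.

(** Each step fires exactly one event, so bounds on the counts of all streams bound the number of
    steps. Nonexplosion rests on this. *)
Lemma sum_cnt n : (\sum_e cnt (C n) e = n)%N.
Proof.
elim: n => [|n IH]; first by rewrite big1 // => -[].
rewrite gCS; have [f [_ -> Hf Hm]] := gstepP (C n).
rewrite (eq_bigr _ (fun e _ => cnt_fire f (C n) e)) big_split /= IH.
by rewrite (bigD1 f) //= eqxx big1 ?addn1 // => i /negbTE ->.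
Qed.

Lemma gidx_unique t m n : gidx C t m -> gidx C t n -> m = n.
Proof.
move=> /andP[a b] /andP[c d]; apply/eqP; rewrite eqn_leq; apply/andP; split.
  rewrite leqNgt; apply/negP => /clk_le h; by move: (lt_le_trans d h); rewrite ltNge a.
rewrite leqNgt; apply/negP => /clk_le h; by move: (lt_le_trans b h); rewrite ltNge c.
Qed.

Lemma gidx_exists t n : 0 <= t -> t < clk (C n) -> exists m, gidx C t m.
Proof.
move=> t0; elim: n => [|n IH]; first by rewrite /clk /= ltNge t0.
move=> h; have [/IH//|le] := ltP t (clk (C n)).
by exists n; rewrite /gidx le h.
Qed.

Lemma gjn_pathE t n : gidx C t n ->
  gjn_path alpha mu te ts ph x0 t = flow alpha (stt (C n)) (t - clk (C n)).
Proof.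
move=> H; rewrite /gjn_path.
set N := (X in xget _ X).
have NE m : N m <-> gidx C t m.
  rewrite /N /gidx /=; split.
    case=> a [Ea [at1 Hb]]; move: Ea at1; rewrite gjn_chainE => -[<-] -> /=.
    exact: (Hb (C m.+1) (gjn_chainE x0 m.+1)).
  move=> /andP[h1 h2]; exists (C m); rewrite gjn_chainE; split=> //; split=> // b Hb.
  by move: Hb; rewrite /= gjn_stepE => -[<-].
case: xgetP => [m _ /NE Hm|Hn]; last by case: (Hn n); apply/NE.
rewrite gjn_chainE (gidx_unique Hm H).
by rewrite /clk /stt; case: (C n) => tn [[x ce] cs].
Qed.

Lemma inv_path t n e : gidx C t n ->
  inv_at t (gjn_path alpha mu te ts ph x0 t) (cnt (C n)) e.
Proof.
move=> H; rewrite (gjn_pathE H); move/andP: H => [h1 h2].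
have -> : t = clk (C n) + (t - clk (C n)) by rewrite addrC subrK.
rewrite {2}(_ : clk (C n) + (t - clk (C n)) = t); last by rewrite addrC subrK.
apply: inv_flow; [by rewrite subr_ge0| |exact: inv_gC].
(* The next event comes after [t], so no enabled clock runs out between the last event and [t]. *)
move=> f Hf; move: h2; rewrite gCS; have [g [_ -> Hg Hm]] := gstepP (C n).
rewrite clk_fire => h2; have := Hm _ Hf; lra.
Qed.

Lemma Zof_balance n j : (Zof (stt (C n)) j + cnt (C n) (inr j) =
  Zof x0 j + cnt (C n) (inl j) + \sum_l \sum_(i < cnt (C n) (inr l)) (ph l i == Some j))%N.
Proof.
elim: n => [|n IH].
  rewrite !addn0 big1 ?addn0 // => l _; by rewrite /cnt /= big_ord0.
rewrite gCS; have [f [_ -> Hf Hm]] := gstepP (C n).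
have Hz := Zof_fire j Hf.
rewrite !cnt_fire.
have -> : (\sum_l \sum_(i < cnt (fire f (C n)) (inr l)) (ph l i == Some j) =
  \sum_l \sum_(i < cnt (C n) (inr l)) (ph l i == Some j) +
  (if f is inr i then (ph i (cnt (C n) f) == Some j) else false))%N.
  case: f Hf Hm Hz => i Hf Hm Hz.
    by rewrite addn0.
  rewrite (bigD1 i) // [in RHS](bigD1 i) // cnt_fire eqxx addn1 big_ord_recr /=.
  rewrite -!addnA; congr (_ + _)%N; rewrite addnC; congr (_ + _)%N.
  apply: eq_bigr => l li; by rewrite /updf (negbTE li).
rewrite (eq_sym (inl j) f) (eq_sym (inr j) f).
move: Hz IH; lia.
Qed.

(** As long as the clock of [e] is never stopped, unitized residual plus elapsed time minus data
    drawn is conserved; the budget inequality of [inv_at] becomes an equality. *)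
Lemma ev_time_enabled_from m n e : (m <= n)%N ->
  (forall p, (m <= p < n)%N -> ev_enabled alpha (stt (C p)) e) ->
  rate e * ev_time (stt (C n)) e + rate e * clk (C n) - \sum_(i < cnt (C n) e) dat e i =
  rate e * ev_time (stt (C m)) e + rate e * clk (C m) - \sum_(i < cnt (C m) e) dat e i.
Proof.
elim: n => [|n IH]; first by rewrite leqn0 => /eqP ->.
rewrite leq_eqVlt => /orP[/eqP -> //|]; rewrite ltnS => mn H.
rewrite -IH // => [|p /andP[mp pn]]; last by apply: H; rewrite mp ltnW.
have He : ev_enabled alpha (stt (C n)) e by apply: H; rewrite mn /=.
rewrite gCS; have [f [_ -> Hf Hm]] := gstepP (C n).
rewrite ev_time_fire cnt_fire clk_fire.
case: eqVneq => [E|ne].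
  rewrite -E addn1 big_ord_recr /= [_ * (_ / _)]mulrCA divff ?mulr1; last first.
    by rewrite gt_eqF // (rate_gt0 He).
  by rewrite mulrDr; lra.
by rewrite addn0 ev_time_flow // mulrBr mulrDr; lra.
Qed.

Lemma ev_time_always_enabled n e :
  (forall m, (m < n)%N -> ev_enabled alpha (stt (C m)) e) ->
  rate e * ev_time (stt (C n)) e =
  rate e * ev_time x0 e - rate e * clk (C n) + \sum_(i < cnt (C n) e) dat e i.
Proof.
move=> H; have := @ev_time_enabled_from 0 n e (leq0n n) H.
have -> : cnt (C 0) e = 0%N by case: e {H}.
by rewrite big_ord0 /clk /= mulr0; lra.
Qed.

Lemma ev_time_path_always_enabled t n e : gidx C t n ->
  (forall m, (m <= n)%N -> ev_enabled alpha (stt (C m)) e) ->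
  rate e * ev_time (gjn_path alpha mu te ts ph x0 t) e =
  rate e * ev_time x0 e - rate e * t + \sum_(i < cnt (C n) e) dat e i.
Proof.
move=> H He; rewrite (gjn_pathE H) ev_time_flow; last exact: He.
by rewrite mulrBr ev_time_always_enabled => [|m /ltnW/He//]; lra.
Qed.

(** Without a completion a queue can only grow, so a station that starts busy stays busy. *)
Lemma no_event_enabled n e : cnt (C n) e = 0%N -> ev_enabled alpha x0 e ->
  forall m, (m <= n)%N -> ev_enabled alpha (stt (C m)) e.
Proof.
case: e => j c0 He m mn; first exact: He.
move: He; rewrite /ev_enabled.
have := Zof_balance m j; have := cnt_le (inr j) mn; rewrite c0 leqn0 => /eqP ->.
lia.
Qed.

End Invariants.
End Chain.

(* Whether [hit t e m] holds does not depend on the [m]-th datum of the stream [e]; this is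
   what Wald's identity needs. *)
Definition hit {R : realType} {J : nat} (C : nat -> R * aug R J) (t : R)
  (e : event J) (m : nat) : Prop :=
  exists n, clk (C n) <= t /\ (m < cnt (C n) e)%N.

(* Station [j] is empty at [t] after [m.+1] completions, so its residual service time is the
   [m]-th service datum; the event itself does not depend on that datum. *)
Definition idle_after {R : realType} {J : nat} (C : nat -> R * aug R J) (t : R)
  (j : 'I_J) (m : nat) : Prop :=
  exists n, [/\ gidx C t n, cnt (C n) (inr j) = m.+1 & Zof (stt (C n)) j = 0%N].

Section Hits.
Context {R : realType} {J : nat} (alpha mu : 'I_J -> R).
Context (te ts : 'I_J -> nat -> R) (ph : 'I_J -> nat -> option 'I_J).
Hypothesis alpha_ge0 : forall j, 0 <= alpha j.
Hypothesis mu_gt0 : forall j, 0 < mu j.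
Hypothesis alpha_pos : exists i, 0 < alpha i.
Variable x0 : state R J.
Hypothesis x0_valid : valid_state x0.
Hypothesis te_ge0 : forall j n, 0 <= te j n.
Hypothesis ts_ge0 : forall j n, 0 <= ts j n.

Local Notation rate := (rate alpha mu).
Local Notation dat := (dat te ts).
Local Notation C := (gC alpha mu te ts ph x0).
Local Notation X := (gjn_path alpha mu te ts ph x0).

Lemma hitE t n e m : gidx C t n -> hit C t e m <-> (m < cnt (C n) e)%N.
Proof.
move=> /andP[h1 h2]; split; last by exists n.
move=> [k [kt mk]]; apply: leq_trans mk _; apply: cnt_le => //.
rewrite leqNgt; apply/negP => nk.
have := clk_le ph alpha_ge0 mu_gt0 alpha_pos x0_valid te_ge0 ts_ge0 nk.
by move=> /le_trans/(_ kt); rewrite leNgt h2.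
Qed.

Lemma hit_sum t e m : hit C t e m ->
  rate e * ev_time x0 e + \sum_(i < m) dat e i <= rate e * t.
Proof.
move=> [n [nt mn]].
have [_ _ _ h4] := inv_gC ph alpha_ge0 mu_gt0 alpha_pos x0_valid te_ge0 ts_ge0 n e.
move: mn h4; case: (cnt (C n) e) => // p; rewrite ltnS => mp /(_ p erefl) h.
apply: (@le_trans _ _ (rate e * clk (C n))); last by rewrite ler_wpM2l // rate_ge0.
apply: le_trans h; rewrite lerD2l.
rewrite -!(big_mkord xpredT (dat e)) (@big_cat_nat _ _ _ m 0 p) //= lerDl sumr_ge0 // => i _.
exact: dat_ge0.
Qed.

Lemma hit_anti t e m n : (m <= n)%N -> hit C t e n -> hit C t e m.
Proof. by move=> mn [k [? h]]; exists k; split => //; exact: leq_ltn_trans h. Qed.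

Lemma hit_mono t t' e m : t <= t' -> hit C t e m -> hit C t' e m.
Proof. by move=> tt' [k [h ?]]; exists k; split => //; exact: le_trans tt'. Qed.

(** If the clock never passed [t], every count would remain below its bound at all steps, whereas
    the total count equals the number of steps. *)
Lemma gidx_nonexplosive t : 0 <= t -> (forall e, exists m, ~ hit C t e m) ->
  exists n, gidx C t n.
Proof.
move=> t0 H.
have [B HB] : exists B, forall e, ~ hit C t e (B e).
  by have [B HB] := boolp.choice H; exists B.
case: (boolp.pselect (exists n, t < clk (C n))) => [[n]|nE].
  exact: gidx_exists.
exfalso; set n := (\sum_e B e).+1.
have : (\sum_e cnt (C n) e <= \sum_e B e)%N.
  apply: leq_sum => e _; rewrite leqNgt; apply/negP => h.
  apply: (HB e); exists n; split => //.
  by rewrite leNgt; apply/negP => h'; apply: nE; exists n.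
by rewrite sum_cnt // /n ltnn.
Qed.

Lemma path_valid t n : gidx C t n -> valid_state (X t).
Proof.
move=> H j.
have I e := inv_path alpha_ge0 mu_gt0 alpha_pos x0_valid te_ge0 ts_ge0 e H.
by split; [have [] := I (inl j)|have [] := I (inr j)].
Qed.

Lemma emptied_count n m k : (m <= n)%N -> Zof (stt (C m)) k = 0%N ->
  (Zof x0 k <= cnt (C n) (inr k))%N.
Proof.
move=> mn z0; have := Zof_balance mu te ts ph alpha_pos x0 m k; rewrite z0 add0n => E.
by apply: leq_trans (cnt_le mu te ts ph alpha_pos x0 (inr k) mn); rewrite E -addnA leq_addr.
Qed.

End Hits.

(** * Insensitivity of [hit] and [idle_after] to the datum of their own index *)

Section Invariance.
Context {R : realType} {J : nat} (alpha mu : 'I_J -> R).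
Context (te ts te' ts' : 'I_J -> nat -> R) (ph ph' : 'I_J -> nat -> option 'I_J).
Hypothesis alpha_ge0 : forall j, 0 <= alpha j.
Hypothesis mu_gt0 : forall j, 0 < mu j.
Hypothesis alpha_pos : exists i, 0 < alpha i.
Variable x0 : state R J.
Hypothesis x0_valid : valid_state x0.
Hypothesis te_ge0 : forall j n, 0 <= te j n.
Hypothesis ts_ge0 : forall j n, 0 <= ts j n.
Local Notation C := (gC alpha mu te ts ph x0).
Local Notation C' := (gC alpha mu te' ts' ph' x0).
Variables (e0 : event J) (n0 : nat).
Hypothesis Hte : forall j n, (inl j, n) <> (e0, n0) -> te j n = te' j n.
Hypothesis Hts : forall j n, (inr j, n) <> (e0, n0) -> ts j n = ts' j n.

Section HitInvariance.
Hypothesis Hph : forall j n, (inr j, n) <> (e0, n0) -> ph j n = ph' j n.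

Lemma fire_agree e a : (e, cnt a e) <> (e0, n0) ->
  fire alpha mu te ts ph e a = fire alpha mu te' ts' ph' e a.
Proof.
case: e => j; rewrite /cnt /fire => ne; first by rewrite (Hte ne).
by rewrite (Hts ne) (Hph ne).
Qed.

(** Entry [n0] of stream [e0] is read only at the firing that raises the count to [n0.+1]; up to
    that firing both data sets drive the same chain. *)
Lemma gC_agree m : (cnt (C m) e0 <= n0)%N -> C m = C' m.
Proof.
elim: m => // m IH h.
have {}IH := IH (leq_trans (cnt_leS mu te ts ph alpha_pos x0 m e0) h).
move: h; rewrite !gCS -IH.
have [f [Ef -> Hf Hm]] := gstepP mu te ts ph alpha_pos (C m).
rewrite cnt_fire => h; rewrite /gstep Ef; apply: fire_agree.
by move=> [E1 E2]; move: h; rewrite -E1 E2 eqxx addn1 ltnn.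
Qed.

Lemma hit_agree t : hit C t e0 n0 -> hit C' t e0 n0.
Proof.
move=> [n [nt hn]].
have ex : exists n, (n0 < cnt (C n) e0)%N by exists n.
(* At the first index where the count exceeds [n0], the preceding states coincide, and the time of a
   firing is determined by the state before it, not by the datum drawn at it. *)
case: (ex_minnP ex) => -[|m] h1 hmin; first by case: e0 h1 => j.
have le : (cnt (C m) e0 <= n0)%N.
  by rewrite leqNgt; apply/negP => /hmin; rewrite ltnn.
have cm : clk (C m.+1) <= t.
  by apply: le_trans nt; apply: clk_le => //; exact: hmin.
exists m.+1; move: cm h1; rewrite !gCS -(gC_agree le).
have [f [Ef -> Hf Hm]] := gstepP mu te ts ph alpha_pos (C m).
by rewrite /gstep Ef !cnt_fire !clk_fire.
Qed.

End HitInvariance.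

Section IdleInvariance.
Variable j : 'I_J.
Hypothesis e0E : e0 = inr j.
Hypothesis phE : ph = ph'.

(** The datum drawn at a completion of [j] enters only the residual service time of [j], which is
    frozen and has no influence on the evolution while [j] is empty. *)
Definition same_but_service (a b : R * aug R J) : Prop :=
  [/\ clk a = clk b, Zof (stt a) = Zof (stt b), Reof (stt a) = Reof (stt b),
      (forall i, i != j -> Rsof (stt a) i = Rsof (stt b) i) &
      a.2.1.2 = b.2.1.2 /\ a.2.2 = b.2.2].

Lemma same_ev_time a b e : same_but_service a b -> e != inr j ->
  ev_time (stt a) e = ev_time (stt b) e.
Proof.
case: e => i [h1 h2 h3 h4 _] ne /=; first by rewrite h3.
by apply: h4; apply: contra ne => /eqP ->.
Qed.

Lemma same_next_event a b : same_but_service a b -> Zof (stt a) j = 0%N ->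
  next_event alpha (stt a) = next_event alpha (stt b).
Proof.
move=> S Z0; have [h1 h2 h3 h4 _] := S.
have En e : ev_enabled alpha (stt a) e = ev_enabled alpha (stt b) e.
  by case: e => i //=; rewrite h2.
have Et e : ev_enabled alpha (stt a) e -> ev_time (stt a) e = ev_time (stt b) e.
  by move=> He; apply: same_ev_time => //; apply/eqP => E; move: He; rewrite E /= Z0.
apply: eq_pick => e /=; rewrite -En; case: (boolP (ev_enabled _ _ e)) => //= He.
apply: eq_forallb => e'; rewrite -En; case: (boolP (ev_enabled _ _ e')) => //= He'.
by rewrite !Et.
Qed.

Lemma same_fire a b e : same_but_service a b -> e != inr j ->
  same_but_service (fire alpha mu te ts ph e a) (fire alpha mu te' ts' ph' e b).
Proof.
move=> S ne; have [h1 h2 h3 h4 [h5 h6]] := S.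
have Ht := same_ev_time S ne.
have Fz s : Zof (flow alpha (stt a) s) = Zof (flow alpha (stt b) s) by [].
have Fe s : Reof (flow alpha (stt a) s) = Reof (flow alpha (stt b) s).
  by rewrite /Reof /= h3.
have Fs s i : i != j -> Rsof (flow alpha (stt a) s) i = Rsof (flow alpha (stt b) s) i.
  by move=> ij; rewrite /Rsof /= h2 h4.
case: e ne Ht => i ne /= Ht.
  have dE : te i (b.2.1.2 i) = te' i (b.2.1.2 i) by apply: Hte; rewrite e0E.
  split.
  - by change (clk a + Reof (stt a) i = clk b + Reof (stt b) i); rewrite h1 Ht.
  - change (updf (Zof (stt a)) i (Zof (stt a) i).+1 = updf (Zof (stt b)) i (Zof (stt b) i).+1).
    by rewrite h2.
  - change (updf (Reof (flow alpha (stt a) (Reof (stt a) i))) i (te i (a.2.1.2 i) / alpha i)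
      = updf (Reof (flow alpha (stt b) (Reof (stt b) i))) i (te' i (b.2.1.2 i) / alpha i)).
    by rewrite Ht Fe h5 dE.
  - move=> k kj; change (Rsof (flow alpha (stt a) (Reof (stt a) i)) k =
      Rsof (flow alpha (stt b) (Reof (stt b) i)) k).
    by rewrite Ht Fs.
  - by rewrite /= h5 h6.
have ij : i != j by apply: contra ne => /eqP ->.
have dE : ts i (b.2.2 i) = ts' i (b.2.2 i).
  by apply: Hts; rewrite e0E => -[E]; rewrite E eqxx in ij.
split.
- by change (clk a + Rsof (stt a) i = clk b + Rsof (stt b) i); rewrite h1 Ht.
- change ((let z1 := updf (Zof (stt a)) i (Zof (stt a) i).-1 in
      if ph i (a.2.2 i) is Some k then updf z1 k (z1 k).+1 else z1) =
    (let z1 := updf (Zof (stt b)) i (Zof (stt b) i).-1 in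
      if ph' i (b.2.2 i) is Some k then updf z1 k (z1 k).+1 else z1)).
  by rewrite h2 h6 phE.
- change (Reof (flow alpha (stt a) (Rsof (stt a) i)) =
      Reof (flow alpha (stt b) (Rsof (stt b) i))).
  by rewrite Ht Fe.
- move=> k kj; change (updf (Rsof (flow alpha (stt a) (Rsof (stt a) i))) i (ts i (a.2.2 i) / mu i) k
      = updf (Rsof (flow alpha (stt b) (Rsof (stt b) i))) i (ts' i (b.2.2 i) / mu i) k).
  by rewrite /updf Ht Fs // h6 dE.
- by rewrite /= h5 h6.
Qed.

Lemma same_fire_service a :
  same_but_service (fire alpha mu te ts ph (inr j) a) (fire alpha mu te' ts' ph' (inr j) a).
Proof.
rewrite -phE; split=> //= i ij; rewrite /Rsof /= /updf.
by rewrite (negbTE ij).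
Qed.

(** Either the last step is the completion at [j] that draws datum [n0], and before it the chains
    are equal; or it is another event, which cannot empty [j], so [j] was already empty and the
    induction hypothesis applies. *)
Lemma idle_same m : cnt (C m) (inr j) = n0.+1 -> Zof (stt (C m)) j = 0%N ->
  same_but_service (C m) (C' m).
Proof.
elim: m => // m IH; rewrite !gCS.
have [f [Ef Eg Hf Hm]] := gstepP mu te ts ph alpha_pos (C m).
have Hz := Zof_fire mu te ts ph j Hf.
rewrite Eg cnt_fire => hc z0; rewrite z0 in Hz.
have [E|ne] := eqVneq f (inr j).
  rewrite E eqxx addn1 in hc; case: hc => hc.
  have <- : C m = C' m.
    by apply: gC_agree => [i k _|]; [rewrite phE|rewrite e0E -[leqLHS]/((C m).2.2 j) hc].
  by rewrite /gstep Ef E; exact: same_fire_service.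
have zm : Zof (stt (C m)) j = 0%N by move: Hz; rewrite (negbTE ne); lia.
rewrite (_ : (inr j == f) = false) ?addn0 in hc; last by rewrite eq_sym (negbTE ne).
have S := IH hc zm.
by rewrite /gstep -(same_next_event S zm) Ef; exact: same_fire.
Qed.

Lemma idle_after_agree t : idle_after C t j n0 -> idle_after C' t j n0.
Proof.
move=> [n [/andP[h1 h2] hc hz]].
have S := idle_same hc hz; have [s1 s2 _ _ [_ s6]] := S.
exists n; split; last by rewrite -s2.
  rewrite /gidx -s1 h1 /=; move: h2; rewrite !gCS.
  have [f [Ef -> Hf Hm]] := gstepP mu te ts ph alpha_pos (C n).
  rewrite /gstep -(same_next_event S hz) Ef !clk_fire s1 (@same_ev_time _ (C' n) f) //.
  by apply/eqP => E; move: Hf; rewrite E /= hz.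
by rewrite -hc /cnt s6.
Qed.

End IdleInvariance.
End Invariance.

(** * Every station completes infinitely many services *)

Section Divergence.
Context {R : realType} {J : nat} (alpha mu : 'I_J -> R).
Context (te ts : 'I_J -> nat -> R) (ph : 'I_J -> nat -> option 'I_J).
Hypothesis alpha_ge0 : forall j, 0 <= alpha j.
Hypothesis mu_gt0 : forall j, 0 < mu j.
Hypothesis alpha_pos : exists i, 0 < alpha i.
Variable x0 : state R J.
Hypothesis x0_valid : valid_state x0.
Hypothesis te_ge0 : forall j n, 0 <= te j n.
Hypothesis ts_ge0 : forall j n, 0 <= ts j n.

Local Notation rate := (rate alpha mu).
Local Notation dat := (dat te ts).
Local Notation C := (gC alpha mu te ts ph x0).
Hypothesis nonexplosive : forall t : R, exists n, t < clk (C n).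

Definition diverges (e : event J) : Prop := forall m, exists n, (m < cnt (C n) e)%N.

(** If the count stayed bounded, the conserved quantity of [ev_time_enabled_from] would make the
    residual time negative once the clock is large. *)
Lemma enabled_diverges e n0 :
  (forall n, (n0 <= n)%N -> ev_enabled alpha (stt (C n)) e) -> diverges e.
Proof.
move=> He m; apply: boolp.contrapT => Hn.
have Hm n : (cnt (C n) e <= m)%N.
  by rewrite leqNgt; apply/negP => h; apply: Hn; exists n.
have rp := rate_gt0 mu_gt0 (He n0 (leqnn _)).
set K := rate e * ev_time (stt (C n0)) e + rate e * clk (C n0) - \sum_(i < cnt (C n0) e) dat e i.
have [n hn] := nonexplosive ((K + \sum_(i < m) dat e i) / rate e).
have [n1 [n01 hn1]] : exists n1, (n0 <= n1)%N /\ (K + \sum_(i < m) dat e i) / rate e < clk (C n1).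
  exists (maxn n0 n); split; first exact: leq_maxl.
  by apply: lt_le_trans hn _; apply: clk_le => //; exact: leq_maxr.
have := ev_time_enabled_from mu_gt0 alpha_pos n01 (fun p h => He p (proj1 (andP h))).
rewrite -/K => EK.
have [h1 _ _ _] := inv_gC ph alpha_ge0 mu_gt0 alpha_pos x0_valid te_ge0 ts_ge0 n1 e.
have h2 : \sum_(i < cnt (C n1) e) dat e i <= \sum_(i < m) dat e i.
  rewrite -!(big_mkord xpredT (dat e)) (@big_cat_nat _ _ _ (cnt (C n1) e) 0 m) //= lerDl sumr_ge0 // => i _.
  exact: dat_ge0.
move: hn1; rewrite ltr_pdivrMr // mulrC => hn1.
have : 0 <= rate e * ev_time (stt (C n1)) e by rewrite mulr_ge0 // ltW.
lra.
Qed.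

Definition arrivals (n : nat) (j : 'I_J) : nat :=
  (cnt (C n) (inl j) + \sum_l \sum_(i < cnt (C n) (inr l)) (ph l i == Some j))%N.

Lemma arrivals_le m n j : (m <= n)%N -> (arrivals m j <= arrivals n j)%N.
Proof.
move=> mn; apply: leq_add; first exact: cnt_le.
apply: leq_sum => l _.
rewrite -!(big_mkord xpredT (fun i => (ph l i == Some j) : nat)).
rewrite [leqRHS](@big_cat_nat _ _ _ (cnt (C m) (inr l))) //= ?leq_addr //.
exact: (cnt_le mu te ts ph alpha_pos x0 (inr l) mn).
Qed.

(** If no more than [m] services were ever completed, then after more than [m] arrivals the queue
    would never be empty again, and a service clock that always runs fires infinitely often. *)
Lemma arrivals_diverges j : (forall m, exists n, (m < arrivals n j)%N) ->
  diverges (inr j).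
Proof.
move=> Ha m; apply: boolp.contrapT => Hn.
have Hm n : (cnt (C n) (inr j) <= m)%N.
  by rewrite leqNgt; apply/negP => h; apply: Hn; exists n.
have [n0 hn0] := Ha m.
have /(_ m) : diverges (inr j); last by move=> [n]; rewrite ltnNge Hm.
apply: (@enabled_diverges (inr j) n0) => n /(arrivals_le j) an.
rewrite /ev_enabled; have := Zof_balance mu te ts ph alpha_pos x0 n j; have := Hm n.
move: an hn0; rewrite /arrivals; lia.
Qed.

Lemma external_diverges j : 0 < alpha j -> diverges (inr j).
Proof.
move=> aj; apply: arrivals_diverges => m.
have [n hn] := @enabled_diverges (inl j) 0 (fun _ _ => aj) m.
by exists n; rewrite /arrivals ltn_addr.
Qed.

Lemma routing_diverges i j : diverges (inr i) ->
  (forall m, exists n, (m <= n)%N /\ ph i n = Some j) -> diverges (inr j).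
Proof.
move=> Hi Hph; apply: arrivals_diverges => m.
have [N hN] : exists N, (m < \sum_(k < N) (ph i k == Some j))%N.
  elim: m => [|m [N hN]].
    have [n [_ E]] := Hph 0%N; exists n.+1.
    by rewrite big_ord_recr /= E eqxx addn1.
  have [n [Nn E]] := Hph N; exists n.+1.
  rewrite big_ord_recr /= E eqxx addn1 ltnS; apply: leq_trans hN _.
  rewrite -!(big_mkord xpredT (fun k => (ph i k == Some j) : nat)).
  by rewrite [leqRHS](@big_cat_nat _ _ _ N) //= leq_addr.
have [n hn] := Hi N; exists n.
apply: (leq_trans hN); rewrite /arrivals (bigD1 i) //=.
apply: leq_trans (leq_addl _ _); apply: leq_trans (leq_addr _ _).
rewrite -!(big_mkord xpredT (fun k => (ph i k == Some j) : nat)).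
by rewrite [leqRHS](@big_cat_nat _ _ _ N) //= ?leq_addr // ltnW.
Qed.

End Divergence.

(** * Measurability of the path *)

Section DiscreteMeasurability.
Context {d : measure_display} {Om : measurableType d}.

(** Measurability of the fibres only; for countable [A] this is measurability for the discrete
    sigma-algebra, without equipping [nat], [option] or the set of events with one. *)
Definition dmeas {A : Type} (f : Om -> A) : Prop :=
  forall a, measurable [set om | f om = a].

Lemma mset_const (p : Prop) : measurable [set om : Om | p].
Proof.
have [E|E] := boolp.pselect p.
  by rewrite (_ : [set _ | _] = setT) //; apply/seteqP; split => om.
by rewrite (_ : [set _ | _] = set0) //; apply/seteqP; split => om.
Qed.

Lemma dmeas_case (K : countType) (k : Om -> K) (S : K -> set Om) :
  dmeas k -> (forall a, measurable (S a)) -> measurable [set om | S (k om) om].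
Proof.
move=> mk mS.
rewrite (_ : [set _ | _] = \bigcup_a ([set om | k om = a] `&` S a)); last first.
  by apply/seteqP; split => [om /= h|om [a _ [<-]]//]; exists (k om).
by apply: countable_bigcupT_measurable => // a; exact: measurableI.
Qed.

Lemma dmeas_comp (K : countType) A (k : Om -> K) (g : K -> A) :
  dmeas k -> dmeas (fun om => g (k om)).
Proof.
move=> mk a; apply: (@dmeas_case K k (fun x => [set om | g x = a]) mk) => x.
exact: mset_const.
Qed.

Lemma dmeas_pair A B (f : Om -> A) (g : Om -> B) :
  dmeas f -> dmeas g -> dmeas (fun om => (f om, g om)).
Proof.
move=> mf mg [a b].
rewrite (_ : [set _ | _] = [set om | f om = a] `&` [set om | g om = b]); first exact: measurableI.
by apply/seteqP; split => om /= => [[-> ->]|[-> ->]].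
Qed.

Lemma mfun_case (K : countType) d' (T : measurableType d') (k : Om -> K) (g : K -> Om -> T) :
  dmeas k -> (forall a, measurable_fun setT (g a)) ->
  measurable_fun setT (fun om => g (k om) om).
Proof.
move=> mk mg _ B mB; rewrite setTI.
apply: (@dmeas_case K k (fun a => g a @^-1` B)) => // a.
by rewrite -[X in measurable X]setTI; exact: mg.
Qed.

Lemma dmeas_case2 (K : countType) A (k : Om -> K) (g : K -> Om -> A) :
  dmeas k -> (forall a, dmeas (g a)) -> dmeas (fun om => g (k om) om).
Proof. by move=> mk mg b; apply: (@dmeas_case K k (fun a => [set om | g a om = b])) => // a; exact: mg. Qed.

Lemma mset_forall (I : finType) (p : I -> Om -> bool) :
  (forall i, measurable [set om | p i om]) -> measurable [set om | [forall i, p i om]].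
Proof.
move=> mp; rewrite (_ : [set _ | _] = ~` (\bigcup_i ~` [set om | p i om])).
  apply: measurableC; apply: countable_bigcupT_measurable => // i.
  exact: measurableC.
apply/seteqP; split => om /=.
  by move=> /forallP h [i _ /=]; apply; exact: h.
move=> h; apply/forallP => i; apply: boolp.contrapT => hi; apply: h; by exists i.
Qed.

Lemma mset_imply (p q : Om -> bool) : measurable [set om | p om] ->
  measurable [set om | q om] -> measurable [set om | p om ==> q om].
Proof.
move=> mp mq; rewrite (_ : [set _ | _] = ~` [set om | p om] `|` [set om | q om]).
  by apply: measurableU => //; exact: measurableC.
apply/seteqP; split => om /=; first by case: (p om) => /= h; [right|left].
by case: (p om) => /=; case=> h //.
Qed.

Lemma dmeas_bool (p : Om -> bool) : measurable [set om | p om] -> dmeas p.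
Proof.
move=> mp [] //; rewrite (_ : [set _ | _] = ~` [set om | p om]); first exact: measurableC.
apply/seteqP; split => om /=; first by move=> ->.
by case: (p om) => // /(_ isT).
Qed.

Lemma dmeas_finfun (I : finType) (p : I -> Om -> bool) :
  (forall i, measurable [set om | p i om]) -> dmeas (fun om => [ffun i => p i om]).
Proof.
move=> mp f; rewrite (_ : [set _ | _] = [set om | [forall i, p i om == f i]]).
  apply: mset_forall => i; have := dmeas_bool (mp i) (f i).
  by congr measurable; apply/seteqP; split => om /= /eqP.
apply/seteqP; split => om /=.
  by move=> <-; apply/forallP => i; rewrite ffunE.
by move=> /forallP h; apply/ffunP => i; rewrite ffunE; exact/eqP.
Qed.

Lemma mset_leq (f : Om -> nat) n : dmeas f -> measurable [set om | (n <= f om)%N].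
Proof. by move=> mf; apply: (@dmeas_case nat f (fun a => [set om | (n <= a)%N])) => // a; exact: mset_const. Qed.

Lemma mset_ler (R : realType) (f g : Om -> R) : measurable_fun setT f ->
  measurable_fun setT g -> measurable [set om | f om <= g om].
Proof.
move=> mf mg; have := measurable_fun_ler mf mg measurableT (Y := [set true]).
by rewrite setTI; apply.
Qed.

Lemma mset_ltr (R : realType) (f g : Om -> R) : measurable_fun setT f ->
  measurable_fun setT g -> measurable [set om | f om < g om].
Proof.
move=> mf mg; have := measurable_fun_ltr mf mg measurableT (Y := [set true]).
by rewrite setTI; apply.
Qed.

End DiscreteMeasurability.

(** From a valid state with nonnegative data the index is unique anyway. Minimality makes it well
    determined for every initial state, so that the path is measurable on the whole state space; 0
    is the default when the path explodes before [t]. *)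
Definition gpath_idx {R : realType} {J : nat} (C : nat -> R * aug R J) (t : R) : nat :=
  xget 0%N [set n | gidx C t n /\ forall m, (m < n)%N -> ~ gidx C t m].

Definition gpath {R : realType} {J : nat} (alpha mu : 'I_J -> R)
  (te ts : 'I_J -> nat -> R) (ph : 'I_J -> nat -> option 'I_J)
  (x0 : state R J) (t : R) : state R J :=
  let C := gC alpha mu te ts ph x0 in
  let n := gpath_idx C t in flow alpha (stt (C n)) (t - clk (C n)).

Section PathMeasurability.
Context {d : measure_display} {Om : measurableType d} {R : realType} {J : nat}.
Variables (alpha mu : 'I_J -> R) (te ts : 'I_J -> nat -> Om -> R).
Variables (ph : 'I_J -> nat -> Om -> option 'I_J) (x0 : Om -> state R J).

Definition mstate (x : Om -> state R J) : Prop :=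
  [/\ forall j, dmeas (fun om => Zof (x om) j),
      forall j, measurable_fun setT (fun om => Reof (x om) j) &
      forall j, measurable_fun setT (fun om => Rsof (x om) j)].

Definition maug (a : Om -> R * aug R J) : Prop :=
  [/\ measurable_fun setT (fun om => clk (a om)), mstate (fun om => stt (a om)) &
      forall e, dmeas (fun om => cnt (a om) e)].

Hypothesis mte : forall j n, measurable_fun setT (te j n).
Hypothesis mts : forall j n, measurable_fun setT (ts j n).
Hypothesis mph : forall j n, dmeas (ph j n).
Hypothesis mx0 : mstate x0.

Lemma mset_enabled x e : mstate x -> measurable [set om | ev_enabled alpha (x om) e].
Proof.
move=> [mz _ _]; case: e => j /=; first exact: mset_const.
exact: mset_leq.
Qed.

Lemma mfun_ev_time x e : mstate x -> measurable_fun setT (fun om => ev_time (x om) e).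
Proof. by case: e => j [_ ? ?] /=. Qed.

Lemma dmeas_next_event x : mstate x -> dmeas (fun om => next_event alpha (x om)).
Proof.
move=> mx.
pose p e om := ev_enabled alpha (x om) e &&
   [forall e', ev_enabled alpha (x om) e' ==> (ev_time (x om) e <= ev_time (x om) e')].
(* The choice made by [pick] depends on the sample point only through finitely many Booleans, that
   is, through an element of a finite type. *)
rewrite (_ : (fun om => _) = fun om => (fun f : {ffun event J -> bool} => [pick e | f e]) [ffun e => p e om]).
  apply: (dmeas_comp (fun f : {ffun event J -> bool} => [pick e | f e])
    (k := fun om => [ffun e => p e om])); apply: dmeas_finfun => e.
  rewrite (_ : [set _ | _] = [set om | ev_enabled alpha (x om) e] `&`
     [set om | [forall e', ev_enabled alpha (x om) e' ==> (ev_time (x om) e <= ev_time (x om) e')]]).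
    apply: measurableI; first exact: mset_enabled.
    apply: mset_forall => e'; apply: mset_imply; first exact: mset_enabled.
    by apply: mset_ler; exact: mfun_ev_time.
  by apply/seteqP; split => om /= => [/andP[]//|[h1 h2]]; apply/andP.
by apply/funext => om; apply: eq_pick => e /=; rewrite ffunE.
Qed.

Lemma mstate_flow x s : mstate x -> measurable_fun setT s ->
  mstate (fun om => flow alpha (x om) (s om)).
Proof.
move=> [mz me ms] mS; split => j; first exact: mz.
- rewrite /Reof /=; case: (0 < alpha j); first exact: measurable_funB.
  by apply: measurable_maxr => //; exact: measurable_funB.
- rewrite /Rsof /=.
  apply: (mfun_case (k := fun om => Zof (x om) j)
    (g := fun z om => if (0 < z)%N then Rsof (x om) j - s om else Rsof (x om) j)); first exact: mz.
  by move=> z; case: (0 < z)%N; [exact: measurable_funB|exact: ms].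
Qed.

Lemma maug_fire e a : maug a ->
  maug (fun om => fire alpha mu (fun j n => te j n om) (fun j n => ts j n om)
                    (fun j n => ph j n om) e (a om)).
Proof.
move=> [mc mx mn].
have mdt := mfun_ev_time e mx.
have [mz me ms] := mx.
have [_ fe fs] := mstate_flow mx mdt.
split.
- rewrite (_ : (fun om => _) = (fun om => clk (a om) + ev_time (stt (a om)) e)).
    exact: measurable_funD.
  by apply/funext => om; rewrite clk_fire.
- case: e mdt fe fs => i mdt fe fs; split => j /=.
  + rewrite /Zof /= /updf; case: (j == i); last exact: mz.
    exact: (dmeas_comp (fun z : nat => z.+1) (mz i)).
  + rewrite /Reof /= /updf; case: (j == i); last exact: fe.
    apply: measurable_funM => //.
    exact: (mfun_case (g := te i) (mn (inl i))).
  + exact: fs.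
  + pose G (q : nat * nat * option 'I_J) :=
       let z1 := if j == i then q.1.2.-1 else q.1.1 in
       if q.2 is Some k then (if j == k then z1.+1 else z1) else z1.
    rewrite (_ : (fun om => _) = (fun om =>
       G (Zof (stt (a om)) j, Zof (stt (a om)) i, ph i (cnt (a om) (inr i)) om))).
      apply: (dmeas_comp G); apply: dmeas_pair; first exact: dmeas_pair.
      exact: (dmeas_case2 (g := ph i) (mn (inr i))).
    apply/funext => om; rewrite /G /=; case: (ph i _ om) => [k|] //.
    by rewrite {1}/Zof /= /updf; case: (eqVneq j k) => [->|].
  + exact: fe.
  + rewrite /Rsof /= /updf; case: (j == i); last exact: fs.
    apply: measurable_funM => //.
    exact: (mfun_case (g := ts i) (mn (inr i))).
- move=> e'.
  rewrite (_ : (fun om => _) = (fun om => (cnt (a om) e' + (e' == e))%N)).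
    exact: (dmeas_comp (fun n : nat => (n + (e' == e))%N) (mn e')).
  by apply/funext => om; rewrite cnt_fire.
Qed.

Lemma maug_case (K : countType) (k : Om -> K) (g : K -> Om -> R * aug R J) :
  dmeas k -> (forall b, maug (g b)) -> maug (fun om => g (k om) om).
Proof.
move=> mk mg; split.
- by apply: (mfun_case (g := fun b om => clk (g b om))) => // b; have [] := mg b.
- split => j.
  + by apply: (dmeas_case2 (g := fun b om => Zof (stt (g b om)) j)) => // b; have [_ []] := mg b.
  + by apply: (mfun_case (g := fun b om => Reof (stt (g b om)) j)) => // b; have [_ []] := mg b.
  + by apply: (mfun_case (g := fun b om => Rsof (stt (g b om)) j)) => // b; have [_ []] := mg b.
- by move=> e; apply: (dmeas_case2 (g := fun b om => cnt (g b om) e)) => // b; have [] := mg b.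
Qed.

Local Notation C om := (gC alpha mu (fun j n => te j n om) (fun j n => ts j n om)
                    (fun j n => ph j n om) (x0 om)).

Lemma maug_gC n : maug (fun om => C om n).
Proof.
elim: n => [|n IH].
  split => //.
  by move=> [] j /= k; exact: mset_const.
pose g (o : option (event J)) om := if o is Some e then
   fire alpha mu (fun j n => te j n om) (fun j n => ts j n om) (fun j n => ph j n om) e (C om n)
   else C om n.
rewrite (_ : (fun om => _) = (fun om => g (next_event alpha (stt (C om n))) om)) //.
apply: (maug_case (g := g)); first by apply: dmeas_next_event; have [] := IH.
by case => [e|] //; exact: maug_fire.
Qed.

Lemma mset_gidx t n : measurable [set om | gidx (C om) t n].
Proof.
rewrite (_ : [set _ | _] = [set om | clk (C om n) <= t] `&` [set om | t < clk (C om n.+1)]).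
  apply: measurableI.
    by apply: mset_ler; [have [] := maug_gC n|exact: measurable_cst].
  by apply: mset_ltr; [exact: measurable_cst|have [] := maug_gC n.+1].
by apply/seteqP; split => om /= => [/andP[]|[h1 h2]] //; apply/andP.
Qed.

Lemma mset_hit t e m : measurable [set om | hit (C om) t e m].
Proof.
rewrite (_ : [set _ | _] = \bigcup_n ([set om | clk (C om n) <= t] `&` [set om | (m < cnt (C om n) e)%N])).
  apply: bigcupT_measurable => n; have [h1 h2 h3] := maug_gC n; apply: measurableI.
    by apply: mset_ler => //; exact: measurable_cst.
  exact: mset_leq.
apply/seteqP; split => om /= => [[n [h1 h2]]|[n _ [h1 h2]]]; by exists n.
Qed.

Lemma mset_idle_after t j m : measurable [set om | idle_after (C om) t j m].
Proof.
rewrite (_ : [set _ | _] = \bigcup_n ([set om | gidx (C om) t n] `&`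
   ([set om | cnt (C om n) (inr j) = m.+1] `&` [set om | Zof (stt (C om n)) j = 0%N]))).
  apply: bigcupT_measurable => n; have [h1 [h2 _ _] h3] := maug_gC n; apply: measurableI.
    exact: mset_gidx.
  by apply: measurableI; [exact: h3|exact: h2].
apply/seteqP; split => om /= => [[n [h1 h2 h3]]|[n _ [h1 [h2 h3]]]]; by exists n.
Qed.

Lemma mset_empties t j : measurable [set om | exists n, clk (C om n) <= t /\ Zof (stt (C om n)) j = 0%N].
Proof.
rewrite (_ : [set _ | _] = \bigcup_n ([set om | clk (C om n) <= t] `&` [set om | Zof (stt (C om n)) j = 0%N])).
  apply: bigcupT_measurable => n; have [h1 [h2 _ _] h3] := maug_gC n; apply: measurableI.
    by apply: mset_ler => //; exact: measurable_cst.
  exact: h2.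
apply/seteqP; split => om /= => [[n [h1 h2]]|[n _ [h1 h2]]]; by exists n.
Qed.

Lemma dmeas_gpath_idx t : dmeas (fun om => gpath_idx (C om) t).
Proof.
pose F n := [set om | gidx (C om) t n] `&` \bigcap_(m in [set m | (m < n)%N]) ~` [set om | gidx (C om) t m].
have mF n : measurable (F n).
  apply: measurableI; first exact: mset_gidx.
  by apply: bigcap_measurableType => m _; apply: measurableC; exact: mset_gidx.
have FP n om : F n om <-> (gidx (C om) t n /\ forall m, (m < n)%N -> ~ gidx (C om) t m) by [].
have Funiq n m om : F n om -> F m om -> n = m.
  move=> [h1 h2] [h3 h4]; apply/eqP; rewrite eqn_leq; apply/andP; split.
    by rewrite leqNgt; apply/negP => /h2; apply.
  by rewrite leqNgt; apply/negP => /h4; apply.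
move=> a.
rewrite (_ : [set _ | _] = F a `|` ([set om | a = 0%N] `&` \bigcap_n ~` F n)).
  apply: measurableU => //; apply: measurableI; first exact: mset_const.
  by apply: bigcap_measurableType => m _; exact: measurableC.
apply/seteqP; split => om; rewrite /gpath_idx /=.
  case: xgetP => [m _ /= hm <-|hn <-]; first by left.
  by right; split => // n _ /= hF; apply: (hn n).
case: xgetP => [m _ /= hm|hn]; case=> [hF|[a0 hF]].
- exact: Funiq hm hF.
- by have := hF m I; case.
- by case: (hn a).
- by rewrite a0.
Qed.

Lemma mstate_gpath t : mstate (fun om => gpath alpha mu (fun j n => te j n om)
  (fun j n => ts j n om) (fun j n => ph j n om) (x0 om) t).
Proof.
have mf n : mstate (fun om => flow alpha (stt (C om n)) (t - clk (C om n))).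
  have [h1 h2 h3] := maug_gC n; apply: mstate_flow => //.
  by apply: measurable_funB => //; exact: measurable_cst.
have mi := dmeas_gpath_idx t.
split => j; rewrite /gpath.
- apply: (dmeas_case2 (g := fun n om => Zof (flow alpha (stt (C om n)) (t - clk (C om n))) j) mi) => n.
  by have [] := mf n.
- apply: (mfun_case (g := fun n om => Reof (flow alpha (stt (C om n)) (t - clk (C om n))) j) mi) => n.
  by have [] := mf n.
- apply: (mfun_case (g := fun n om => Rsof (flow alpha (stt (C om n)) (t - clk (C om n))) j) mi) => n.
  by have [] := mf n.
Qed.

End PathMeasurability.

(** * Independence of one primitive from all the others *)

Section IndependenceOfRest.
Context {R : realType} {d : measure_display} {Om : measurableType d}.
Variables (P : probability Om R) (I : eqType) (F : I -> set (set Om)) (i0 : I).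
Hypothesis indF : mutually_independent P F.
Hypothesis mF : forall i A, F i A -> measurable A.
Hypothesis FT : forall i, F i setT.
Hypothesis FI : forall i, setI_closed (F i).

(** A pi-system that generates the sigma-algebra of all primitives other than [i0]. *)
Definition rest : set (set Om) :=
  [set A | exists (s : seq I) (E : I -> set Om), [/\ uniq s, i0 \notin s,
     forall i, F i (E i) & A = \bigcap_(i in [set i | i \in s]) E i]].

Lemma rest_sub i A : i != i0 -> F i A -> rest A.
Proof.
move=> ii0 FA; exists [:: i], (fun k => if k == i then A else setT); split => //.
- by rewrite inE eq_sym.
- by move=> k; case: eqP => [->|].
- apply/seteqP; split => om /=.
    by move=> Aom k /=; rewrite inE => /eqP ->; rewrite eqxx.
  by move=> /(_ i); rewrite /= inE eqxx; apply.
Qed.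

Lemma measurable_rest A : rest A -> measurable A.
Proof.
move=> [s [E [us _ FE ->]]].
apply: fin_bigcap_measurable; first exact: finite_seq.
by move=> i _; exact: mF (FE i).
Qed.

Lemma rest_setI : setI_closed rest.
Proof.
move=> A B [s [E [us s0 FE ->]]] [s' [E' [us' s0' FE' ->]]].
exists (undup (s ++ s')), (fun i => (if i \in s then E i else setT) `&` (if i \in s' then E' i else setT)).
split.
- exact: undup_uniq.
- by rewrite mem_undup mem_cat (negbTE s0) (negbTE s0').
- by move=> i; apply: FI; case: ifP.
- apply/seteqP; split => om /=.
    move=> [h1 h2] i /= _; split.
      by case: ifP => // hi; exact: h1.
    by case: ifP => // hi; exact: h2.
  move=> h; split => i /= hi; have /= := h i; rewrite mem_undup mem_cat hi ?orbT => /(_ isT) [] //.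
Qed.

(** For fixed [A] both sides are finite measures in [E]; they have the same total mass and agree on
    the pi-system [rest], hence on the sigma-algebra that it generates. *)
Lemma indep_rest A E : F i0 A -> <<s rest >> E -> P (A `&` E) = (P A * P E)%E.
Proof.
move=> FA sE.
have mA := mF FA.
have PAfin : (P A \is a fin_num)%E by exact: fin_num_measure.
have pA0 : 0 <= fine (P A) by rewrite fine_ge0.
pose m1 := mrestr P mA.
pose m2 := mscale (NngNum pA0) P.
have := @g_sigma_algebra_measure_unique_trace _ R Om rest setT measurableT.
have HE : [set X | rest X /\ X `<=` setT] = rest.
  by apply/seteqP; split => X //= [].
rewrite HE => /(_ (fun X => @measurable_rest X) rest_setI m1 m2).
have E1 X : m1 X = P (X `&` A) by [].
have E2 X : m2 X = (P A * P X)%E by rewrite -[in RHS](fineK PAfin).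
move=> H; rewrite setIC; transitivity (m1 E); first by [].
transitivity (m2 E); last exact: E2.
apply: H => //.
- apply: (etrans (E1 setT)); apply: etrans (esym (E2 setT)).
  by rewrite setTI probability_setT mule1.
- move=> X [s [D [us s0 FD ->]]].
  apply: (etrans (E1 _)); apply: etrans (esym (E2 _)); rewrite setIC.
  (* Prepending [i0], with event [A], to the finite family gives another finite family of distinct
     indices, to which mutual independence applies. *)
  pose D' i := if i == i0 then A else D i.
  have FD' i : F i (D' i) by rewrite /D'; case: eqP => [->|].
  have iD (r : seq I) : i0 \notin r -> (\prod_(i <- r) P (D' i) = \prod_(i <- r) P (D i))%E.
    move=> hr; rewrite big_seq [RHS]big_seq; apply: eq_bigr => i ir.
    by rewrite /D'; case: eqP => // ei; move: hr; rewrite -ei ir.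
  have := indF (s := i0 :: s) (E := D'); rewrite /= s0 us => /(_ isT (fun i _ => FD' i)).
  rewrite big_cons iD // {2}/D' eqxx.
  rewrite -(indF us (fun i _ => FD i)) => <-; congr (P _).
  apply/seteqP; split => om /=.
    move=> [Aom h] i /=; rewrite inE /D'; case: eqP => //= _ hi; exact: h.
  move=> h; split.
    by have := h i0; rewrite /= inE eqxx /D' eqxx; apply.
  move=> i /= hi; have := h i; rewrite /= inE hi orbT /D'; case: eqP => [ei|_]; last by apply.
  by move: s0; rewrite -ei hi.
- apply: (@le_lt_trans _ _ (P (setT `&` A))); first exact: lexx.
  by rewrite setTI (le_lt_trans (probability_le1 P mA)) // ltry.
Qed.

End IndependenceOfRest.

Section PrimitiveIndependence.
Context {R : realType} {J : nat} {d : measure_display} {Om : measurableType d}.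
Variables (P : probability Om R) (Pm : 'M[R]_J).
Variables (Te Ts : 'I_J -> nat -> Om -> R) (Phi : 'I_J -> nat -> Om -> option 'I_J).
Hypothesis Hprim : gjn_primitives P Pm Te Ts Phi.
Variables (alpha mu : 'I_J -> R).
Hypothesis alpha_ge0 : forall j, 0 <= alpha j.
Hypothesis mu_gt0 : forall j, 0 < mu j.
Hypothesis alpha_pos : exists i, 0 < alpha i.
Variable x0 : state R J.
Hypothesis x0_valid : valid_state x0.

Local Notation F := (prim_events Te Ts Phi).
Local Notation C om := (gC alpha mu (fun j n => Te j n om) (fun j n => Ts j n om)
                          (fun j n => Phi j n om) x0).

Definition arrival_kind : 'I_3 := ord0.
Definition service_kind : 'I_3 := @Ordinal 3 1 isT.
Definition routing_kind : 'I_3 := @Ordinal 3 2 isT.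

Lemma prim_measurable i A : F i A -> measurable A.
Proof.
case: Hprim => -[m1 [m2 m3]] _ _ _ _.
case: i => [[c j] n] /=; case: ifP => _; last case: ifP => _.
- by move=> [B mB <-]; rewrite -[X in measurable X]setTI; exact: m1.
- by move=> [B mB <-]; rewrite -[X in measurable X]setTI; exact: m2.
- by move=> [B mB <-]; exact: m3.
Qed.

Lemma prim_setT i : F i setT.
Proof.
case: i => [[c j] n] /=; case: ifP => _; last case: ifP => _;
  exists setT => //; exact: measurableT.
Qed.

Lemma prim_setI i : setI_closed (F i).
Proof.
case: i => [[c j] n] A B /=; case: ifP => _; last case: ifP => _;
  move=> [A' mA <-] [B' mB <-]; exists (A' `&` B'); rewrite ?preimage_setI //;
  exact: measurableI.
Qed.

Lemma measurable_Te j n : measurable_fun setT (Te j n).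
Proof. by case: Hprim => -[]. Qed.
Lemma measurable_Ts j n : measurable_fun setT (Ts j n).
Proof. by case: Hprim => -[_ []]. Qed.
Lemma dmeas_Phi j n : dmeas (Phi j n).
Proof. by case: Hprim => -[_ [_ m]] _ _ _ _ a; exact: (m j n [set a]). Qed.
Lemma Te_ge0 om j n : 0 <= Te j n om.
Proof. by case: Hprim => _ []. Qed.
Lemma Ts_ge0 om j n : 0 <= Ts j n om.
Proof. by case: Hprim => _ []. Qed.

Section Rest.
Variable i0 : 'I_3 * 'I_J * nat.
Local Notation rst := (rest F i0).
Local Notation Om' := (g_sigma_algebraType rst).

(** The primitive [i0] is overwritten by a constant, so every path functional built from these data
    is measurable for the sigma-algebra of the remaining primitives. *)
Definition te' j n om := if (arrival_kind, j, n) == i0 then 0 else Te j n om.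
Definition ts' j n om := if (service_kind, j, n) == i0 then 0 else Ts j n om.
Definition ph' j n om := if (routing_kind, j, n) == i0 then None else Phi j n om.

Let rest_meas i A : i != i0 -> F i A -> @measurable _ Om' A.
Proof. by move=> ii FA; apply: sub_sigma_algebra; exact: (rest_sub prim_setT ii FA). Qed.

Lemma mte' j n : measurable_fun setT (te' j n : Om' -> R).
Proof.
rewrite /te'; have [E|ne] := eqVneq (arrival_kind, j, n) i0; first exact: measurable_cst.
by move=> _ B mB; rewrite setTI; apply: (rest_meas ne); exists B.
Qed.

Lemma mts' j n : measurable_fun setT (ts' j n : Om' -> R).
Proof.
rewrite /ts'; have [E|ne] := eqVneq (service_kind, j, n) i0; first exact: measurable_cst.
by move=> _ B mB; rewrite setTI; apply: (rest_meas ne); exists B.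
Qed.

Lemma mph' j n : dmeas (ph' j n : Om' -> option 'I_J).
Proof.
rewrite /ph'; have [E|ne] := eqVneq (routing_kind, j, n) i0; first by move=> a; exact: mset_const.
by move=> a; apply: (rest_meas ne); exists [set a].
Qed.

Lemma mstate_cst : mstate (fun=> x0 : state R J) (Om := Om').
Proof. by split => j; [move=> a; exact: mset_const| exact: measurable_cst | exact: measurable_cst]. Qed.

Local Notation C' om := (gC alpha mu (fun j n => te' j n om) (fun j n => ts' j n om)
                          (fun j n => ph' j n om) x0).

Lemma te'_ge0 om j n : 0 <= te' j n om.
Proof. by rewrite /te'; case: eqP => // _; exact: Te_ge0. Qed.
Lemma ts'_ge0 om j n : 0 <= ts' j n om.
Proof. by rewrite /ts'; case: eqP => // _; exact: Ts_ge0. Qed.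

(** The hypotheses say that [i0] can only be the datum or the routing decision attached to firing
    [n] of [e]. Overwriting it does not change the event, by [hit_agree], and the event of the
    overwritten path lies in the required sigma-algebra. *)
Lemma rest_hit t e n :
  (forall j m, (arrival_kind, j, m) = i0 -> (inl j, m) = (e, n)) ->
  (forall j m, (service_kind, j, m) = i0 -> (inr j, m) = (e, n)) ->
  (forall j m, (routing_kind, j, m) = i0 -> (inr j, m) = (e, n)) ->
  <<s rst >> [set om | hit (C om) t e n].
Proof.
move=> h0 h1 h2.
have := @mset_hit _ Om' R J alpha mu te' ts' ph' (fun=> x0) mte' mts' mph' mstate_cst t e n.
have -> : [set om | hit (C' om) t e n] = [set om | hit (C om) t e n]; last by [].
have te'E om j m : (inl j, m) <> (e, n) -> te' j m om = Te j m om.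
  by move=> ne; rewrite /te'; case: eqP => // /h0.
have ts'E om j m : (inr j, m) <> (e, n) -> ts' j m om = Ts j m om.
  by move=> ne; rewrite /ts'; case: eqP => // /h1.
have ph'E om j m : (inr j, m) <> (e, n) -> ph' j m om = Phi j m om.
  by move=> ne; rewrite /ph'; case: eqP => // /h2.
apply/seteqP; split => om /=; apply: hit_agree => // j m; try by move=> ne; rewrite ?te'E ?ts'E ?ph'E.
- exact: te'_ge0.
- exact: ts'_ge0.
- exact: Te_ge0.
- exact: Ts_ge0.
Qed.

Lemma rest_idle_after t j n : i0 = (service_kind, j, n) ->
  <<s rst >> [set om | idle_after (C om) t j n].
Proof.
move=> i0E.
have := @mset_idle_after _ Om' R J alpha mu te' ts' ph' (fun=> x0) mte' mts' mph' mstate_cst t j n.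
have -> : [set om | idle_after (C' om) t j n] = [set om | idle_after (C om) t j n]; last by [].
have te'E om i m : te' i m om = Te i m om by rewrite /te' i0E.
have ts'E om i m : (inr i, m) <> (inr j, n) :> event J * nat -> ts' i m om = Ts i m om.
  by move=> ne; rewrite /ts' i0E; case: eqP => // -[E1 E2]; case: ne; rewrite E1 E2.
have ph'E om i m : ph' i m om = Phi i m om by rewrite /ph' i0E.
apply/seteqP; split => om /=.
- apply: (@idle_after_agree _ _ _ _ _ _ _ _ _ _ alpha_pos x0 (inr j) n) => //.
  + by move=> i m ne; rewrite ts'E.
  + by apply/funext => i; apply/funext => m.
- apply: (@idle_after_agree _ _ _ _ _ _ _ _ _ _ alpha_pos x0 (inr j) n) => //.
  + by move=> i m ne; rewrite ts'E.
  + by apply/funext => i; apply/funext => m.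
Qed.

Lemma indep_event A E : F i0 A -> <<s rst >> E -> P (A `&` E) = (P A * P E)%E.
Proof.
have [_ _ _ _ ind] := Hprim.
exact: (indep_rest ind prim_measurable prim_setT prim_setI).
Qed.

End Rest.

Lemma indep_hit_dat t e n B : measurable B ->
  P (dat Te Ts e n @^-1` B `&` [set om | hit (C om) t e n]) =
  (P (dat Te Ts e n @^-1` B) * P [set om | hit (C om) t e n])%E.
Proof.
move=> mB; case: e => j.
- apply: (@indep_event (arrival_kind, j, n)); first by exists B.
  by apply: rest_hit => i m // [-> ->].
- apply: (@indep_event (service_kind, j, n)); first by exists B.
  by apply: rest_hit => i m // [-> ->].
Qed.

Lemma indep_hit_ph t j n B :
  P (Phi j n @^-1` B `&` [set om | hit (C om) t (inr j) n]) =
  (P (Phi j n @^-1` B) * P [set om | hit (C om) t (inr j) n])%E.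
Proof.
apply: (@indep_event (routing_kind, j, n)); first by exists B.
by apply: rest_hit => i m // [-> ->].
Qed.

Lemma indep_idle_after t j n B : measurable B ->
  P (Ts j n @^-1` B `&` [set om | idle_after (C om) t j n]) =
  (P (Ts j n @^-1` B) * P [set om | idle_after (C om) t j n])%E.
Proof.
move=> mB; apply: (@indep_event (service_kind, j, n)); first by exists B.
exact: rest_idle_after.
Qed.

End PrimitiveIndependence.

Lemma ge0_integral_restrict {R : realType} {d} {T : measurableType d}
  (m : {measure set T -> \bar R}) (D : set T) (mD : measurable D) (f : T -> \bar R) :
  measurable_fun setT f -> (forall x, 0 <= f x)%E ->
  (\int[mrestr m mD]_x f x = \int[m]_(x in D) f x)%E.
Proof.
move=> mf f0.
have mDC : measurable (~` D) by exact: measurableC.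
rewrite [LHS](ge0_negligible_integral (N := ~` D)) //; last first.
  by rewrite -[LHS]/(m (~` D `&` D)) setICl measure0.
rewrite setTD setCK; apply: eq_measure_integral => A mA AD.
by rewrite /= /mrestr setIidl.
Qed.

(** * Counting processes *)

Section Wald.
Context {R : realType} {d : measure_display} {Om : measurableType d}.
Variables (P : probability Om R) (N : Om -> nat).
Hypothesis mN : dmeas N.

Local Notation Ev n := [set om | (n < N om)%N].

Lemma measurable_Ev n : measurable (Ev n). Proof. exact: mset_leq. Qed.

(** Restricted to [E], the law of [X] is [P E] times the law of [X0]; the claim is the integral of
    [g] against these two equal measures on the line. *)
Lemma integral_indep (X X0 : Om -> R) (E : set Om) (g : R -> R) :
  measurable E -> measurable_fun setT X -> measurable_fun setT X0 ->
  (forall B, measurable B -> P (X @^-1` B `&` E) = P (X @^-1` B) * P E)%E ->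
  (forall B, measurable B -> P (X @^-1` B) = P (X0 @^-1` B))%E ->
  measurable_fun setT g -> (forall x, 0 <= g x) ->
  (\int[P]_(om in E) (g (X om))%:E = P E * \int[P]_om (g (X0 om))%:E)%E.
Proof.
move=> mE mX mX0 ind idd mg g0.
have PEfin : (P E \is a fin_num)%E by exact: fin_num_measure.
have pE0 : 0 <= fine (P E) by rewrite fine_ge0.
rewrite -(ge0_integral_restrict P mE (f := fun om => (g (X om))%:E)); last 2 first.
- by apply/measurable_EFinP; exact: measurableT_comp.
- by move=> x; rewrite lee_fin.
have mg' : measurable_fun setT (EFin \o g) by exact/measurable_EFinP.
transitivity (\int[pushforward (mrestr P mE) X]_x (EFin \o g) x)%E.
  by rewrite ge0_integral_pushforward // => y _; rewrite lee_fin.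
rewrite (eq_measure_integral (mscale (NngNum pE0) (pushforward P X0))); last first.
  move=> A mA _; rewrite /= /mscale /= /pushforward /mrestr /= ind // idd //.
  by rewrite muleC fineK.
rewrite ge0_integral_mscale //=; last by move=> x _; rewrite lee_fin.
rewrite fineK // ge0_integral_pushforward //=; last by move=> y _; rewrite lee_fin.
Qed.

(** A random sum is a nonnegative series whose terms carry the indicator of [i < N], so it can be
    integrated term by term. The weights [a] are there to reach higher powers of [N]. *)
Lemma wald_sum (a : nat -> R) (Y : nat -> Om -> R) (c : R) :
  (forall i, 0 <= a i) -> (forall i om, 0 <= Y i om) -> 0 <= c ->
  (forall i, measurable_fun setT (Y i)) ->
  (forall i, \int[P]_(om in Ev i) (Y i om)%:E = P (Ev i) * c%:E)%E ->
  (\int[P]_om (\sum_(i < N om) a i * Y i om)%:E =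
   c%:E * \int[P]_om (\sum_(i < N om) a i)%:E)%E.
Proof.
move=> a0 Y0 c0 mY HY.
have H (Z : nat -> Om -> R) : (forall i om, 0 <= Z i om) -> (forall i, measurable_fun setT (Z i)) ->
  (\int[P]_om (\sum_(i < N om) a i * Z i om)%:E =
   \sum_(i <oo) ((a i)%:E * \int[P]_(om in Ev i) (Z i om)%:E))%E.
  move=> Z0 mZ.
  transitivity (\int[P]_om (\sum_(i <oo) ((a i * Z i om * \1_(Ev i) om)%:E)))%E.
    apply: eq_integral => om _.
    rewrite (nneseries_split 0 (N om)) ?add0n; last first.
      by move=> k _; rewrite lee_fin !mulr_ge0.
    rewrite eseries0 ?adde0; last first.
      by move=> i iN _; rewrite indicE memNset ?mulr0 //= ltnNge iN.
    rewrite sumEFin big_mkord; congr EFin; apply: eq_bigr => i _.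
    by rewrite indicE mem_set ?mulr1 //=.
  rewrite integral_nneseries //; last first.
  - by move=> n x _; rewrite lee_fin !mulr_ge0.
  - move=> n; apply/measurable_EFinP; apply: measurable_funM => //.
      by apply: measurable_funM => //.
    by apply: measurable_indic; exact: measurable_Ev.
  apply: eq_eseriesr => i _.
  rewrite -ge0_integralZl_EFin //; last 3 first.
  - exact: measurable_Ev.
  - by move=> x _; rewrite lee_fin.
  - by apply/measurable_EFinP; exact: measurable_funTS.
  rewrite [RHS]integral_mkcond; apply: eq_integral => om _.
  rewrite patchE indicE; case: ifP => _; rewrite ?mulr1 ?mulr0 ?EFinM //.
rewrite H // (_ : (fun om => _) = fun om => (\sum_(i < N om) a i * cst 1 om)%:E); last first.
  by apply/funext => om; congr EFin; apply: eq_bigr => i _; rewrite mulr1.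
rewrite (H (fun=> cst 1)) => [|i om|i]; last 2 first.
- by rewrite ler01.
- exact: measurable_cst.
rewrite -nneseriesZl; last first.
  by move=> i _; rewrite mule_ge0 ?lee_fin // integral_ge0 // => x _; rewrite lee_fin.
apply: eq_eseriesr => i _; rewrite HY.
have -> : (\int[P]_(om in Ev i) (cst 1 om)%:E = P (Ev i))%E.
  by apply: (etrans (integral_cst P (measurable_Ev i) 1%:E)); rewrite mul1e.
by rewrite muleA muleC.
Qed.

End Wald.

(** Telescoping of [(n+1)^(p+1) - n^(p+1) <= (p+1) (n+1)^p]. *)
Lemma expn_le_sum (n p : nat) : (n ^ p.+1 <= p.+1 * \sum_(i < n) i.+1 ^ p)%N.
Proof.
elim: n => [|n IH]; first by rewrite exp0n.
rewrite big_ord_recr /= mulnDr.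
have H : (n.+1 ^ p.+1 <= n ^ p.+1 + p.+1 * n.+1 ^ p)%N.
  elim: p {IH} => [|p IH]; first by rewrite !expn1 expn0; lia.
  have h : (n ^ p.+1 <= n.+1 ^ p.+1)%N by rewrite leq_exp2r.
  rewrite expnS (expnS n p.+1) in IH *; rewrite (expnS n.+1 p.+1).
  by move: IH h; rewrite !(expnS n.+1 p) !(expnS n p); nia.
by apply: leq_trans H _; rewrite leq_add2r.
Qed.

(** * Moments of renewal counts *)

Section RenewalCount.
Context {R : realType} {d : measure_display} {Om : measurableType d}.
Variables (P : probability Om R) (N : Om -> nat) (T : nat -> Om -> R) (c : R).
Hypothesis mN : dmeas N.
Hypothesis mT : forall n, measurable_fun setT (T n).
Hypothesis T0 : forall n om, 0 <= T n om.
Hypothesis idT : forall n B, measurable B -> P (T n @^-1` B) = P (T 0%N @^-1` B).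
Hypothesis indT : forall n B, measurable B ->
  (P (T n @^-1` B `&` [set om | (n < N om)%N]) = P (T n @^-1` B) * P [set om | (n < N om)%N])%E.
Hypothesis ET : (\int[P]_om (T 0%N om)%:E = 1%:E)%E.
Hypothesis c0 : 0 <= c.
Hypothesis pathT : forall om n, (n < N om)%N -> \sum_(i < n) T i om <= c.

Lemma wald_dat (a : nat -> R) (g : R -> R) (gam : R) :
  (forall i, 0 <= a i) -> (forall x, 0 <= g x) -> measurable_fun setT g ->
  (\int[P]_om (g (T 0%N om))%:E = gam%:E)%E ->
  (\int[P]_om (\sum_(i < N om) a i * g (T i om))%:E =
   gam%:E * \int[P]_om (\sum_(i < N om) a i)%:E)%E.
Proof.
move=> a0 g0 mg Eg; apply: (wald_sum mN (Y := fun i om => g (T i om))) => //.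
- by rewrite -lee_fin -Eg integral_ge0 // => x _; rewrite lee_fin.
- by move=> i; exact: (measurableT_comp mg (mT i)).
- move=> i; rewrite (integral_indep (X0 := T 0%N)) ?Eg //; first exact: mset_leq.
  + by move=> B mB; exact: indT.
  + by move=> B mB; exact: idT.
Qed.

(* Truncating at 1 bounds the overshoot of the partial sums over [c] by 1, whatever the
   moments of [T]. *)
Definition trunc_mean := fine (\int[P]_om (Num.min (T 0%N om) 1)%:E)%E.

Lemma mtrunc : measurable_fun setT (fun om => Num.min (T 0%N om) 1 : R).
Proof. by apply: measurable_minr => //; exact: measurable_cst. Qed.

Lemma trunc_meanE : (\int[P]_om (Num.min (T 0%N om) 1)%:E = trunc_mean%:E)%E.
Proof.
rewrite /trunc_mean fineK // ge0_fin_numE; last first.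
  by apply: integral_ge0 => om _; rewrite lee_fin le_min T0 ler01.
apply: (@le_lt_trans _ _ 1%:E); last exact: ltry.
rewrite -ET; apply: ge0_le_integral => //.
- by move=> om _; rewrite lee_fin le_min T0 ler01.
- by apply/measurable_EFinP; exact: mtrunc.
- by apply/measurable_EFinP.
- by move=> om _; rewrite lee_fin ge_min lexx.
Qed.

(** If the truncated mean vanished, [T 0] would be zero almost surely, contradicting its mean 1. *)
Lemma trunc_mean_gt0 : 0 < trunc_mean.
Proof.
have h0 : 0 <= trunc_mean.
  by apply: fine_ge0; apply: integral_ge0 => om _; rewrite lee_fin le_min T0 ler01.
rewrite lt_neqAle h0 andbT; apply/eqP => h.
have := trunc_meanE; rewrite -h => H.
have mm : measurable_fun setT (fun om => (Num.min (T 0%N om) 1)%:E : \bar R).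
  by apply/measurable_EFinP; exact: mtrunc.
have Hae : ae_eq P setT (fun om => (Num.min (T 0%N om) 1)%:E) (cst 0%E).
  apply/(ae_eq_integral_abs P measurableT mm).
  rewrite -[RHS]H; apply: eq_integral => om _.
  by rewrite gee0_abs // lee_fin le_min T0 ler01.
have : ae_eq P setT (fun om => (T 0%N om)%:E) (cst 0%E).
  apply: filterS Hae => om /= /(_ I) [E] _; congr EFin; move: E.
  by case: (leP (T 0%N om) 1) => // _ /eqP; rewrite oner_eq0.
move=> /(ae_eq_integral_abs P measurableT) H1.
have : (\int[P]_om (T 0%N om)%:E = 0)%E.
  rewrite -H1; last by apply/measurable_EFinP.
  by apply: eq_integral => om _; rewrite gee0_abs // lee_fin.
by rewrite ET => -[] /eqP; rewrite oner_eq0.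
Qed.

Lemma measurable_natpow p : measurable_fun setT (fun om => (N om)%:R ^+ p : R).
Proof. by apply: (mfun_case (g := fun n _ => n%:R ^+ p : R) mN) => n; exact: measurable_cst. Qed.

Lemma measurable_Nsum (Y : nat -> Om -> R) : (forall i, measurable_fun setT (Y i)) ->
  measurable_fun setT (fun om => \sum_(i < N om) Y i om).
Proof.
move=> mY; apply: (mfun_case (g := fun n om => \sum_(i < n) Y i om) mN) => n.
by apply: measurable_sum => i; exact: mY.
Qed.

(** Induction on [p]. In the sum of [(i+1)^p * min(T_i, 1)] over [i < N], all data but the last add
    up to at most [c] and the last is at most 1, so the sum is at most [(c+1) N^p]. By Wald its mean
    is [trunc_mean] times that of the sum of [(i+1)^p], which dominates [N^(p+1) / (p+1)]. *)
Lemma count_moment p :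
  (\int[P]_om ((N om)%:R ^+ p)%:E <= (p`!%:R * ((c + 1) / trunc_mean) ^+ p)%:E)%E.
Proof.
have t0 := trunc_mean_gt0.
elim: p => [|p IH].
  under eq_integral do rewrite expr0.
  apply: (le_trans (y := (1%:E * P setT)%E)).
    by rewrite -(integral_cst P measurableT 1%:E).
  by rewrite probability_setT mule1 fact0 expr0 mulr1.
(* The outer maximum makes the truncation nonnegative on the whole line, as [wald_dat] demands; on
   the data it changes nothing. *)
have W := @wald_dat (fun i => i.+1%:R ^+ p) (fun x => Num.max 0 (Num.min x 1)) trunc_mean.
have Hmin om : Num.max 0 (Num.min (T 0%N om) 1) = Num.min (T 0%N om) 1.
  by apply/max_idPr; rewrite le_min T0 ler01.
have {}W : (\int[P]_om (\sum_(i < N om) i.+1%:R ^+ p * Num.max 0 (Num.min (T i om) 1))%:E =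
  trunc_mean%:E * \int[P]_om (\sum_(i < N om) i.+1%:R ^+ p)%:E)%E.
  apply: W.
  - by move=> i; rewrite exprn_ge0.
  - by move=> x; rewrite le_max lexx.
  - apply: measurable_maxr; first exact: measurable_cst.
    by apply: measurable_minr => //; exact: measurable_cst.
  - by rewrite -trunc_meanE; apply: eq_integral => om _; rewrite Hmin.
have U : (\int[P]_om (\sum_(i < N om) i.+1%:R ^+ p * Num.max 0 (Num.min (T i om) 1))%:E
   <= (c + 1)%:E * \int[P]_om ((N om)%:R ^+ p)%:E)%E.
  rewrite -ge0_integralZl_EFin //; last 2 first.
  - by apply/measurable_EFinP; exact: measurable_natpow.
  - by rewrite addr_ge0.
  apply: ge0_le_integral => //.
  - by move=> om _; rewrite lee_fin sumr_ge0 // => i _; rewrite mulr_ge0 ?exprn_ge0 // le_max lexx.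
  - apply/measurable_EFinP; apply: (measurable_Nsum (Y := fun i om => i.+1%:R ^+ p * Num.max 0 (Num.min (T i om) 1))) => i.
    apply: measurable_funM; first exact: measurable_cst.
    apply: measurable_maxr; first exact: measurable_cst.
    by apply: measurable_minr => //; exact: measurable_cst.
  - apply/measurable_EFinP; apply: measurable_funM; first exact: measurable_cst.
    exact: measurable_natpow.
  move=> om _; rewrite -EFinM lee_fin.
  have := @pathT om; case: (N om) => [_|n /(_ n (ltnSn n)) hn].
    by rewrite big_ord0 mulr_ge0 ?addr_ge0 // exprn_ge0.
  apply: (@le_trans _ _ (\sum_(i < n.+1) n.+1%:R ^+ p * Num.min (T i om) 1)).
    apply: ler_sum => i _; rewrite (_ : Num.max 0 _ = Num.min (T i om) 1); last first.
      by apply/max_idPr; rewrite le_min T0 ler01.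
    apply: ler_wpM2r; first by rewrite le_min T0 ler01.
    by rewrite lerXn2r ?nnegrE // ler_nat ltn_ord.
  rewrite -mulr_sumr mulrC ler_wpM2r ?exprn_ge0 // big_ord_recr /=.
  apply: lerD; last by rewrite ge_min lexx orbT.
  by apply: le_trans hn; apply: ler_sum => i _; rewrite ge_min lexx.
have L : (\int[P]_om ((N om)%:R ^+ p.+1)%:E <= p.+1%:R%:E * \int[P]_om (\sum_(i < N om) i.+1%:R ^+ p)%:E)%E.
  rewrite -ge0_integralZl_EFin //; last 2 first.
  - by move=> om _; rewrite lee_fin sumr_ge0 // => i _; rewrite exprn_ge0.
  - by apply/measurable_EFinP; apply: (measurable_Nsum (Y := fun i => cst (i.+1%:R ^+ p))) => i; exact: measurable_cst.
  apply: ge0_le_integral => //.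
  - by apply/measurable_EFinP; exact: measurable_natpow.
  - apply/measurable_EFinP; apply: measurable_funM; first exact: measurable_cst.
    by apply: (measurable_Nsum (Y := fun i => cst (i.+1%:R ^+ p))) => i; exact: measurable_cst.
  move=> om _; rewrite -EFinM lee_fin.
  have := expn_le_sum (N om) p; rewrite -(ler_nat R) natrX natrM natr_sum.
  by under eq_bigr do rewrite natrX.
apply: (le_trans L).
have E1 : (\int[P]_om (\sum_(i < N om) i.+1%:R ^+ p)%:E <=
   ((c + 1) / trunc_mean * (p`!%:R * ((c + 1) / trunc_mean) ^+ p))%:E)%E.
  rewrite -(@lee_pmul2l _ trunc_mean%:E) // ?lte_fin // -W.
  apply: (le_trans U); rewrite -EFinM.
  rewrite (mulrA trunc_mean) (mulrC trunc_mean (_ / _)) divfK ?gt_eqF // EFinM.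
  by apply: lee_wpmul2l; rewrite ?lee_fin ?addr_ge0.
apply: (@le_trans _ _ (p.+1%:R%:E * ((c + 1) / trunc_mean * (p`!%:R * ((c + 1) / trunc_mean) ^+ p))%:E)%E).
  by apply: lee_wpmul2l; rewrite ?lee_fin.
rewrite -EFinM lee_fin factS natrM exprS.
by rewrite mulrCA !mulrA (mulrC _ (p`!%:R)) !mulrA mulrC !mulrA.
Qed.

End RenewalCount.

Lemma measure_eq_mod {R : realType} {d} {T : measurableType d}
  (P : {measure set T -> \bar R}) (A B G : set T) :
  measurable A -> measurable B -> measurable G -> P (~` G) = 0%E ->
  A `&` G = B `&` G -> P A = P B.
Proof.
move=> mA mB mG PG AB.
have E C : measurable C -> P C = P (C `&` G).
  move=> mC; rewrite (measureDI P mC mG) [X in (X + _)%E](_ : _ = 0%E) ?add0e //.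
  have mGC : measurable (~` G) by exact: measurableC.
  have mCG : measurable (C `\` G) by exact: measurableD.
  apply/eqP; rewrite -measure_le0 -PG; apply: le_measure; rewrite ?inE //.
by rewrite (E A) // (E B) // AB.
Qed.

(** * Nonexplosion and event counts from a fixed initial state *)

Section FixedStart.
Context {R : realType} {J : nat} {d : measure_display} {Om : measurableType d}.
Variables (P : probability Om R) (Pm : 'M[R]_J).
Variables (Te Ts : 'I_J -> nat -> Om -> R) (Phi : 'I_J -> nat -> Om -> option 'I_J).
Hypothesis Hprim : gjn_primitives P Pm Te Ts Phi.
Variables (alpha mu : 'I_J -> R).
Hypothesis alpha_ge0 : forall j, 0 <= alpha j.
Hypothesis mu_gt0 : forall j, 0 < mu j.
Hypothesis alpha_pos : exists i, 0 < alpha i.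
Variable x0 : state R J.
Hypothesis x0_valid : valid_state x0.
Variable t : R.
Hypothesis t_ge0 : 0 <= t.

Local Notation C om := (gC alpha mu (fun j n => Te j n om) (fun j n => Ts j n om)
                          (fun j n => Phi j n om) x0).
Local Notation rate := (rate alpha mu).
Local Notation D := (dat Te Ts).

Let te0 := Te_ge0 Hprim.
Let ts0 := Ts_ge0 Hprim.

Lemma Dge0 e n om : 0 <= D e n om.
Proof. by case: e => j; [exact: te0|exact: ts0]. Qed.

Lemma datE e n om : dat (fun j n => Te j n om) (fun j n => Ts j n om) e n = D e n om.
Proof. by case: e. Qed.

Lemma measurable_D e n : measurable_fun setT (D e n).
Proof. by case: e => j; [exact: measurable_Te Hprim _ _|exact: measurable_Ts Hprim _ _]. Qed.

Lemma D_id e n B : measurable B -> P (D e n @^-1` B) = P (D e 0%N @^-1` B).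
Proof. by case: Hprim => _ _ [h1 h2] _ _; case: e => j; [exact: h1|exact: h2]. Qed.

Lemma D_mean e : (\int[P]_om (D e 0%N om)%:E = 1%:E)%E.
Proof. by case: Hprim => _ _ _ [h1 [h2 _]] _; case: e => j; [exact: h1|exact: h2]. Qed.

Lemma mstate_x0 : mstate (fun=> x0 : state R J) (Om := Om).
Proof. by split => j; [move=> a; exact: mset_const| exact: measurable_cst | exact: measurable_cst]. Qed.

Let mx0 := mstate_x0.
Let mTe := measurable_Te Hprim.
Let mTs := measurable_Ts Hprim.
Let mPhi := dmeas_Phi Hprim.

Lemma measurable_hit e m : measurable [set om | hit (C om) t e m].
Proof. exact: mset_hit. Qed.

Definition tau (e : event J) : R := trunc_mean P (D e).

Lemma tau_gt0 e : 0 < tau e.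
Proof. by apply: trunc_mean_gt0; [exact: measurable_D|exact: Dge0|exact: D_mean]. Qed.

Lemma rate_t_ge0 e : 0 <= rate e * t.
Proof. by rewrite mulr_ge0 // rate_ge0. Qed.

Lemma ev_time_x0_ge0 e : 0 <= ev_time x0 e.
Proof. by case: e => j; have [] := x0_valid j. Qed.

(** Markov's inequality for the number of firings, whose mean is bounded by [count_moment]. *)
Lemma hit_prob_le e m : (P [set om | hit (C om) t e m] <=
  ((rate e * t + 1) / tau e / m.+1%:R)%:E)%E.
Proof.
(* Nonexplosion is not yet available, so the firings are counted only up to [m.+1]; since [hit] is
   decreasing in its index, [n < N] still means that firing [n] occurred. *)
pose N om := (\sum_(i < m.+1) `[< hit (C om) t e i >])%N.
have NE om n : (n < N om)%N <-> (n < m.+1)%N /\ hit (C om) t e n.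
  have Hs k : (forall i, (i < k)%N -> hit (C om) t e i) ->
      (\sum_(i < k) `[< hit (C om) t e i >] = k)%N.
    move=> h; rewrite (eq_bigr (fun=> 1%N)) ?sum_nat_const ?card_ord ?muln1 // => i _.
    by rewrite (asboolT (h _ (ltn_ord i))).
  have Hz k l : (k <= l)%N -> ~ hit (C om) t e k ->
      (\sum_(i < l) `[< hit (C om) t e i >] <= k)%N.
    move=> kl h; rewrite -(big_mkord xpredT (fun i => `[< hit (C om) t e i >] : nat)).
    rewrite (@big_cat_nat _ _ _ k) //= [X in (_ + X)%N](_ : _ = 0%N).
      rewrite addn0 big_mkord (leq_trans (leq_sum _ (fun i _ => leq_b1 _))) //.
      by rewrite sum_nat_const card_ord muln1.
    rewrite big_nat_cond big1 // => i /andP[/andP[ki il] _]; rewrite asboolF // => hi; apply: h.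
    exact: hit_anti hi.
  split.
    move=> h; have nm : (n < m.+1)%N.
      apply: leq_trans h _; rewrite /N (leq_trans (leq_sum _ (fun i _ => leq_b1 _))) //.
      by rewrite sum_nat_const card_ord muln1.
    split=> //; apply: contrapT => hn; have := Hz n m.+1 (ltnW nm) hn.
    by rewrite leqNgt -/(N om) h.
  move=> [nm hn]; rewrite /N -(big_mkord xpredT (fun i => `[< hit (C om) t e i >] : nat)).
  rewrite (@big_cat_nat _ _ _ n.+1) //= big_mkord Hs ?leq_addr // => i; rewrite ltnS => ni.
  exact: hit_anti hn.
have mN : dmeas N.
  have mb i : dmeas (fun om => `[< hit (C om) t e i >]).
    apply: dmeas_bool; have := measurable_hit e i; congr measurable.
    by apply/seteqP; split => om /= /asboolP.
  rewrite /N; elim: m.+1 => [|k IH].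
    by rewrite (_ : (fun om => _) = (fun=> 0%N)); [move=> a; exact: mset_const|apply/funext => om; rewrite big_ord0].
  rewrite (_ : (fun om => _) = (fun om => (fun q : nat * bool => (q.1 + q.2)%N)
     ((\sum_(i < k) `[< hit (C om) t e i >])%N, `[< hit (C om) t e k >]))); last first.
    by apply/funext => om; rewrite big_ord_recr.
  apply: (dmeas_comp (fun q : nat * bool => (q.1 + q.2)%N)); exact: dmeas_pair.
have H := @count_moment R d Om P N (D e) (rate e * t) mN (measurable_D e) (Dge0 e) (D_id e)
  _ (D_mean e) (rate_t_ge0 e) _ 1%N.
have {}H : (\int[P]_om ((N om)%:R ^+ 1)%:E <= (1`!%:R * ((rate e * t + 1) / tau e) ^+ 1)%:E)%E.
  apply: H.
  - move=> n B mB; have [nm|nm] := ltnP n m.+1.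
      have -> : [set om | (n < N om)%N] = [set om | hit (C om) t e n].
        by apply/seteqP; split => om /=; [move=> /NE[]|move=> h; apply/NE].
      by apply: (indep_hit_dat Hprim).
    have -> : [set om | (n < N om)%N] = set0.
      by apply/seteqP; split => om //= /NE[]; rewrite ltnNge nm.
    by rewrite setI0 measure0 mule0.
  - move=> om n /NE[_ /hit_sum]; move=> /(_ alpha_ge0 mu_gt0 alpha_pos x0_valid (te0 om) (ts0 om)).
    under eq_bigr do rewrite datE.
    apply: le_trans; rewrite lerDr; apply: mulr_ge0; [exact: rate_ge0|exact: ev_time_x0_ge0].
rewrite (_ : 1`! = 1%N) // expr1 mul1r in H.
rewrite EFinM lee_pdivlMr ?ltr0n // muleC.
apply: le_trans H.
have mh := measurable_hit e m.
rewrite -(setIT [set om | hit _ _ _ _]) -(integral_indic P _ mh) //.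
have mi : measurable_fun setT (fun x => (\1_[set om | hit (C om) t e m] x : R)%:E).
  by apply/measurable_EFinP; exact: measurable_indic.
rewrite -ge0_integralZl_EFin //.
apply: ge0_le_integral => //.
- exact: measurable_funeM.
- apply/measurable_EFinP; exact: (measurable_natpow mN 1).
move=> om _; rewrite -EFinM lee_fin indicE.
case: (boolP (om \in _)) => /=; rewrite ?mulr1 ?mulr0 ?expr1 // => /set_mem /= h.
by rewrite ler_nat; apply/NE.
Qed.

Definition nonexplosive_at := [set om | exists n, gidx (C om) t n].

Lemma measurable_Good : measurable nonexplosive_at.
Proof.
rewrite (_ : nonexplosive_at = \bigcup_n [set om | gidx (C om) t n]); first by apply: bigcupT_measurable => n; exact: mset_gidx.
by apply/seteqP; split => om [n]; [exists n|exists n].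
Qed.

(** By [hit_prob_le], infinitely many firings of one stream by time [t] have probability at most
    [K / (m+1)] for every [m], hence 0; there are finitely many streams. *)
Lemma Good_ae : P (~` nonexplosive_at) = 0%E.
Proof.
pose B e := \bigcap_m [set om | hit (C om) t e m].
have mB e : measurable (B e).
  by apply: bigcap_measurableType => m _; exact: measurable_hit.
have B0 e : P (B e) = 0%E.
  have Bfin : (P (B e) \is a fin_num)%E by exact: fin_num_measure.
  rewrite -(fineK Bfin); congr EFin; apply/eqP; rewrite eq_le fine_ge0 // andbT.
  rewrite leNgt; apply/negP => p0.
  set K := (rate e * t + 1) / tau e.
  have Hm m : fine (P (B e)) <= K / m.+1%:R.
    rewrite -lee_fin fineK //; apply: le_trans (hit_prob_le e m).
    have mh := measurable_hit e m.
    by apply: le_measure; rewrite ?inE // => om /(_ m I).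
  have [m hm] : exists m : nat, K / fine (P (B e)) < m%:R.
    by exists (Num.truncn (K / fine (P (B e)))).+1; exact: truncnS_gt.
  have := Hm m; rewrite ler_pdivlMr ?ltr0n // leNgt => /negP; apply.
  move: hm; rewrite ltr_pdivrMr // mulrC => /lt_le_trans; apply.
  by apply: ler_wpM2l; [exact: ltW|rewrite ler_nat].
have aeB e : {ae P, forall om, ~ B e om}.
  by exists (B e); split => // om /= /contrapT.
have : {ae P, forall om, nonexplosive_at om}.
  have H : {ae P, forall om, forall e, ~ B e om} by apply: (@filter_forall _ _ _ (almost_everywhere P)).
  apply: filterS H => om nB.
  apply: gidx_nonexplosive => // e; apply: contrapT => hE.
  by apply: (nB e) => m _ /=; apply: contrapT => hm; apply: hE; exists m.
by move=> /negligibleP; apply; exact: measurableC measurable_Good.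
Qed.

Lemma gpath_idxP om : nonexplosive_at om -> gidx (C om) t (gpath_idx (C om) t).
Proof.
move=> [n hn]; rewrite /gpath_idx.
have ex : exists n, gidx (C om) t n by exists n.
case: (ex_minnP ex) => m hm hmin.
case: xgetP => [k _ [] //|/(_ m)[]]; split => // k km hk.
by have := hmin k hk; rewrite leqNgt km.
Qed.

Lemma gpath_idx_bad om : ~ nonexplosive_at om -> gpath_idx (C om) t = 0%N.
Proof.
move=> nG; rewrite /gpath_idx; case: xgetP => // k _ [hk _].
by case: nG; exists k.
Qed.

(** On an explosive path the index defaults to 0 and so does the count, which keeps the path bound
    [Nt_path] true at every sample point. *)
Definition nb_events (e : event J) om : nat := cnt (C om (gpath_idx (C om) t)) e.

Lemma dmeas_Nt e : dmeas (nb_events e).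
Proof.
apply: (dmeas_case2 (g := fun n om => cnt (C om n) e)); first exact: dmeas_gpath_idx.
by move=> n; have [] := maug_gC alpha mu mTe mTs mPhi mx0 n.
Qed.

Lemma Nt_hit e om n : nonexplosive_at om -> hit (C om) t e n <-> (n < nb_events e om)%N.
Proof. by move=> /gpath_idxP; exact: hitE. Qed.

Lemma Nt_path e om n : (n < nb_events e om)%N ->
  rate e * ev_time x0 e + \sum_(i < n) D e i om <= rate e * t.
Proof.
move=> h; have [G|G] := pselect (nonexplosive_at om); last first.
  by move: h; rewrite /nb_events (gpath_idx_bad G); case: (e).
have /(Nt_hit e n G) /hit_sum := h.
move=> /(_ alpha_ge0 mu_gt0 alpha_pos x0_valid (te0 om) (ts0 om)).
by under eq_bigr do rewrite datE.
Qed.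

Lemma Nt_path0 e om n : (n < nb_events e om)%N -> \sum_(i < n) D e i om <= rate e * t.
Proof.
move=> /Nt_path; apply: le_trans; rewrite lerDr.
by apply: mulr_ge0; [exact: rate_ge0|exact: ev_time_x0_ge0].
Qed.

(** Up to the null set of explosive paths, [n < nb_events] is the event [hit], for which
    independence is known. *)
Lemma indep_Nt_dat e n B : measurable B ->
  P (D e n @^-1` B `&` [set om | (n < nb_events e om)%N]) =
  (P (D e n @^-1` B) * P [set om | (n < nb_events e om)%N])%E.
Proof.
move=> mB.
have mD : measurable (D e n @^-1` B).
  by rewrite -[X in measurable X]setTI; exact: measurable_D.
have mN : measurable [set om | (n < nb_events e om)%N] by apply: mset_leq; exact: dmeas_Nt.
have mh := measurable_hit e n.
have EG : [set om | (n < nb_events e om)%N] `&` nonexplosive_at = [set om | hit (C om) t e n] `&` nonexplosive_at.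
  by apply/seteqP; split => om [/= h G]; split => //; apply/(Nt_hit e n G).
rewrite (measure_eq_mod mN mh measurable_Good Good_ae EG).
rewrite -(indep_hit_dat Hprim) //.
apply: (measure_eq_mod (G := nonexplosive_at)) => //; try exact: measurableI.
- exact: measurable_Good.
- exact: Good_ae.
- by rewrite -!setIA EG.
Qed.

Lemma indep_Nt_ph j n B :
  P (Phi j n @^-1` B `&` [set om | (n < nb_events (inr j) om)%N]) =
  (P (Phi j n @^-1` B) * P [set om | (n < nb_events (inr j) om)%N])%E.
Proof.
have mD : measurable (Phi j n @^-1` B) by case: Hprim => -[_ []].
have mN : measurable [set om | (n < nb_events (inr j) om)%N] by apply: mset_leq; exact: dmeas_Nt.
have mh := measurable_hit (inr j) n.
have EG : [set om | (n < nb_events (inr j) om)%N] `&` nonexplosive_at = [set om | hit (C om) t (inr j) n] `&` nonexplosive_at.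
  by apply/seteqP; split => om [/= h G]; split => //; apply/(Nt_hit (inr j) n G).
rewrite (measure_eq_mod mN mh measurable_Good Good_ae EG).
rewrite -(indep_hit_ph Hprim) //.
apply: (measure_eq_mod (G := nonexplosive_at)) => //; try exact: measurableI.
- exact: measurable_Good.
- exact: Good_ae.
- by rewrite -!setIA EG.
Qed.

Lemma Nt_moment e p : (\int[P]_om ((nb_events e om)%:R ^+ p)%:E <=
  (p`!%:R * ((rate e * t + 1) / tau e) ^+ p)%:E)%E.
Proof.
apply: count_moment.
- exact: dmeas_Nt.
- exact: measurable_D.
- exact: Dge0.
- exact: D_id.
- by move=> n B mB; exact: indep_Nt_dat.
- exact: D_mean.
- exact: rate_t_ge0.
- by move=> om n; exact: Nt_path0.
Qed.

Lemma Nt_wald e (g : R -> R) (gam : R) : (forall x, 0 <= g x) -> measurable_fun setT g ->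
  (\int[P]_om (g (D e 0%N om))%:E = gam%:E)%E ->
  (\int[P]_om (\sum_(i < nb_events e om) g (D e i om))%:E = gam%:E * \int[P]_om ((nb_events e om)%:R)%:E)%E.
Proof.
move=> g0 mg Eg.
have := @wald_dat R d Om P (nb_events e) (D e) (dmeas_Nt e) (measurable_D e) (D_id e)
  (fun n B => @indep_Nt_dat e n B) (fun=> 1) g gam (fun=> ler01) g0 mg Eg.
under eq_integral do under eq_bigr do rewrite mul1r.
move=> ->; congr (_ * _)%E; apply: eq_integral => om _.
by rewrite sumr_const card_ord.
Qed.

Lemma Nt_wald_ph j k :
  (\int[P]_om (\sum_(i < nb_events (inr j) om) (Phi j i om == Some k)%:R)%:E =
   (Pm j k)%:E * \int[P]_om ((nb_events (inr j) om)%:R)%:E)%E.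
Proof.
have mY i : measurable [set om | Phi j i om = Some k] by exact: mPhi.
have PmE i : P [set om | Phi j i om = Some k] = (Pm j k)%:E.
  by case: Hprim => _ _ _ [_ [_ [h _]]] _; rewrite -(h j i k).
have YE i : (fun om => (Phi j i om == Some k)%:R : R) = \1_[set om | Phi j i om = Some k].
  apply/funext => om; rewrite indicE; case: eqP => h; first by rewrite mem_set.
  by rewrite memNset.
have W : (\int[P]_om (\sum_(i < nb_events (inr j) om) 1 * (Phi j i om == Some k)%:R)%:E =
   (Pm j k)%:E * \int[P]_om (\sum_(i < nb_events (inr j) om) 1)%:E)%E.
  apply: (wald_sum (dmeas_Nt (inr j)) (a := fun=> 1) (Y := fun i om => (Phi j i om == Some k)%:R)) => //.
  - by rewrite -lee_fin -(PmE 0%N) measure_ge0.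
  - by move=> i; rewrite YE; exact: measurable_indic.
  - move=> i; transitivity (\int[P]_(om in [set om | (i < nb_events (inr j) om)%N]) (\1_[set om | Phi j i om = Some k] om)%:E)%E.
      by apply: eq_integral => om _; rewrite -YE.
    have mN : measurable [set om | (i < nb_events (inr j) om)%N] by apply: mset_leq; exact: dmeas_Nt.
    rewrite integral_indic // -(PmE i) muleC.
    exact: (indep_Nt_ph j i [set Some k]).
move: W; under eq_integral do under eq_bigr do rewrite mul1r.
move=> ->; congr (_ * _)%E; apply: eq_integral => om _.
by rewrite sumr_const card_ord.
Qed.

End FixedStart.

(** * The path at a fixed time; recurrence of service completions *)

Section PathAtTime.
Context {R : realType} {J : nat} {d : measure_display} {Om : measurableType d}.
Variables (P : probability Om R) (Pm : 'M[R]_J).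
Variables (Te Ts : 'I_J -> nat -> Om -> R) (Phi : 'I_J -> nat -> Om -> option 'I_J).
Hypothesis Hprim : gjn_primitives P Pm Te Ts Phi.
Variables (alpha mu : 'I_J -> R).
Hypothesis alpha_ge0 : forall j, 0 <= alpha j.
Hypothesis mu_gt0 : forall j, 0 < mu j.
Hypothesis alpha_pos : exists i, 0 < alpha i.
Variable x0 : state R J.
Hypothesis x0_valid : valid_state x0.

Local Notation C om := (gC alpha mu (fun j n => Te j n om) (fun j n => Ts j n om)
                          (fun j n => Phi j n om) x0).
Local Notation rate := (rate alpha mu).
Local Notation D := (dat Te Ts).
Local Notation Good t := (nonexplosive_at Te Ts Phi alpha mu x0 t).
Local Notation Nt t := (nb_events Te Ts Phi alpha mu x0 t).
Local Notation X t om := (gpath alpha mu (fun j n => Te j n om) (fun j n => Ts j n om)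
                          (fun j n => Phi j n om) x0 t).
Let te0 := Te_ge0 Hprim.
Let ts0 := Ts_ge0 Hprim.

Definition visits_empty (t : R) (k : 'I_J) om : Prop :=
  exists n, clk (C om n) <= t /\ Zof (stt (C om n)) k = 0%N.

Lemma gjn_path_good t om : Good t om ->
  X t om = gjn_path alpha mu (fun j n => Te j n om) (fun j n => Ts j n om)
                          (fun j n => Phi j n om) x0 t.
Proof. by move=> /gpath_idxP H; rewrite (gjn_pathE alpha_ge0 mu_gt0 alpha_pos x0_valid (te0 om) (ts0 om) H). Qed.

(** Holds at every sample point: if the path explodes, both sides fall back to index 0. *)
Lemma XprocE t om : Xproc alpha mu Te Ts Phi x0 t om = X t om.
Proof.
have [G|nG] := pselect (Good t om); first by rewrite gjn_path_good.
rewrite /gpath (gpath_idx_bad nG) /Xproc /gjn_path.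
case: xgetP => [m _ /=|_]; last by [].
move=> [a [Ea [h1 h2]]]; exfalso; apply: nG; exists m; rewrite /gidx.
have E := gjn_chainE mu (fun j n => Te j n om) (fun j n => Ts j n om)
   (fun j n => Phi j n om) alpha_pos x0.
rewrite E in Ea; case: Ea => Ea; rewrite Ea h1 /=; apply: h2.
exact: (E m.+1).
Qed.

Section Facts.
Variables (t : R) (om : Om).
Hypothesis G : Good t om.
Let I0 e := inv_path alpha_ge0 mu_gt0 alpha_pos x0_valid (te0 om) (ts0 om) e (gpath_idxP G).

Lemma X_valid : valid_state (X t om).
Proof.
rewrite gjn_path_good //.
exact: (path_valid alpha_ge0 mu_gt0 alpha_pos x0_valid (te0 om) (ts0 om) (gpath_idxP G)).
Qed.

Lemma X_balance j : (Zof (X t om) j + Nt t (inr j) om = Zof x0 j + Nt t (inl j) om +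
  \sum_l \sum_(i < Nt t (inr l) om) (Phi l i om == Some j))%N.
Proof. exact: (Zof_balance mu _ _ _ alpha_pos x0 (gpath_idx (C om) t) j). Qed.

Lemma X_lower e : rate e * ev_time x0 e - rate e * t + \sum_(i < Nt t e om) D e i om
  <= rate e * ev_time (X t om) e.
Proof.
have [_ h _ _] := I0 e; rewrite gjn_path_good //; apply: le_trans h.
by rewrite lerD2l; under eq_bigr do rewrite -datE.
Qed.

Lemma X_upper e : rate e * ev_time (X t om) e <=
  (if Nt t e om is m.+1 then D e m om else rate e * ev_time x0 e).
Proof.
have [_ _ h _] := I0 e; rewrite gjn_path_good //; apply: (le_trans h).
by rewrite /nb_events; case: (cnt _ e) => // m; rewrite datE.
Qed.

Lemma X_upper_sum e : rate e * ev_time (X t om) e <=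
  rate e * ev_time x0 e + \sum_(i < Nt t e om) D e i om.
Proof.
apply: (le_trans (X_upper e)); case: (Nt t e om) => [|m].
  by rewrite big_ord0 addr0.
rewrite big_ord_recr /= addrA lerDr addr_ge0 //.
  apply: mulr_ge0; first exact: rate_ge0.
  exact: ev_time_x0_ge0.
by apply: sumr_ge0 => i _; exact: (Dge0 Hprim).
Qed.

Lemma X_busy k : ~ visits_empty t k om ->
  mu k * Rsof (X t om) k = mu k * Rsof x0 k - mu k * t + \sum_(i < Nt t (inr k) om) Ts k i om.
Proof.
move=> H; have := @ev_time_path_always_enabled _ _ _ _ _ _ _ alpha_ge0 mu_gt0 alpha_pos
  x0 x0_valid (te0 om) (ts0 om) t _ (inr k) (gpath_idxP G).
rewrite -gjn_path_good //; apply => m hm /=; rewrite lt0n; apply/eqP => z0.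
apply: H; exists m; split => //; have /andP[h1 _] := gpath_idxP G; apply: le_trans h1.
exact: clk_le.
Qed.

Lemma X_emptied k : visits_empty t k om -> (Zof x0 k <= Nt t (inr k) om)%N.
Proof.
move=> [m [h1 h2]].
have mn : (m <= gpath_idx (C om) t)%N.
  rewrite leqNgt; apply/negP => h; have /andP[_ h3] := gpath_idxP G.
  have := clk_le (fun j n => Phi j n om) alpha_ge0 mu_gt0 alpha_pos x0_valid (te0 om) (ts0 om) h.
  by rewrite leNgt (le_lt_trans h1 h3).
exact: emptied_count mn h2.
Qed.

Lemma X_no_event e : Nt t e om = 0%N -> ev_enabled alpha x0 e ->
  rate e * ev_time (X t om) e = rate e * ev_time x0 e - rate e * t.
Proof.
move=> N0 He; have := @ev_time_path_always_enabled _ _ _ _ _ _ _ alpha_ge0 mu_gt0 alpha_pos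
  x0 x0_valid (te0 om) (ts0 om) t _ e (gpath_idxP G).
rewrite -gjn_path_good // => -> => [|m hm]; last exact: (no_event_enabled alpha_pos N0 He hm).
by rewrite -[cnt _ e]/(Nt t e om) N0 big_ord0 addr0.
Qed.

Lemma X_idle_after j m : Zof (X t om) j = 0%N -> Nt t (inr j) om = m.+1 ->
  idle_after (C om) t j m.
Proof. by move=> z0 hn; exists (gpath_idx (C om) t); split => //; exact: gpath_idxP. Qed.

Lemma X_idle_start j : Zof (X t om) j = 0%N -> Nt t (inr j) om = 0%N -> Zof x0 j = 0%N.
Proof. by have := X_balance j; lia. Qed.

End Facts.

Lemma nonexplosive_ae : {ae P, forall om, forall t : R, exists n, t < clk (C om n)}.
Proof.
have H : {ae P, forall om, forall n : nat, Good n%:R om}.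
  apply/ae_foralln => n.
  have := Good_ae Hprim alpha_ge0 mu_gt0 alpha_pos x0_valid (ler0n R n).
  move=> h; exists (~` Good n%:R); split => //.
  apply: measurableC; apply: measurable_Good; exact: Hprim.
apply: filterS H => om H t.
have [n hn] : exists n : nat, t < n%:R.
  by exists (Num.truncn t).+1; exact: truncnS_gt.
have [m /andP[_ hm]] := H n; exists m.+1; exact: lt_trans hm.
Qed.

(** By independence, avoiding [j] in [L] consecutive routing decisions from index [m] on has
    probability [(1 - Pm i j)^L], which tends to 0. *)
Lemma routing_ae i j : 0 < Pm i j ->
  {ae P, forall om, forall m, exists n, (m <= n)%N /\ Phi i n om = Some j}.
Proof.
move=> pij; apply/ae_foralln => m.
pose B n := Phi i n @^-1` [set o | o <> Some j].
have mB n : measurable (B n) by rewrite /B; case: Hprim => -[_ []].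
have PB n : P (B n) = (1 - Pm i j)%:E.
  have -> : B n = ~` (Phi i n @^-1` [set Some j]) by [].
  rewrite probability_setC; last by case: Hprim => -[_ []].
  by case: Hprim => _ _ _ [_ [_ [-> _]]] _.
have q1 : 1 - Pm i j < 1 by rewrite ltrBlDr ltrDl.
have q0 : 0 <= 1 - Pm i j by rewrite -lee_fin -(PB 0%N) measure_ge0.
pose A := \bigcap_n B (m + n)%N.
have mA : measurable A by apply: bigcap_measurableType.
have PA L : (P A <= ((1 - Pm i j) ^+ L)%:E)%E.
  have [_ _ _ _ ind] := Hprim.
  pose s := [seq (routing_kind, i, (m + n)%N) | n <- iota 0 L].
  have us : uniq s.
    by rewrite map_inj_uniq ?iota_uniq // => x y [] /addnI.
  have := ind s (fun q => B q.2) us.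
  have -> : (\prod_(q <- s) P (B q.2) = ((1 - Pm i j) ^+ L)%:E)%E.
    rewrite big_map; rewrite (eq_bigr (fun=> (1 - Pm i j)%:E)) => [|n _]; last exact: PB.
    rewrite -[L in RHS](size_iota 0); elim: (iota 0 L) => [|a l IH]; first by rewrite big_nil.
    by rewrite big_cons IH /= exprS EFinM.
  move=> <- => [|q /mapP[n _ ->]]; last by exists [set o | o <> Some j].
  apply: le_measure; rewrite ?inE //.
    by apply: fin_bigcap_measurable; [exact: finite_seq|move=> q _; exact: mB].
  by move=> om h q /= /mapP[n _ ->] /=; exact: h.
have PA0 : P A = 0%E.
  have Pf : (P A \is a fin_num)%E by exact: fin_num_measure.
  apply/eqP; rewrite eq_le measure_ge0 andbT -(fineK Pf) lee_fin.
  have cv : (1 - Pm i j) ^+ L @[L --> \oo] --> (0 : R).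
    by apply: cvg_expr; rewrite ger0_norm.
  rewrite -(cvg_lim _ cv) //; apply: limr_ge; first exact: cvgP cv.
  by near=> L; rewrite -lee_fin fineK.
exists A; split => // om /= h n _ /= E; apply: h; exists (m + n)%N.
by rewrite leq_addr.
Unshelve. all: by end_near. Qed.

(** Let [v] be [lambda] restricted to the complement of [S]. No flow enters that complement from
    outside or from [S], so the traffic equations give [v <= v P]; substochasticity gives the
    reverse inequality for the totals, hence [v = v P], and invertibility of [I - P] forces [v = 0].
    As [lambda] is positive, the complement is empty. *)
Lemma closed_class_total (lambda : 'I_J -> R) (S : 'I_J -> Prop) :
  network_data alpha Pm lambda -> (forall j, 0 < alpha j -> S j) ->
  (forall i j, S i -> 0 < Pm i j -> S j) -> forall j, S j.
Proof.
move=> [P0 P1 inv a0 lam] Sa SP.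
pose s j := `[< S j >].
pose v : 'rV[R]_J := \row_j (if s j then 0 else lambda j).
have inU l j : s l -> ~~ s j -> Pm l j = 0.
  move=> /asboolP Sl /asboolPn nS; apply/eqP; rewrite eq_le P0 andbT leNgt.
  by apply/negP => /(SP l j Sl).
have aU j : ~~ s j -> alpha j = 0.
  move=> /asboolPn nS; apply/eqP; rewrite eq_le a0 andbT leNgt.
  by apply/negP => /Sa.
have v0 l : 0 <= v 0 l by rewrite mxE; case: ifP => // _; case: (lam l) => _ /ltW.
have vP j : (v *m Pm) 0 j = \sum_l v 0 l * Pm l j by rewrite mxE.
have vU j : ~~ s j -> v 0 j = \sum_l v 0 l * Pm l j.
  move=> sj; rewrite mxE (negbTE sj); case: (lam j) => -> _; rewrite aU // add0r.
  apply: eq_bigr => l _; rewrite mxE; case: ifP => // sl.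
  by rewrite inU // mul0r mulr0.
have vge j : v 0 j <= (v *m Pm) 0 j.
  rewrite vP; have [sj|sj] := boolP (s j); last by rewrite -vU.
  by rewrite {1}mxE sj sumr_ge0 // => l _; rewrite mulr_ge0.
have sumle : \sum_j (v *m Pm) 0 j <= \sum_j v 0 j.
  under eq_bigr do rewrite vP.
  rewrite exchange_big /=; apply: ler_sum => l _.
  by rewrite -mulr_sumr ler_piMr.
have sumeq : \sum_j ((v *m Pm) 0 j - v 0 j) = 0.
  apply/eqP; rewrite eq_le sumrB subr_le0 sumle /= subr_ge0.
  by apply: ler_sum.
have veq : v *m Pm = v.
  apply/rowP => j; apply/eqP; rewrite -subr_eq0.
  move: sumeq; move/eqP; rewrite psumr_eq0 => [/allP/(_ j)|i _]; last by rewrite subr_ge0.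
  by rewrite mem_index_enum => /(_ isT).
have v00 : v = 0.
  have : v *m (1%:M - Pm) = 0 by rewrite mulmxBr mulmx1 veq subrr.
  by move=> /(congr1 (mulmx^~ (invmx (1%:M - Pm)))); rewrite mul0mx mulmxK.
move=> j; apply: contrapT => nS; have : v 0 j = 0 by rewrite v00 mxE.
rewrite mxE /s asboolF //; case: (lam j) => _ + E; by rewrite E ltxx.
Qed.

(** Almost surely, the stations with infinitely many completions include those fed from outside and
    are closed under routing, so [closed_class_total] applies. *)
Lemma service_diverges_ae (lambda : 'I_J -> R) j : network_data alpha Pm lambda ->
  {ae P, forall om, exists t : nat, hit (C om) t%:R (inr j) 0}.
Proof.
move=> nd.
have H : {ae P, forall om, forall i l, 0 < Pm i l ->
    forall m, exists n, (m <= n)%N /\ Phi i n om = Some l}.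
  apply: (@filter_forall _ _ _ (almost_everywhere P)) => i.
  apply: (@filter_forall _ _ _ (almost_everywhere P)) => l.
  have [p|p] := boolP (0 < Pm i l); last by apply: aeW.
  by apply: filterS (routing_ae p) => om h _.
apply: (filterS2 _ _ nonexplosive_ae H) => om ne rt.
have /(_ j 0%N) [n hn] := closed_class_total nd
  (@external_diverges _ _ _ _ _ _ _ alpha_ge0 mu_gt0 alpha_pos x0 x0_valid (te0 om) (ts0 om) ne)
  (fun i l Si pil => @routing_diverges _ _ _ _ _ _ _ alpha_ge0 mu_gt0 alpha_pos x0 x0_valid (te0 om) (ts0 om) ne i l Si (rt i l pil)).
exists (Num.truncn (clk (C om n))).+1; exists n; split => //.
by apply/ltW; exact: truncnS_gt.
Qed.

End PathAtTime.

(** Only [g] is assumed measurable: the integral of [f] is a supremum over simple functions below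
    [f], and each of them is compared with [g]. *)
Lemma ge0_integral_le_ae {R : realType} {d} {T : measurableType d}
  (m : {measure set T -> \bar R}) (V : set T) (f g : T -> \bar R) :
  measurable V -> m (~` V) = 0%E -> (forall x, 0 <= f x)%E -> (forall x, 0 <= g x)%E ->
  measurable_fun setT g -> (forall x, V x -> f x <= g x)%E ->
  (\int[m]_x f x <= \int[m]_x g x)%E.
Proof.
move=> mV mV0 f0 g0 mg fg.
rewrite [leLHS]ge0_integralTE //.
apply: ub_ereal_sup => _ [h /= hf <-].
rewrite -integralT_nnsfun.
have mVC : measurable (~` V) by exact: measurableC.
have mh : measurable_fun setT (fun x => (h x)%:E : \bar R).
  by apply/measurable_EFinP; exact: measurable_funPT.
apply: (ae_ge0_le_integral measurableT) => //.
  by move=> x _; rewrite lee_fin; exact: fun_ge0.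
exists (~` V); split => // x /= hx Vx; apply: hx => _; exact: (le_trans (hf x) (fg x Vx)).
Qed.

Lemma integral_prob_cst {R : realType} {d} {T : measurableType d}
  (P : probability T R) (r : R) : (\int[P]_x r%:E = r%:E)%E.
Proof.
transitivity (r%:E * P setT)%E; first exact: (integral_cst P measurableT r%:E).
by rewrite probability_setT mule1.
Qed.

Section StateMeasurability.
Context {R : realType} {J : nat}.

Lemma mstate_id : mstate (fun x : stateM R J => x : state R J).
Proof.
split => j.
- move=> a; apply: sub_sigma_algebra; left; by exists j, a.
- move=> _ B mB; rewrite setTI; apply: sub_sigma_algebra; right; left; by exists j, B.
- move=> _ B mB; rewrite setTI; apply: sub_sigma_algebra; right; right; by exists j, B.
Qed.

Lemma measurable_mstate {d} {Om : measurableType d} (x : Om -> state R J) :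
  mstate x -> measurable_fun setT (x : Om -> stateM R J).
Proof.
move=> [mz me ms]; apply: (@measurability _ _ Om (stateM R J) setT x (@state_gen R J)) => // _ [A GA <-]; rewrite setTI.
case: GA => [[j [n ->]]|[[j [B [mB ->]]]|[j [B [mB ->]]]]].
- exact: mz.
- by have := me j measurableT B mB; rewrite setTI.
- by have := ms j measurableT B mB; rewrite setTI.
Qed.

Lemma mstate_comp {d d'} {Om : measurableType d} {Om' : measurableType d'}
  (x : Om -> state R J) (f : Om' -> Om) :
  mstate x -> measurable_fun setT f -> mstate (fun om => x (f om)).
Proof.
move=> [mz me ms] mf; split => j.
- by move=> a; have := mf measurableT _ (mz j a); rewrite setTI.
- exact: (measurableT_comp (me j) mf).
- exact: (measurableT_comp (ms j) mf).
Qed.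

Lemma measurable_valid : measurable [set x : stateM R J | valid_state x].
Proof.
have [_ me ms] := mstate_id.
rewrite (_ : [set _ | _] = \bigcap_(j : 'I_J) ([set x : stateM R J | 0 <= Reof x j] `&` [set x : stateM R J | 0 <= Rsof x j])).
  apply: fin_bigcap_measurable; first exact: finite_finset.
  move=> j _; apply: measurableI.
    by apply: mset_ler => //; exact: measurable_cst.
  by apply: mset_ler => //; exact: measurable_cst.
by apply/seteqP; split => x /= h j; [move=> _; exact: h|have [] := h j I].
Qed.

End StateMeasurability.

(** * Stationarity *)

Section Stationary.
Context {R : realType} {J : nat} {d : measure_display} {Om : measurableType d}.
Variables (P : probability Om R) (Pm : 'M[R]_J).
Variables (Te Ts : 'I_J -> nat -> Om -> R) (Phi : 'I_J -> nat -> Om -> option 'I_J).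
Hypothesis Hprim : gjn_primitives P Pm Te Ts Phi.
Variables (alpha mu : 'I_J -> R).
Hypothesis alpha_ge0 : forall j, 0 <= alpha j.
Hypothesis mu_gt0 : forall j, 0 < mu j.
Hypothesis alpha_pos : exists i, 0 < alpha i.
Variable pi : probability (stateM R J) R.
Hypothesis Hpi : is_stationary P alpha mu Te Ts Phi pi.

Local Notation X x t om := (gpath alpha mu (fun j n => Te j n om) (fun j n => Ts j n om)
                          (fun j n => Phi j n om) x t).
Local Notation V := [set x : stateM R J | valid_state x].

Lemma piV : pi (~` V) = 0%E.
Proof.
rewrite probability_setC; last exact: measurable_valid.
by have [-> _] := Hpi; rewrite subee.
Qed.

Lemma ae_valid : {ae pi, forall x, valid_state x}.
Proof. by exists (~` V); split => //; [apply: measurableC; exact: measurable_valid|exact: piV]. Qed.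

Let mTe := measurable_Te Hprim.
Let mTs := measurable_Ts Hprim.
Let mPhi := dmeas_Phi Hprim.

Lemma measurable_X_prod t :
  measurable_fun setT (fun z : stateM R J * Om => X z.1 t z.2 : stateM R J).
Proof.
apply: measurable_mstate.
apply: (mstate_gpath alpha mu (te := fun j n (z : stateM R J * Om) => Te j n z.2)
  (ts := fun j n z => Ts j n z.2) (ph := fun j n z => Phi j n z.2) (x0 := fun z => z.1)).
- move=> j n; exact: (measurableT_comp (mTe j n) measurable_snd).
- move=> j n; exact: (measurableT_comp (mTs j n) measurable_snd).
- move=> j n a; have := @measurable_snd _ _ (stateM R J) Om measurableT _ (mPhi j n a).
  by rewrite setTI.
- exact: (mstate_comp mstate_id measurable_fst).
Qed.

Lemma measurable_X_sec t (x : stateM R J) : measurable_fun setT (fun om => X x t om : stateM R J).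
Proof.
apply: measurable_mstate; apply: (mstate_gpath alpha mu (x0 := fun=> x)) => //.
exact: mstate_x0.
Qed.

(** The integrand in [is_stationary] is identified with a measurable function only at valid states,
    which yields one inequality through [ge0_integral_le_ae]. Applied to [A] and to its complement,
    that inequality becomes an equality between probability measures. *)
Lemma stationary_law t (A : set (stateM R J)) : 0 <= t -> measurable A ->
  pi A = (pi \x P)%E ((fun z : stateM R J * Om => X z.1 t z.2) @^-1` A).
Proof.
move=> t0 mA.
have mX B : measurable B -> measurable ((fun z : stateM R J * Om => X z.1 t z.2 : stateM R J) @^-1` B).
  by move=> mB; rewrite -[S in measurable S]setTI; exact: measurable_X_prod.
have le B : measurable B -> (pi B <= (pi \x P)%E ((fun z : stateM R J * Om => X z.1 t z.2) @^-1` B))%E.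
  move=> mB; have [_ /(_ B mB t t0) ->] := Hpi.
  apply: (ge0_integral_le_ae measurable_valid piV) => //.
  - exact: (measurable_fun_xsection P (mX B mB)).
  - move=> x Vx /=; rewrite le_eqVlt; apply/orP; left; apply/eqP; congr (P _).
    apply/seteqP; split => om /=; rewrite (XprocE Hprim alpha_ge0 mu_gt0 alpha_pos Vx) /xsection /=.
      by move=> h; rewrite in_setE.
    by rewrite in_setE.
apply/eqP; rewrite eq_le le //=.
have fA : (pi A \is a fin_num)%E by exact: fin_num_measure.
have := le (~` A) (measurableC mA).
pose F (z : stateM R J * Om) : stateM R J := X z.1 t z.2.
pose q := (pi \x P)%E (F @^-1` A).
have hC : ((pi \x P)%E (F @^-1` (~` A)) = 1 - q)%E.
  by rewrite preimage_setC; apply: (@probability_setC _ _ _ (pi \x P)%E); exact: mX.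
have fq : q \is a fin_num.
  have q0 : (0 <= q)%E by apply: integral_ge0 => x _; exact: measure_ge0.
  rewrite ge0_fin_numE // (@le_lt_trans _ _ 1%E) ?ltry //.
  by apply: (@probability_le1 _ _ _ (pi \x P)%E); exact: mX.
change ((pi (~` A) <= (pi \x P)%E (F @^-1` (~` A)))%E -> (q <= pi A)%E).
rewrite hC probability_setC // -(fineK fA) -(fineK fq) -!EFinB !lee_fin; lra.
Qed.

Lemma stationary_integral t (G : stateM R J -> \bar R) : 0 <= t ->
  measurable_fun setT G -> (forall x, 0 <= G x)%E ->
  (\int[pi]_x G x = \int[pi]_x \int[P]_om G (X x t om))%E.
Proof.
move=> t0 mG G0.
rewrite (eq_measure_integral (pushforward (pi \x P)%E (fun z : stateM R J * Om => X z.1 t z.2 : stateM R J))); last first.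
  by move=> ? A mA _; exact: (stationary_law t0 mA).
  move=> mX; rewrite (ge0_integral_pushforward mX) //.
  rewrite preimage_setT (fubini_tonelli1 (fun z : stateM R J * Om => G (X z.1 t z.2))) //.
  exact: (measurableT_comp mG mX).
exact: measurable_X_prod.
Qed.

Lemma measurable_fun_expect t (G : stateM R J -> \bar R) :
  measurable_fun setT G -> (forall x, 0 <= G x)%E ->
  measurable_fun setT (fun x : stateM R J => \int[P]_om G (X x t om))%E.
Proof.
move=> mG G0.
apply: (@measurable_fun_fubini_tonelli_F _ _ _ _ _ P (fun z : stateM R J * Om => G (X z.1 t z.2))) => //.
exact: (measurableT_comp mG (measurable_X_prod t)).
Qed.

(* [G] need not be integrable: the drift inequality survives truncation of [G] at level [K],
   and then [K] tends to infinity. *)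
Lemma stationary_drift t (G a b : stateM R J -> R) : 0 <= t ->
  measurable_fun setT G -> measurable_fun setT a -> measurable_fun setT b ->
  (forall x, 0 <= G x) -> (forall x, 0 <= a x) -> (forall x, 0 <= b x) ->
  (forall x, valid_state x ->
    \int[P]_om (G (X x t om))%:E + (a x)%:E <= (G x + b x)%:E)%E ->
  (\int[pi]_x (a x)%:E <= \int[pi]_x (b x)%:E)%E.
Proof.
move=> t0 mG ma mb G0 a0 b0 H.
pose GK (K : nat) (x : stateM R J) : R := Num.min (G x) K%:R.
pose aK (K : nat) (x : stateM R J) : R := a x * (G x <= K%:R)%R%:R.
have mGK K : measurable_fun setT (GK K).
  by apply: measurable_minr => //; exact: measurable_cst.
have maK K : measurable_fun setT (aK K).
  apply: measurable_funM => //.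
  rewrite (_ : (fun x => _) = \1_[set x | G x <= K%:R]).
    apply: measurable_indic; apply: mset_ler => //; exact: measurable_cst.
  apply/funext => x; rewrite indicE; case: (boolP (G x <= K%:R)) => h; first by rewrite mem_set.
  by rewrite memNset //=; exact/negP.
have GK0 K x : 0 <= GK K x by rewrite le_min G0 ler0n.
have aK0 K x : 0 <= aK K x by rewrite mulr_ge0.
have step K : (\int[pi]_x (aK K x)%:E <= \int[pi]_x (b x)%:E)%E.
  have E1 : (\int[pi]_x (GK K x)%:E + \int[pi]_x (aK K x)%:E <=
             \int[pi]_x (GK K x)%:E + \int[pi]_x (b x)%:E)%E.
    rewrite [S in (S + _ <= _)%E](@stationary_integral t (fun x => (GK K x)%:E) t0) //; last 2 first.
    - by apply/measurable_EFinP.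
    - by move=> x; rewrite lee_fin.
    have mE : measurable_fun setT (fun x : stateM R J => \int[P]_om (GK K (X x t om))%:E)%E.
      apply: (@measurable_fun_expect t (fun x => (GK K x)%:E)) => //.
      - by apply/measurable_EFinP.
      - by move=> x; rewrite lee_fin.
    rewrite -!ge0_integralD //; try by [move=> x _; rewrite lee_fin | apply/measurable_EFinP
      | move=> x _; apply: integral_ge0 => om _; rewrite lee_fin].
    apply: (ge0_integral_le_ae measurable_valid piV).
    - by move=> x; rewrite adde_ge0 ?lee_fin // integral_ge0 // => om _; rewrite lee_fin.
    - by move=> x; rewrite adde_ge0 ?lee_fin.
    - by apply: emeasurable_funD; apply/measurable_EFinP.
    - move=> x Vx.
      have mGX : measurable_fun setT (fun om => G (X x t om)).
        exact: (measurableT_comp mG (measurable_X_sec t x)).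
      have mGKX : measurable_fun setT (fun om => GK K (X x t om)).
        exact: (measurableT_comp (mGK K) (measurable_X_sec t x)).
      (* Below level [K] truncation only decreases the expectation after time [t], so the drift
         inequality persists; above it the truncated function already has its maximal value [K] at
         [x], and the gain term is switched off. *)
      rewrite /aK; have [GxK|GxK] := leP (G x) K%:R.
        rewrite mulr1 {2}/GK (min_idPl GxK); apply: le_trans (H x Vx).
        apply: leeD => //; apply: ge0_le_integral => //.
        + by move=> om _; rewrite lee_fin.
        + by apply/measurable_EFinP.
        + by apply/measurable_EFinP.
        + by move=> om _; rewrite lee_fin ge_min lexx.
      rewrite mulr0 adde0 {2}/GK (min_idPr (ltW GxK)).
      apply: (@le_trans _ _ (K%:R%:E)%E); last by rewrite leeDl ?lee_fin.
      apply: (@le_trans _ _ (\int[P]_om K%:R%:E)%E).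
        apply: ge0_le_integral => //.
        + by move=> om _; rewrite lee_fin.
        + by apply/measurable_EFinP.
        + by move=> om _; rewrite lee_fin ge_min lexx orbT.
      by rewrite integral_prob_cst.
  (* Finiteness, gained by truncation, is what permits cancelling this term on both sides. *)
  have fG : (\int[pi]_x (GK K x)%:E \is a fin_num)%E.
    rewrite ge0_fin_numE; last by apply: integral_ge0 => x _; rewrite lee_fin.
    apply: (@le_lt_trans _ _ (\int[pi]_x K%:R%:E)%E).
      apply: ge0_le_integral => //.
      + by move=> om _; rewrite lee_fin.
      + by apply/measurable_EFinP.
      + by move=> om _; rewrite lee_fin ge_min lexx orbT.
    by rewrite integral_prob_cst ltry.
  by move: E1; rewrite leeD2lE.
have lim x : (a x)%:E = limn (fun K => (aK K x)%:E).
  apply/esym/cvg_lim => //; apply: cvg_EFin; first by near=> K.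
  apply: (@cvg_near_cst).
  near=> K; rewrite /aK /= (_ : G x <= K%:R) ?mulr1 //.
  near: K; exists (Num.truncn (G x)).+1 => // K /= hK.
  by apply: (le_trans (ltW (truncnS_gt (G x)))); rewrite ler_nat.
rewrite (eq_integral _ _ (fun x _ => lim x)) monotone_convergence //; last 3 first.
- by move=> K; apply/measurable_EFinP.
- by move=> K x _; rewrite lee_fin.
- move=> x _ K L KL; rewrite lee_fin /aK ler_wpM2l // ler_nat.
  case: (boolP (G x <= K%:R)) => //= h; rewrite (le_trans h) // ler_nat //.
apply: lime_le; last by near=> K; exact: step.
apply: ereal_nondecreasing_is_cvgn => K L KL; apply: ge0_le_integral => //.
- by move=> x _; rewrite lee_fin.
- by apply/measurable_EFinP.
- by apply/measurable_EFinP.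
- move=> x _; rewrite lee_fin /aK ler_wpM2l // ler_nat.
  case: (boolP (G x <= K%:R)) => //= h; rewrite (le_trans h) // ler_nat //.
Unshelve. all: by end_near. Qed.

End Stationary.

(** * Residual times under the stationary law *)

Section Residuals.
Context {R : realType} {J : nat} {d : measure_display} {Om : measurableType d}.
Variables (P : probability Om R) (Pm : 'M[R]_J).
Variables (Te Ts : 'I_J -> nat -> Om -> R) (Phi : 'I_J -> nat -> Om -> option 'I_J).
Hypothesis Hprim : gjn_primitives P Pm Te Ts Phi.
Variables (alpha mu lambda : 'I_J -> R).
Hypothesis Hnet : network_data alpha Pm lambda.
Hypothesis mu_gt0 : forall j, 0 < mu j.
Hypothesis alpha_pos : exists i, 0 < alpha i.

Local Notation X x t om := (gpath alpha mu (fun j n => Te j n om) (fun j n => Ts j n om)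
                          (fun j n => Phi j n om) x t).
Local Notation rate := (rate alpha mu).
Local Notation D := (dat Te Ts).
Local Notation N x t := (nb_events Te Ts Phi alpha mu x t).
Local Notation tau e := (tau P Te Ts e).

Lemma alpha_ge0 : forall j, 0 <= alpha j. Proof. by case: Hnet. Qed.
Let alpha0 := alpha_ge0.
Let mTe := measurable_Te Hprim.
Let mTs := measurable_Ts Hprim.
Let mPhi := dmeas_Phi Hprim.

(* On valid states the absolute value is superfluous; it makes [rho] nonnegative everywhere. *)
Definition rho (e : event J) (x : state R J) : R := `|rate e * ev_time x e|.

Lemma rho_ge0 e x : 0 <= rho e x. Proof. exact: normr_ge0. Qed.

Lemma rhoE e x : valid_state x -> rho e x = rate e * ev_time x e.
Proof.
move=> Vx; apply: ger0_norm; apply: mulr_ge0; first exact: rate_ge0.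
by case: e => j; have [] := Vx j.
Qed.

Lemma measurable_rho e : measurable_fun setT (fun x : stateM R J => rho e x).
Proof.
have H : measurable_fun setT (fun x : stateM R J => rate e * ev_time x e).
  apply: measurable_funM; first exact: measurable_cst.
  exact: (mfun_ev_time e mstate_id).
exact: (measurableT_comp (@normr_measurable R setT) H).
Qed.

Lemma D_moment_wald x t e p gam : valid_state x -> 0 <= t ->
  (\int[P]_om (D e 0%N om ^+ p)%:E = gam%:E)%E ->
  (\int[P]_om (\sum_(i < N x t e om) D e i om ^+ p)%:E =
    gam%:E * \int[P]_om ((N x t e om)%:R)%:E)%E.
Proof.
move=> Vx t0 Eg.
have := Nt_wald Hprim alpha0 mu_gt0 alpha_pos Vx t0 (e := e) (g := fun y => `|y| ^+ p) (gam := gam).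
have mg : measurable_fun setT (fun y : R => `|y| ^+ p).
  by apply: measurable_funX; exact: normr_measurable.
move=> /(_ _ mg _) H; rewrite -H.
- apply: eq_integral => om _; congr EFin; apply: eq_bigr => i _.
  by rewrite ger0_norm //; exact: (Dge0 Hprim).
- by move=> y; rewrite exprn_ge0.
- by rewrite -Eg; apply: eq_integral => om _; rewrite ger0_norm //; exact: (Dge0 Hprim).
Qed.

Lemma N_mean_le x t e : valid_state x -> 0 <= t ->
  (\int[P]_om ((N x t e om)%:R)%:E <= ((rate e * t + 1) / tau e)%:E)%E.
Proof.
move=> Vx t0; have := Nt_moment Hprim alpha0 mu_gt0 alpha_pos Vx t0 e 1%N.
by rewrite (_ : 1`! = 1%N) // mul1r expr1; under eq_integral do rewrite expr1.
Qed.

Lemma Xprime_ae x t : valid_state x -> 0 <= t ->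
  {ae P, forall om, nonexplosive_at Te Ts Phi alpha mu x t om}.
Proof.
move=> Vx t0; exists (~` nonexplosive_at Te Ts Phi alpha mu x t); split => //.
- by apply: measurableC; apply: measurable_Good; exact: Hprim.
- exact: (Good_ae Hprim alpha0 mu_gt0 alpha_pos Vx t0).
Qed.

Lemma measurable_X_fun (G : stateM R J -> R) x t : measurable_fun setT G ->
  measurable_fun setT (fun om => G (X x t om)).
Proof. by move=> mG; exact: (measurableT_comp mG (measurable_X_sec Hprim alpha mu t x)). Qed.

Lemma residual_power_drop (s r y : R) (M : nat) : 0 <= s -> 0 <= r ->
  s * r ^+ M <= r ^+ M.+1 + s ^+ M.+1.
Proof.
move=> s0 r0; have [rs|sr] := leP r s.
  rewrite -[leLHS]add0r lerD ?exprn_ge0 // exprS ler_wpM2l // lerXn2r ?nnegrE //.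
rewrite -[leLHS]addr0 lerD ?exprn_ge0 // exprS ler_wpM2r ?exprn_ge0 //; exact: ltW.
Qed.

(** If the clock does not fire, it either stands still or loses exactly [rate e], and
    [(y-s)^(M+1) + s y^M <= y^(M+1)] for [0 <= s <= y]. If it fires, the new residual is at most the
    last datum drawn, and [residual_power_drop] pays for the gain term. *)
Lemma rho_step_path x e M om : valid_state x ->
  nonexplosive_at Te Ts Phi alpha mu x 1 om ->
  rho e (X x 1 om) ^+ M.+1 + (ev_enabled alpha x e)%:R * (rate e * rho e x ^+ M) <=
  rho e x ^+ M.+1 + rate e ^+ M.+1 + \sum_(i < N x 1 e om) D e i om ^+ M.+1.
Proof.
move=> Vx G.
have r0 := rho_ge0 e x.
have s0 : 0 <= rate e by exact: rate_ge0.
have X0 := rho_ge0 e (X x 1 om).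
have VX : valid_state (X x 1 om) by exact: (X_valid Hprim).
have drop := residual_power_drop 0 M s0 r0.
have enl : (ev_enabled alpha x e)%:R * (rate e * rho e x ^+ M) <= rate e * rho e x ^+ M.
  by rewrite ler_piMl ?mulr_ge0 ?exprn_ge0 // lern1 leq_b1.
have := X_upper Hprim alpha0 mu_gt0 alpha_pos Vx G e; rewrite -!rhoE //.
case EN : (N x 1 e om) => [|m] hX.
  rewrite big_ord0 addr0.
  have [He|He] := boolP (ev_enabled alpha x e); last first.
    rewrite mul0r addr0 -[leLHS]addr0 lerD ?exprn_ge0 //.
    by rewrite lerXn2r ?nnegrE.
  rewrite mul1r.
  have E := X_no_event Hprim alpha0 mu_gt0 alpha_pos Vx G EN He.
  rewrite -!rhoE // mulr1 in E.
  rewrite E in X0 *.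
  apply: (@le_trans _ _ (rho e x ^+ M.+1)); last by rewrite lerDl exprn_ge0.
  rewrite exprS [in leRHS]exprS.
  have : (rho e x - rate e) ^+ M <= rho e x ^+ M by rewrite lerXn2r ?nnegrE // gerBl.
  have : 0 <= (rho e x - rate e) ^+ M by rewrite exprn_ge0.
  move: X0; set a := _ ^+ M; set b := rho e x ^+ M; nra.
have h1 : rho e (X x 1 om) ^+ M.+1 <= D e m om ^+ M.+1.
  by rewrite lerXn2r ?nnegrE //; exact: (Dge0 Hprim).
have h2 : 0 <= \sum_(i < m) D e i om ^+ M.+1.
  by apply: sumr_ge0 => i _; apply: exprn_ge0; exact: (Dge0 Hprim).
rewrite big_ord_recr /=; lra.
Qed.

Lemma rho_step x e M gam : valid_state x ->
  (\int[P]_om (D e 0%N om ^+ M.+1)%:E = gam%:E)%E ->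
  (\int[P]_om (rho e (X x 1 om) ^+ M.+1)%:E +
     ((ev_enabled alpha x e)%:R * (rate e * rho e x ^+ M))%:E <=
   (rho e x ^+ M.+1 + (rate e ^+ M.+1 + gam * ((rate e + 1) / tau e)))%:E)%E.
Proof.
move=> Vx Eg.
have t0 : 0 <= 1 :> R by [].
set c := (_ * (rate e * _)).
have rg : 0 <= rate e by exact: rate_ge0.
have c0 : 0 <= c by rewrite !mulr_ge0 ?exprn_ge0 ?rho_ge0.
have m1 : measurable_fun setT (fun om => rho e (X x 1 om) ^+ M.+1).
  apply: (@measurable_X_fun (fun x => rho e x ^+ M.+1)).
  by apply: measurable_funX; exact: measurable_rho.
have mS : measurable_fun setT (fun om => \sum_(i < N x 1 e om) D e i om ^+ M.+1).
  apply: (@measurable_Nsum _ _ _ (N x 1 e) _ (fun i om => D e i om ^+ M.+1)); first exact: (dmeas_Nt Hprim).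
  by move=> i; apply: measurable_funX; exact: (measurable_D Hprim).
have S0 om : 0 <= \sum_(i < N x 1 e om) D e i om ^+ M.+1.
  by apply: sumr_ge0 => i _; apply: exprn_ge0; exact: (Dge0 Hprim).
have g0 : 0 <= gam.
  rewrite -lee_fin -Eg; apply: integral_ge0 => om _; rewrite lee_fin exprn_ge0 //; exact: (Dge0 Hprim).
have b0 : 0 <= rho e x ^+ M.+1 + rate e ^+ M.+1 by rewrite addr_ge0 // exprn_ge0 ?rho_ge0.
have p0 om : 0 <= rho e (X x 1 om) ^+ M.+1 by rewrite exprn_ge0 ?rho_ge0.
have step : (\int[P]_om (rho e (X x 1 om) ^+ M.+1 + c)%:E <=
  \int[P]_om (rho e x ^+ M.+1 + rate e ^+ M.+1 + \sum_(i < N x 1 e om) D e i om ^+ M.+1)%:E)%E.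
  apply: (ae_ge0_le_integral measurableT).
  - by move=> om _; rewrite lee_fin addr_ge0.
  - by apply/measurable_EFinP; apply: measurable_funD => //; exact: measurable_cst.
  - by move=> om _; rewrite lee_fin addr_ge0.
  - by apply/measurable_EFinP; apply: measurable_funD => //; exact: measurable_cst.
  - by apply: filterS (Xprime_ae Vx t0) => om G _; rewrite lee_fin rho_step_path.
move: step.
under eq_integral do rewrite EFinD.
rewrite ge0_integralD //; try by [move=> om _; rewrite lee_fin | apply/measurable_EFinP].
rewrite integral_prob_cst => /le_trans; apply.
under eq_integral do rewrite EFinD.
rewrite ge0_integralD //; try by [move=> om _; rewrite lee_fin | apply/measurable_EFinP].
rewrite integral_prob_cst.
apply: (@le_trans _ _ ((rho e x ^+ M.+1 + rate e ^+ M.+1)%:E + (gam * ((rate e + 1) / tau e))%:E)%E); last first.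
  by rewrite -EFinD addrA.
apply: leeD2l.
rewrite (D_moment_wald Vx t0 Eg) EFinM.
apply: lee_wpmul2l; first by rewrite lee_fin.
by have := N_mean_le e Vx t0; rewrite mulr1.
Qed.

Section UnderStationarity.
Variable pi : probability (stateM R J) R.
Hypothesis Hpi : is_stationary P alpha mu Te Ts Phi pi.

Lemma measurable_enabled e : measurable_fun setT (fun x : stateM R J => (ev_enabled alpha x e)%:R : R).
Proof.
rewrite (_ : (fun x => _) = \1_[set x : stateM R J | ev_enabled alpha x e]).
  by apply: measurable_indic; exact: (mset_enabled alpha e mstate_id).
apply/funext => x; rewrite indicE; case: (boolP (ev_enabled alpha x e)) => h; first by rewrite mem_set.
by rewrite memNset //=; exact/negP.
Qed.

(** Drift inequality for the power [M.+1] of the residual: a running clock turns it into a bound on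
    the power [M], with the loss of one moment usual for stationary residual lifetimes. *)
Lemma enabled_residual_moment e M gam : 
  (\int[P]_om (D e 0%N om ^+ M.+1)%:E = gam%:E)%E ->
  (\int[pi]_x ((ev_enabled alpha x e)%:R * (rate e * rho e x ^+ M))%:E <=
   (rate e ^+ M.+1 + gam * ((rate e + 1) / tau e))%:E)%E.
Proof.
move=> Eg.
have rg : 0 <= rate e by exact: rate_ge0.
have t0 : 0 <= 1 :> R by [].
have g0 : 0 <= gam.
  rewrite -lee_fin -Eg; apply: integral_ge0 => om _; rewrite lee_fin exprn_ge0 //; exact: (Dge0 Hprim).
have tg := tau_gt0 Hprim e.
rewrite -[leRHS](integral_prob_cst pi).
apply: (stationary_drift Hprim alpha0 mu_gt0 alpha_pos Hpi t0 (G := fun x => rho e x ^+ M.+1)).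
- by apply: measurable_funX; exact: measurable_rho.
- apply: measurable_funM; first exact: measurable_enabled.
  apply: measurable_funM; first exact: measurable_cst.
  by apply: measurable_funX; exact: measurable_rho.
- exact: measurable_cst.
- by move=> x; rewrite exprn_ge0 ?rho_ge0.
- by move=> x; rewrite !mulr_ge0 ?exprn_ge0 ?rho_ge0.
- by move=> x; rewrite addr_ge0 ?exprn_ge0 // mulr_ge0 // divr_ge0 ?addr_ge0 // ltW.
- by move=> x Vx; exact: rho_step.
Qed.

(** The cap [K] supplies the dominating constant when time tends to infinity. *)
Definition idle_residual j M (K : nat) (x : state R J) : R :=
  Num.min (rho (inr j) x ^+ M) K%:R * (Zof x j == 0%N)%:R.

Lemma idle_residual_ge0 j M K x : 0 <= idle_residual j M K x.
Proof. by rewrite mulr_ge0 // le_min exprn_ge0 ?rho_ge0 /=. Qed.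

Lemma measurable_empty j : measurable [set x : stateM R J | Zof x j = 0%N].
Proof. by have [mz _ _] := @mstate_id R J; exact: mz. Qed.

Lemma empty_indicE j : (fun x : stateM R J => (Zof x j == 0%N)%:R : R) =
  \1_[set x : stateM R J | Zof x j = 0%N].
Proof.
apply/funext => x; rewrite indicE; case: eqP => h; first by rewrite mem_set.
by rewrite memNset.
Qed.

Lemma measurable_idle_residual j M K :
  measurable_fun setT (fun x : stateM R J => idle_residual j M K x).
Proof.
apply: measurable_funM; last first.
  by rewrite empty_indicE; apply: measurable_indic; exact: measurable_empty.
apply: measurable_minr; last exact: measurable_cst.
by apply: measurable_funX; exact: measurable_rho.
Qed.

Local Notation C x om := (gC alpha mu (fun j n => Te j n om) (fun j n => Ts j n om)
                          (fun j n => Phi j n om) x).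

(* On [m.+1] completions the residual time at an empty station is the [m]-th service datum,
   independent of [idle_after]; without completions it has not changed. *)
Lemma idle_residual_step x t j M K gam : valid_state x -> 0 <= t ->
  (\int[P]_om (Ts j 0%N om ^+ M)%:E = gam%:E)%E ->
  (\int[P]_om (idle_residual j M K (X x t om))%:E <=
   (idle_residual j M K x)%:E * P [set om | N x t (inr j) om = 0%N] + gam%:E)%E.
Proof.
move=> Vx t0 Eg.
pose IA m := [set om | idle_after (C x om) t j m].
have mIA m : measurable (IA m) by apply: (mset_idle_after alpha mu (x0 := fun=> x)) => //; exact: mstate_x0.
(* The number of completions by time [t] is unique, so the probabilities of the events [IA m] add up
   to at most 1 and the series is bounded by [gam]. *)
have IAtriv : trivIset setT IA.
  apply/trivIsetP => m n _ _ mn; rewrite -subset0 => om [[k [hk ck _]] [l [hl cl _]]].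
  have kl := gidx_unique alpha0 mu_gt0 alpha_pos Vx (Te_ge0 Hprim om) (Ts_ge0 Hprim om) hk hl.
  by move: ck cl; rewrite kl => -> [] /eqP; rewrite (negbTE mn).
have g0 : 0 <= gam.
  rewrite -lee_fin -Eg; apply: integral_ge0 => om _; rewrite lee_fin exprn_ge0 //; exact: (Ts_ge0 Hprim).
pose Y om : \bar R := (\sum_(m <oo) (Ts j m om ^+ M * \1_(IA m) om)%:E)%E.
have T0 m om : 0 <= Ts j m om ^+ M * \1_(IA m) om :> R.
  by rewrite mulr_ge0 // exprn_ge0 //; exact: (Ts_ge0 Hprim).
have mT m : measurable_fun setT (fun om => (Ts j m om ^+ M * \1_(IA m) om)%:E : \bar R).
  apply/measurable_EFinP; apply: measurable_funM; last exact: measurable_indic.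
  by apply: measurable_funX; exact: mTs.
have Y0 om : (0 <= Y om)%E by apply: nneseries_ge0 => m _ _; rewrite lee_fin.
have mY : measurable_fun setT Y.
  by apply: ge0_emeasurable_sum => // m om _ _; rewrite lee_fin.
have EY : (\int[P]_om Y om <= gam%:E)%E.
  rewrite integral_nneseries //; last by move=> m om _; rewrite lee_fin.
  have E m : (\int[P]_om (Ts j m om ^+ M * \1_(IA m) om)%:E = gam%:E * P (IA m))%E.
    have H := @integral_indep R d Om P (Ts j m) (Ts j 0%N) (IA m) (fun y => `|y| ^+ M)
      (mIA m) (mTs j m) (mTs j 0%N).
    have mg : measurable_fun setT (fun y : R => `|y| ^+ M).
      by apply: measurable_funX; exact: normr_measurable.
    rewrite muleC -[in RHS]Eg (_ : (\int[P]_om (Ts j 0 om ^+ M)%:E = \int[P]_om (`|Ts j 0 om| ^+ M)%:E)%E); last first.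
      by apply: eq_integral => om _; rewrite ger0_norm //; exact: (Ts_ge0 Hprim).
    rewrite -H //; last 2 first.
    - by move=> B mB; apply: (indep_idle_after Hprim).
    - by move=> B mB; case: Hprim => _ _ [_ h2] _ _; exact: h2.
    rewrite [RHS]integral_mkcond; apply: eq_integral => om _.
    rewrite patchE indicE; case: ifP => _; rewrite ?mulr1 ?mulr0 ?ger0_norm //; exact: (Ts_ge0 Hprim).
  rewrite (eq_eseriesr (fun m _ => E m)) nneseriesZl; last by move=> m _; exact: measure_ge0.
  have -> : (\sum_(m <oo) P (IA m) = P (\bigcup_m IA m))%E.
    rewrite measure_bigcup //; apply: eq_eseriesl => m; exact/esym/in_setT.
  rewrite -[leRHS]mule1; apply: lee_wpmul2l; first by rewrite lee_fin.
  by apply: probability_le1; exact: bigcupT_measurable.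
have mN0 : measurable [set om | N x t (inr j) om = 0%N] by exact: (dmeas_Nt Hprim).
apply: (@le_trans _ _ (\int[P]_om ((idle_residual j M K x)%:E * (\1_[set om | N x t (inr j) om = 0%N] om)%:E + Y om))%E).
  apply: (ae_ge0_le_integral measurableT) => //.
  - by move=> om _; rewrite lee_fin idle_residual_ge0.
  - apply/measurable_EFinP; apply: (@measurable_X_fun (fun x => idle_residual j M K x)).
    exact: measurable_idle_residual.
  - by move=> om _; rewrite adde_ge0 // mule_ge0 ?lee_fin ?idle_residual_ge0.
  - apply: emeasurable_funD => //; apply: measurable_funeM; apply/measurable_EFinP.
    exact: measurable_indic.
  apply: filterS (Xprime_ae Vx t0) => om G _.
  have VX := X_valid Hprim alpha0 mu_gt0 alpha_pos Vx G.
  rewrite {1}/idle_residual; case: eqP => z0; last first.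
    by rewrite mulr0 adde_ge0 // mule_ge0 ?lee_fin ?idle_residual_ge0.
  rewrite mulr1.
  have := X_upper Hprim alpha0 mu_gt0 alpha_pos Vx G (inr j).
  rewrite -!rhoE //.
  case EN : (N x t (inr j) om) => [|m] hX.
    rewrite indicE mem_set //= mule1 -[leLHS]adde0; apply: leeD => //.
    have zs : Zof x j = 0%N by apply: X_idle_start z0 EN.
    rewrite lee_fin /idle_residual zs eqxx mulr1.
    rewrite le_min; apply/andP; split.
      by rewrite ge_min; apply/orP; left; rewrite lerXn2r ?nnegrE ?rho_ge0.
    by rewrite ge_min lexx orbT.
  have EN' : N x t (inr j) om <> 0%N by rewrite EN.
  rewrite indicE memNset // mule0 add0e.
  apply: (@le_trans _ _ (Ts j m om ^+ M)%:E).
    by rewrite lee_fin ge_min; apply/orP; left; rewrite lerXn2r ?nnegrE ?rho_ge0 //; exact: (Ts_ge0 Hprim).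
  apply: (@le_trans _ _ (\sum_(0 <= i < m.+1) (Ts j i om ^+ M * \1_(IA i) om)%:E)%E); last first.
    by apply: nneseries_lim_ge => i _ _; rewrite lee_fin.
  rewrite big_nat_recr //= indicE mem_set ?mulr1; last first.
    by apply: X_idle_after z0 EN.
  by rewrite leeDr // sume_ge0 // => i _; rewrite lee_fin.
rewrite ge0_integralD //; first last.
- apply: measurable_funeM; apply/measurable_EFinP; exact: measurable_indic.
- by move=> om _; rewrite mule_ge0 ?lee_fin ?idle_residual_ge0.
apply: leeD => //.
rewrite ge0_integralZl_EFin //; last 2 first.
- by apply/measurable_EFinP; exact: measurable_indic.
- exact: idle_residual_ge0.
by rewrite integral_indic // setIT.
Qed.

Lemma measurable_no_event_prob t e :
  measurable_fun setT (fun x : stateM R J => P [set om | N x t e om = 0%N]).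
Proof.
pose T := (stateM R J * Om)%type.
have mTe' j n : measurable_fun setT (fun z : T => Te j n z.2) by exact: (measurableT_comp (mTe j n) measurable_snd).
have mTs' j n : measurable_fun setT (fun z : T => Ts j n z.2) by exact: (measurableT_comp (mTs j n) measurable_snd).
have mPhi' j n : dmeas (fun z : T => Phi j n z.2).
  by move=> a; have := @measurable_snd _ _ (stateM R J) Om measurableT _ (mPhi j n a); rewrite setTI.
have mx : mstate (fun z : T => z.1) by exact: (mstate_comp mstate_id measurable_fst).
have mN : dmeas (fun z : T => N z.1 t e z.2).
  apply: (dmeas_case2 (g := fun n (z : T) => cnt (C z.1 z.2 n) e)).
    exact: (@dmeas_gpath_idx _ T R J alpha mu _ _ _ _ mTe' mTs' mPhi' mx t).
  by move=> n; have [_ _] := @maug_gC _ T R J alpha mu _ _ _ _ mTe' mTs' mPhi' mx n; apply.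
have := measurable_fun_xsection P (mN 0%N).
rewrite (_ : P \o _ = fun x : stateM R J => P [set om | N x t e om = 0%N]) //.
apply/funext => x /=; congr (P _); apply/seteqP; split => om /=; rewrite /xsection /=.
  by rewrite inE.
by move=> h; rewrite inE.
Qed.

(** These events decrease, up to null sets, to the event that station [j] never completes a service,
    which is null by [service_diverges_ae]. *)
Lemma no_event_prob_cvg x j : valid_state x ->
  (P [set om | N x n%:R (inr j) om = 0%N] @[n --> \oo] --> 0)%E.
Proof.
move=> Vx; pose B (n : nat) := ~` [set om | hit (C x om) n%:R (inr j) 0].
have mB n : measurable (B n).
  by apply: measurableC; apply: (mset_hit alpha mu (x0 := fun=> x)) => //; exact: mstate_x0.
have EB n : P [set om | N x n%:R (inr j) om = 0%N] = P (B n).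
  have t0 : 0 <= n%:R :> R by [].
  apply: (measure_eq_mod (G := nonexplosive_at Te Ts Phi alpha mu x n%:R)) => //.
  - exact: (dmeas_Nt Hprim).
  - by apply: measurable_Good; exact: Hprim.
  - exact: (Good_ae Hprim alpha0 mu_gt0 alpha_pos Vx t0).
  - have HN om := Nt_hit Hprim alpha0 mu_gt0 alpha_pos Vx (om := om) (t := n%:R) (inr j) 0.
    apply/seteqP; split => om [h G]; split => //.
      have {}h : N x n%:R (inr j) om = 0%N := h.
      by move=> /(HN om G); rewrite h.
    apply: contrapT => h2; apply: h; apply/(HN om G); rewrite lt0n; exact/eqP.
have mI : measurable (\bigcap_n B n) by apply: bigcap_measurableType.
have PI : P (\bigcap_n B n) = 0%E.
  have [A [mA PA sub]] := service_diverges_ae Hprim alpha0 mu_gt0 alpha_pos Vx j Hnet.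
  apply/eqP; rewrite -measure_le0 -PA; apply: le_measure; rewrite ?inE //.
  by move=> om h; apply: sub => /= -[n hn]; exact: (h n I).
rewrite (eq_cvg _ _ EB) -PI; apply: nonincreasing_cvg_mu => //.
  by rewrite (le_lt_trans (probability_le1 P (mB 0%N))) ?ltry.
move=> m n mn; apply/subsetPset; apply: subsetC => om /=.
by apply: hit_mono; rewrite ler_nat.
Qed.

(** The clock of an idle station does not run, so no drift is available. Stationarity at time [n]
    bounds the integral by [gam] plus the part carried by paths without completion at [j] up to [n];
    that part vanishes by dominated convergence. *)
Lemma idle_residual_moment_trunc j M K gam :
  (\int[P]_om (Ts j 0%N om ^+ M)%:E = gam%:E)%E ->
  (\int[pi]_x (idle_residual j M K x)%:E <= gam%:E)%E.
Proof.
move=> Eg.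
pose f (n : nat) (x : stateM R J) : \bar R :=
  ((idle_residual j M K x)%:E * P [set om | N x n%:R (inr j) om = 0%N])%E.
have Q0 x : (0 <= (idle_residual j M K x)%:E)%E by rewrite lee_fin idle_residual_ge0.
have mQ : measurable_fun setT (fun x : stateM R J => (idle_residual j M K x)%:E).
  by apply/measurable_EFinP; exact: measurable_idle_residual.
have g0 : 0 <= gam.
  rewrite -lee_fin -Eg; apply: integral_ge0 => om _; rewrite lee_fin exprn_ge0 //; exact: (Ts_ge0 Hprim).
have mf n : measurable_fun setT (f n).
  by apply: emeasurable_funM => //; exact: measurable_no_event_prob.
have f0 n x : (0 <= f n x)%E by rewrite mule_ge0.
have QK x : idle_residual j M K x <= K%:R.
  rewrite /idle_residual; apply: (@le_trans _ _ (K%:R * (Zof x j == 0%N)%:R)).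
    by rewrite ler_wpM2r // ge_min lexx orbT.
  by rewrite ler_piMr // lern1 leq_b1.
have le n : (\int[pi]_x (idle_residual j M K x)%:E <= \int[pi]_x f n x + gam%:E)%E.
  have t0 : 0 <= n%:R :> R by [].
  rewrite (stationary_integral Hprim alpha0 mu_gt0 alpha_pos Hpi t0 mQ Q0).
  rewrite -(integral_prob_cst pi gam) -ge0_integralD //; try by [move=> x _; rewrite lee_fin].
  apply: (ge0_integral_le_ae measurable_valid (piV Hpi)).
  - by move=> x; apply: integral_ge0 => om _.
  - by move=> x; rewrite adde_ge0 // lee_fin.
  - by apply: emeasurable_funD.
  - by move=> x Vx; exact: idle_residual_step.
have [_ _ cv] : [/\ pi.-integrable setT (cst 0%E : stateM R J -> \bar R),
   (\int[pi]_x `|f n x - cst 0%E x| @[n --> \oo] --> 0)%E &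
   (\int[pi]_x f n x @[n --> \oo] --> \int[pi]_x cst 0%E x)%E].
  apply: (@dominated_convergence _ _ _ pi setT measurableT f (cst 0%E) (cst K%:R%:E)) => //.
  - have [A [mA A0 sub]] := ae_valid Hpi.
    exists A; split => // x hx; apply: sub => /= Vx; apply: hx => _.
    rewrite /f (_ : cst 0%E x = ((idle_residual j M K x)%:E * 0)%E); last by rewrite mule0.
    by apply: cvgeZl => //; exact: no_event_prob_cvg.
  - apply/integrableP; split => //.
    rewrite (_ : (fun x => _) = fun=> K%:R%:E); first by rewrite integral_prob_cst ltry.
    by apply/funext => x; rewrite gee0_abs // lee_fin.
  - exists set0; split => // x hx; exfalso; apply: hx => n _ /=; rewrite gee0_abs // /f -[leRHS]mule1.
    apply: lee_pmul => //; first by rewrite lee_fin.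
    by apply: probability_le1; exact: (dmeas_Nt Hprim).
rewrite -[leRHS]add0e.
have cv2 : (\int[pi]_x f n x + gam%:E @[n --> \oo] --> 0 + gam%:E)%E.
  apply: cvgeD => //; last exact: cvg_cst.
  by move: cv; rewrite integral0.
rewrite -(cvg_lim _ cv2) //; apply: lime_ge; first exact: cvgP cv2.
by near=> n; exact: le.
Unshelve. all: by end_near. Qed.

Lemma idle_residual_moment j M gam :
  (\int[P]_om (Ts j 0%N om ^+ M)%:E = gam%:E)%E ->
  (\int[pi]_x (rho (inr j) x ^+ M * (Zof x j == 0%N)%:R)%:E <= gam%:E)%E.
Proof.
move=> Eg.
have lim (x : stateM R J) : (rho (inr j) x ^+ M * (Zof x j == 0%N)%:R)%:E = limn (fun K => (idle_residual j M K x)%:E).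
  apply/esym/cvg_lim => //; apply: cvg_EFin; first by near=> K.
  apply: (@cvg_near_cst).
  near=> K; rewrite /= /idle_residual (min_idPl _) //.
  near: K; exists (Num.truncn (rho (inr j) x ^+ M)).+1 => // K /= hK.
  by apply: (le_trans (ltW (truncnS_gt _))); rewrite ler_nat.
rewrite (eq_integral _ _ (fun x _ => lim x)) monotone_convergence //; last 3 first.
- by move=> K; apply/measurable_EFinP; exact: measurable_idle_residual.
- by move=> K x _; rewrite lee_fin idle_residual_ge0.
- move=> x _ K L KL; rewrite lee_fin ler_wpM2r // le_min !ge_min lexx /= ler_nat KL orbT //.
apply: lime_le; last by near=> K; exact: idle_residual_moment_trunc.
apply: ereal_nondecreasing_is_cvgn => K L KL; apply: ge0_le_integral => //.
- by move=> x _; rewrite lee_fin idle_residual_ge0.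
- by apply/measurable_EFinP; exact: measurable_idle_residual.
- by apply/measurable_EFinP; exact: measurable_idle_residual.
- by move=> x _; rewrite lee_fin ler_wpM2r // le_min !ge_min lexx /= ler_nat KL orbT.
Unshelve. all: by end_near. Qed.

End UnderStationarity.
End Residuals.

(** * Elementary inequalities for powers *)

Section RealInequalities.
Context {R : realType}.
Implicit Types (v dl : R) (m : nat).

(** The recursion is the cost of multiplying the previous inequality by [v + dl]: [m'.+2] from the
    first-order term times [dl], and 4 for the four products of the remainder with [v] and [dl]. *)
Fixpoint taylor_cst (m : nat) : R := if m is m'.+1 then m'.+2%:R + 4 * taylor_cst m' else 2.

Lemma taylor_cst_ge m : m.+2%:R <= taylor_cst m.
Proof.
elim: m => [//|m IH] /=; rewrite -[m.+3]addn1 natrD lerD2l.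
have : (2 : R) <= m.+2%:R by rewrite ler_nat.
lra.
Qed.

Lemma taylor_pos m v dl : 0 <= v -> 0 <= v + dl ->
  (v + dl) ^+ m.+2 <= v ^+ m.+2 + m.+2%:R * v ^+ m.+1 * dl +
     taylor_cst m * (v ^+ m * dl ^+ 2 + `|dl| ^+ m.+2).
Proof.
move=> v0 vd.
have nd := normr_ge0 dl.
have sq : `|dl| ^+ 2 = dl ^+ 2 by rewrite real_normK ?num_real.
have dn : dl <= `|dl| by exact: ler_norm.
elim: m => [|m IH].
  rewrite expr0 mul1r sq expr1 /= sqrrD -mulr_natl; have := sqr_ge0 dl; lra.
rewrite exprS; apply: (le_trans (ler_wpM2l vd IH)) => /=.
set K := taylor_cst m.
have K0 : 0 <= K by apply: le_trans (taylor_cst_ge m); rewrite ler0n.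
have [a0 b0] : 0 <= v ^+ m /\ 0 <= `|dl| ^+ m by rewrite !exprn_ge0.
have [f1 f2] : v * `|dl| ^+ m <= v * v ^+ m + `|dl| * `|dl| ^+ m /\
    v ^+ m * `|dl| <= v * v ^+ m + `|dl| * `|dl| ^+ m.
  (* Mixed products are dominated by the two pure ones, according to which of [v] and the absolute
     value of [dl] is larger. *)
  have [le|/ltW le] := leP `|dl| v.
    have : `|dl| ^+ m <= v ^+ m by rewrite lerXn2r ?nnegrE.
    move=> h; split; nra.
  have : v ^+ m <= `|dl| ^+ m by rewrite lerXn2r ?nnegrE.
  move=> h; split; nra.
rewrite !(exprS v) !(exprS `|dl|) -sq.
rewrite (_ : m.+3%:R = m.+2%:R + 1 :> R); last by rewrite -[m.+3]addn1 natrD.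
set a := v ^+ m in a0 f1 f2 *; set b := `|dl| ^+ m in b0 f1 f2 *.
set n := `|dl| in nd sq dn f1 f2 *; set c := m.+2%:R.
have c0 : 0 <= c by rewrite ler0n.
have q0 : 0 <= n ^+ 2 by exact: sqr_ge0.
set q := n ^+ 2 in q0 *.
have qE : dl * dl = q by rewrite -expr2 -sq.
have g1 : v * b * q <= (v * a + n * b) * q by apply: ler_wpM2r.
have g2 : a * dl * q <= (v * a + n * b) * q.
  by apply: ler_wpM2r => //; apply: le_trans f2; apply: ler_wpM2l.
have g3 : dl * b * q <= n * b * q by apply: ler_wpM2r => //; apply: ler_wpM2r.
have w1 : 0 <= v * a * q by rewrite !mulr_ge0.
have w2 : 0 <= n * b * q by rewrite !mulr_ge0.
have g : v * a * q + v * b * q + a * dl * q + dl * b * q <= 4 * (v * a * q + n * b * q) by lra.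
have gK := ler_wpM2l K0 g.
have w1c := mulr_ge0 c0 w1; have w2c := mulr_ge0 c0 w2.
have -> : (v + dl) * (v * (v * a) + c * (v * a) * dl + K * (a * q + n * (n * b))) =
  v * (v * (v * a)) + (c + 1) * (v * (v * a)) * dl + c * (v * a * (dl * dl)) +
  K * (v * a * q + v * b * (n * n) + a * dl * q + dl * b * (n * n)) by ring.
rewrite qE -[n * n]expr2 -/q.
have -> : (c + 4 * K) * (v * a * q + n * (n * (n * b))) =
  c * (v * a * q + n * b * (n * n)) + 4 * K * (v * a * q + n * b * (n * n)) by ring.
rewrite -[n * n]expr2 -/q.
move: gK w1c w2c w1 w2; rewrite !mulrDr !mulrDl !mul1r !mulrA; lra.
Qed.

(** Besides [taylor_pos] there are two cases. If [v >= 0 > v + dl], the left side is 0 and the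
    negative first-order term is absorbed by the second-order one, since [v < - dl] and
    [taylor_cst m >= m.+2]. If [v < 0], the positive part of [v + dl] is at most the absolute value
    of [dl]. *)
Lemma taylor_max m v dl :
  Num.max (v + dl) 0 ^+ m.+2 <= Num.max v 0 ^+ m.+2 + m.+2%:R * Num.max v 0 ^+ m.+1 * dl +
     taylor_cst m * (Num.max v 0 ^+ m * dl ^+ 2 + `|dl| ^+ m.+2).
Proof.
have K2 := taylor_cst_ge m.
have c0 : 0 <= m.+2%:R :> R by rewrite ler0n.
have K0 : 0 <= taylor_cst m := le_trans c0 K2.
have nd := normr_ge0 dl.
have c1 : 1 <= taylor_cst m by apply: le_trans K2; rewrite ler1n.
have [v0|/ltW v0] := leP 0 v.
  have [vd|/ltW vd] := leP 0 (v + dl); first exact: taylor_pos.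
  rewrite expr0n /=.
  have d0 : dl <= 0 by lra.
  have nE : `|dl| = - dl by rewrite ler0_norm.
  have a0 : 0 <= v ^+ m by rewrite exprn_ge0.
  have n0 : 0 <= `|dl| ^+ m.+2 by rewrite exprn_ge0.
  have p0 : 0 <= v ^+ m.+2 by rewrite exprn_ge0.
  have e0 : 0 <= v ^+ m * dl ^+ 2 by rewrite mulr_ge0 // sqr_ge0.
  have h : v ^+ m.+1 * - dl <= v ^+ m * dl ^+ 2.
    rewrite exprSr -mulrA; apply: ler_wpM2l => //; rewrite expr2; nra.
  have h2 : m.+2%:R * (v ^+ m.+1 * - dl) <= taylor_cst m * (v ^+ m * dl ^+ 2).
    apply: (@le_trans _ _ (m.+2%:R * (v ^+ m * dl ^+ 2))); first exact: ler_wpM2l.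
    exact: ler_wpM2r.
  have h3 : 0 <= taylor_cst m * `|dl| ^+ m.+2 by rewrite mulr_ge0.
  by move: h2 h3; rewrite mulrDr !mulrN !mulrA; lra.
rewrite !expr0n /= mulr0 mul0r addr0 add0r.
apply: (@le_trans _ _ (`|dl| ^+ m.+2)).
  rewrite lerXn2r ?nnegrE // ?le_max ?lexx ?orbT // ge_max nd andbT.
  by have := ler_norm dl; lra.
have n0 : 0 <= `|dl| ^+ m.+2 by rewrite exprn_ge0.
rewrite mulrDr; apply: (@le_trans _ _ (taylor_cst m * `|dl| ^+ m.+2)).
  by rewrite ler_peMl.
by rewrite lerDr; apply: mulr_ge0 => //; apply: mulr_ge0; [exact: ler0n|exact: sqr_ge0].
Qed.

Lemma sum_power_le (I : finType) (p : nat) (a : I -> R) : (forall i, 0 <= a i) ->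
  (\sum_i a i) ^+ p.+1 <= #|I|%:R ^+ p.+1 * \sum_i a i ^+ p.+1.
Proof.
move=> a0; case: (pickP (fun _ : I => true)) => [i0 _|I0]; last first.
  by rewrite !big1 ?expr0n ?mulr0 // => i; have := I0 i.
case: (@Order.TotalTheory.arg_maxP _ _ _ i0 xpredT a isT) => i _ ai.
have le : \sum_j a j <= #|I|%:R * a i.
  by rewrite mulr_natl -sumr_const; apply: ler_sum => j _; exact: ai.
apply: (@le_trans _ _ ((#|I|%:R * a i) ^+ p.+1)).
  by rewrite lerXn2r ?nnegrE ?sumr_ge0 // mulr_ge0.
rewrite exprMn ler_wpM2l ?exprn_ge0 // (bigD1 i) //= lerDl sumr_ge0 // => j _.
by rewrite exprn_ge0.
Qed.

(** Either [A <= c r v], and the first term suffices, or [v < A / (c r)]. The factor [r^-m] produced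
    here is the leading term in the final bound. *)
Lemma young_power m (A c v r : R) : 0 <= A -> 0 < c -> 0 < r -> 0 <= v ->
  A * v ^+ m <= c * r * v ^+ m.+1 + A * (A / c) ^+ m * r^-1 ^+ m.
Proof.
move=> A0 c0 r0 v0.
have [le|lt] := leP A (c * r * v).
  rewrite -[leLHS]addr0 lerD //; last by rewrite !mulr_ge0 ?exprn_ge0 ?divr_ge0 ?invr_ge0 // ltW.
  by rewrite exprS mulrA ler_wpM2r ?exprn_ge0.
rewrite -[leLHS]add0r lerD //; first by rewrite !mulr_ge0 ?exprn_ge0 // ltW.
rewrite -mulrA ler_wpM2l // -exprMn lerXn2r ?nnegrE //; last first.
  by rewrite -mulrA -invfM ler_pdivlMr ?mulr_gt0 // mulrC ltW.
by rewrite !mulr_ge0 ?invr_ge0 // ltW.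
Qed.

End RealInequalities.

(** * Expectations of integrable real variables *)

Section Means.
Context {R : realType} {d : measure_display} {Om : measurableType d}.
Variable P : probability Om R.

Definition has_mean (f : Om -> R) (m : R) : Prop :=
  P.-integrable setT (EFin \o f) /\ (\int[P]_om (f om)%:E = m%:E)%E.

Lemma has_mean_cst c : has_mean (fun=> c) c.
Proof.
split; last exact: integral_prob_cst.
apply/integrableP; split; first exact: measurable_cst.
by under eq_integral do rewrite /=; rewrite integral_prob_cst ltry.
Qed.

Lemma has_meanD f g a b : has_mean f a -> has_mean g b ->
  has_mean (fun om => f om + g om) (a + b).
Proof.
move=> [i1 e1] [i2 e2]; split; first exact: (integrableD measurableT i1 i2).
under eq_integral do rewrite EFinD.
by rewrite integralD // e1 e2.
Qed.

Lemma has_meanZ f a c : has_mean f a -> has_mean (fun om => c * f om) (c * a).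
Proof.
move=> [i1 e1]; split; first exact: (integrableZl measurableT c i1).
under eq_integral do rewrite EFinM.
by rewrite integralZl // e1.
Qed.

Lemma has_meanB f g a b : has_mean f a -> has_mean g b ->
  has_mean (fun om => f om - g om) (a - b).
Proof.
move=> h1 h2; rewrite (_ : (fun om => _) = (fun om => f om + (-1) * g om)).
  by rewrite -(mulN1r b); apply: has_meanD => //; exact: has_meanZ.
by apply/funext => om; rewrite mulN1r.
Qed.

Lemma has_mean_sum (I : finType) (f : I -> Om -> R) (a : I -> R) :
  (forall i, has_mean (f i) (a i)) -> has_mean (fun om => \sum_i f i om) (\sum_i a i).
Proof.
move=> H; elim: (index_enum I) => [|i s IH].
  rewrite big_nil (_ : (fun om => _) = fun=> 0); first exact: has_mean_cst.
  by apply/funext => om; rewrite big_nil.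
rewrite big_cons (_ : (fun om => _) = fun om => f i om + \sum_(j <- s) f j om).
  exact: has_meanD.
by apply/funext => om; rewrite big_cons.
Qed.

Lemma has_mean_ge0 (f : Om -> R) (B : R) : measurable_fun setT f -> (forall om, 0 <= f om) ->
  (\int[P]_om (f om)%:E <= B%:E)%E -> exists2 m, has_mean f m & 0 <= m <= B.
Proof.
move=> mf f0 fB.
have i0 : (0 <= \int[P]_om (f om)%:E)%E by apply: integral_ge0 => om _; rewrite lee_fin.
have fin : (\int[P]_om (f om)%:E \is a fin_num)%E.
  by rewrite ge0_fin_numE // (le_lt_trans fB) ?ltry.
exists (fine (\int[P]_om (f om)%:E)%E); last first.
  by rewrite fine_ge0 //= -lee_fin fineK.
split; last by rewrite fineK.
apply/integrableP; split; first exact/measurable_EFinP.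
rewrite (eq_integral (fun om => (f om)%:E)) => [|om _]; last by rewrite gee0_abs // lee_fin.
by rewrite (le_lt_trans fB) ?ltry.
Qed.

Lemma has_mean_le_ae f g a b : has_mean f a -> has_mean g b ->
  {ae P, forall om, f om <= g om} -> a <= b.
Proof.
move=> h1 h2 le.
have [i e] := has_meanB h2 h1.
rewrite -subr_ge0 -lee_fin -e.
have -> : (\int[P]_om (g om - f om)%:E = \int[P]_om (Num.max (g om - f om) 0)%:E)%E.
  have mi := measurable_int P i.
  apply: ae_eq_integral => //.
    by apply/measurable_EFinP; apply: measurable_maxr; [exact/measurable_EFinP|exact: measurable_cst].
  have [A [mA A0 sub]] := le; exists A; split => // om h; apply: sub => /= h2'; apply: h => _ /=.
  by congr EFin; apply/esym/max_idPl; rewrite subr_ge0.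
by apply: integral_ge0 => om _; rewrite lee_fin le_max lexx orbT.
Qed.

End Means.

(** * Drift of the weighted workload *)

Section Weights.
Context {R : realType} {J : nat}.
Variables (alpha lambda : 'I_J -> R) (Pm w : 'M[R]_J) (k : 'I_J).
Hypothesis Hnet : network_data alpha Pm lambda.
Hypothesis Hw : w_matrix Pm w.

(** [w j k] reads as the probability that a job leaving [j] reaches [k] with only stations below [k]
    in between. [wup j] is the corresponding value of a job that is present at [j]; jobs above [k]
    have value 0. *)
Definition wup (j : 'I_J) : R := if j == k then 1 else if (j < k)%N then w j k else 0.
Definition wdn (j : 'I_J) : R := if (k < j)%N then w j k else 0.
Definition wk : R := 1 - w k k.

Lemma w01 i j : 0 <= w i j <= 1. Proof. by have [] := Hw i j. Qed.

Lemma wup01 j : 0 <= wup j <= 1.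
Proof. by rewrite /wup; case: eqP => _; [rewrite ler01 lexx|case: ifP => _; [exact: w01|rewrite ler01 lexx]]. Qed.

Lemma wdn01 j : 0 <= wdn j <= 1.
Proof. by rewrite /wdn; case: ifP => _; [exact: w01|rewrite ler01 lexx]. Qed.

Lemma wk01 : 0 <= wk <= 1.
Proof. by rewrite /wk; have /andP[h1 h2] := w01 k k; apply/andP; split; lra. Qed.

Lemma routed_weight j : \sum_l Pm j l * wup l = w j k.
Proof.
have [_ ->] := Hw j k.
rewrite (bigD1 k) //= {1}/wup eqxx mulr1; congr (_ + _).
rewrite [RHS]big_mkcond [LHS]big_mkcond /=; apply: eq_bigr => l _.
have [->|ne] := eqVneq l k; first by rewrite ltnn.
by rewrite /wup (negbTE ne); case: ifP => _ //; rewrite mulr0.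
Qed.

(** By [routed_weight], [w j k] is the mean value of a job after its service at [j]. A service thus
    changes the value by 0 below [k], by [- wk] at [k] and by [w j k] above [k]. *)
Lemma weight_balance j : wup j - (if j == k then wk else 0) + wdn j = w j k.
Proof.
rewrite /wup /wdn /wk; have [->|ne] := eqVneq j k; first by rewrite ltnn; lra.
have [jk|kj] := ltnP j k; first by rewrite ltnNge (ltnW jk) /=; lra.
have kj' : (k < j)%N by rewrite ltn_neqAle kj andbT eq_sym.
by rewrite kj'; lra.
Qed.

Lemma weighted_arrivals : \sum_j wup j * alpha j = wk * lambda k - \sum_j wdn j * lambda j.
Proof.
have [_ _ _ _ lam] := Hnet.
have E j : alpha j = lambda j - \sum_l lambda l * Pm l j.
  by have [E _] := lam j; rewrite [in RHS]E; lra.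
under eq_bigr do rewrite E mulrBr.
rewrite sumrB.
have -> : \sum_j wup j * \sum_l lambda l * Pm l j = \sum_l lambda l * w l k.
  under eq_bigr do rewrite mulr_sumr.
  rewrite exchange_big /=; apply: eq_bigr => l _.
  rewrite -routed_weight mulr_sumr; apply: eq_bigr => j _; ring.
rewrite -sumrB.
have -> : wk * lambda k = \sum_j (if j == k then wk else 0) * lambda j.
  by rewrite (bigD1 k) //= eqxx big1 ?addr0 // => i /negbTE ->; rewrite mul0r.
rewrite -sumrB; apply: eq_bigr => j _; rewrite -weight_balance; case: eqP => _; ring.
Qed.

(** If [wk = 0], then [weighted_arrivals] equates a nonnegative sum with minus another one, so all
    weights [wdn] vanish. The column [wup] is then fixed by [Pm], which invertibility of [I - P]
    excludes because [wup k = 1]. *)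
Lemma wk_gt0 : 0 < wk.
Proof.
have [P0 P1 inv a0 lam] := Hnet.
have /andP[wk0 _] := wk01.
rewrite lt_neqAle wk0 andbT; apply/eqP => wkE.
have l0 j : 0 < lambda j by case: (lam j).
have s1 : 0 <= \sum_j wup j * alpha j.
  by apply: sumr_ge0 => j _; rewrite mulr_ge0 //; have /andP[] := wup01 j.
have s2 : 0 <= \sum_j wdn j * lambda j.
  by apply: sumr_ge0 => j _; apply: mulr_ge0; [have /andP[] := wdn01 j|exact: ltW].
have := weighted_arrivals; rewrite -wkE mul0r sub0r => E.
have dn0 j : wdn j = 0.
  have /eqP : \sum_j wdn j * lambda j = 0 by lra.
  rewrite psumr_eq0 => [/allP/(_ j)|i _]; last first.
    by apply: mulr_ge0; [have /andP[] := wdn01 i|exact: ltW].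
  by rewrite mem_index_enum => /(_ isT); rewrite mulf_eq0 (gt_eqF (l0 j)) orbF => /eqP.
have col j : wup j = \sum_l Pm j l * wup l.
  rewrite routed_weight -weight_balance dn0 -wkE if_same subr0 addr0 //.
pose c : 'cV[R]_J := \col_j wup j.
have c0 : (1%:M - Pm) *m c = 0.
  rewrite mulmxBl mul1mx; apply/colP => j; rewrite !mxE [X in X - _]col.
  by apply/eqP; rewrite subr_eq0; apply/eqP; apply: eq_bigr => l _; rewrite mxE.
have cz : c = 0.
  by move: c0 => /(congr1 (mulmx (invmx (1%:M - Pm)))); rewrite mulmx0 mulKmx.
have : c k 0 = 0 by rewrite cz mxE.
by rewrite mxE /wup eqxx => /eqP; rewrite oner_eq0.
Qed.

(** For [j > k], the condition on [r] says [w_jk r^(j-k) <= wk / J]. Each of the [J - 1] stations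
    other than [k] therefore uses at most the share [wk / J] of the drift of [k], and one share
    remains. *)
Lemma heavy_traffic_drift (r : R) : (0 < r < 1) -> r < r0 w ->
  \sum_j wdn j * r ^+ j.+1 - wk * r ^+ k.+1 <= - (wk / J%:R * r ^+ k.+1).
Proof.
move=> /andP[r_gt0 r1] rr0.
have J0 : 0 < J%:R :> R by rewrite ltr0n (leq_ltn_trans (leq0n k)).
have wk0 := wk_gt0.
have rk : 0 < r ^+ k.+1 by rewrite exprn_gt0.
have H j : wdn j * r ^+ j.+1 <= (if j == k then 0 else wk / J%:R * r ^+ k.+1).
  rewrite /wdn; case: ltnP => [kj|jk]; last first.
    by rewrite mul0r; case: eqP => // _; rewrite mulr_ge0 ?divr_ge0 // ltW.
  rewrite (_ : (j == k) = false); last by apply/eqP => jk; move: kj; rewrite jk ltnn.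
  have [w0|wn0] := eqVneq (w j k) 0; first by rewrite w0 mul0r mulr_ge0 ?divr_ge0 // ltW.
  have wp : 0 < w j k by rewrite lt_neqAle eq_sym wn0; have /andP[] := w01 j k.
  have b0 : 0 < wk / (J%:R * w j k) by rewrite divr_gt0 // mulr_gt0.
  have le : r < powR (wk / (J%:R * w j k)) ((j - k)%:R)^-1.
    apply: (lt_le_trans rr0); rewrite /r0.
    by apply: (bigmin_inf j) => //; apply: (bigmin_inf k); rewrite ?kj.
  have n0 : (0 < j - k)%N by rewrite subn_gt0.
  have rn : r ^+ (j - k) <= wk / (J%:R * w j k).
    apply: (@le_trans _ _ (powR (wk / (J%:R * w j k)) ((j - k)%:R)^-1 ^+ (j - k))).
      by rewrite lerXn2r ?nnegrE ?powR_ge0 // ltW.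
    rewrite -powR_mulrn ?powR_ge0 // -powRrM mulVf ?pnatr_eq0 -?lt0n // powRr1; [exact: lexx|exact: ltW].
  have -> : r ^+ j.+1 = r ^+ (j - k) * r ^+ k.+1.
    by rewrite -exprD addnS subnK // ltnW.
  rewrite mulrA; apply: ler_wpM2r; first exact: ltW.
  move: rn; rewrite !ler_pdivlMr ?mulr_gt0 //.
  by rewrite [J%:R * _]mulrC mulrA (mulrC (w j k)).
apply: (@le_trans _ _ (\sum_j (if j == k then 0 else wk / J%:R * r ^+ k.+1) - wk * r ^+ k.+1)).
  by rewrite lerD2r; apply: ler_sum => j _; exact: H.
have E : \sum_(j < J) (if j == k then 0 else wk / J%:R * r ^+ k.+1) + wk / J%:R * r ^+ k.+1 = wk * r ^+ k.+1.
  rewrite (bigD1 k) //= eqxx add0r.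
  rewrite (eq_bigr (fun=> wk / J%:R * r ^+ k.+1)) => [|i /negbTE -> //].
  rewrite sumr_const (@cardC1 'I_J k) card_ord -mulrSr prednK ?(leq_ltn_trans (leq0n k)) // -[LHS]mulr_natl.
  by rewrite mulrA [J%:R * _]mulrC divfK // gt_eqF.
by rewrite -E; lra.
Qed.

End Weights.

Definition rate_bound {R : realType} {J : nat} (alpha lambda : 'I_J -> R) (e : event J) : R :=
  match e with inl j => alpha j | inr j => lambda j + 1 end.

(** The streams that enter [drift_fun]: external arrivals above [k] have weight 0. For [k < M] these
    are exactly streams with an assumed moment of order [M + 1]. *)
Definition active {J : nat} (k : 'I_J) (e : event J) : bool :=
  match e with inl j => (j <= k)%N | inr _ => true end.

Definition drift_fun {R : realType} {J : nat} (alpha mu : 'I_J -> R) (w : 'M[R]_J)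
  (k : 'I_J) (x : state R J) : R :=
  \sum_j wup w k j * (Zof x j)%:R - \sum_j wup w k j * (alpha j * Reof x j)
  + wk w k * (mu k * Rsof x k) - \sum_j wdn w k j * (mu j * Rsof x j).

Section Drift.
Context {R : realType} {J : nat} {d : measure_display} {Om : measurableType d}.
Variables (P : probability Om R) (Pm w : 'M[R]_J).
Variables (Te Ts : 'I_J -> nat -> Om -> R) (Phi : 'I_J -> nat -> Om -> option 'I_J).
Hypothesis Hprim : gjn_primitives P Pm Te Ts Phi.
Variables (alpha mu lambda : 'I_J -> R).
Hypothesis Hnet : network_data alpha Pm lambda.
Hypothesis Hw : w_matrix Pm w.
Hypothesis mu_gt0 : forall j, 0 < mu j.
Hypothesis mu_le : forall j, mu j <= lambda j + 1.
Hypothesis alpha_pos : exists i, 0 < alpha i.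
Variables (k : 'I_J) (m : nat) (gam : event J -> R).
Hypothesis Hgam : forall e, active k e ->
  (\int[P]_om (dat Te Ts e 0%N om ^+ m.+2)%:E = (gam e)%:E)%E.
Variable x : state R J.
Hypothesis Vx : valid_state x.

Let alpha0 := alpha_ge0 Hnet.
Let t1 : 0 <= 1 :> R := ler01.

Local Notation X om := (gpath alpha mu (fun j n => Te j n om) (fun j n => Ts j n om)
                          (fun j n => Phi j n om) x 1).
Local Notation rate := (rate alpha mu).
Local Notation D := (dat Te Ts).
Local Notation N := (nb_events Te Ts Phi alpha mu x 1).
Local Notation tau e := (tau P Te Ts e).
Local Notation Good := (nonexplosive_at Te Ts Phi alpha mu x 1).
Local Notation u := (wup w k).
Local Notation v := (wdn w k).
Local Notation y := (wk w k).
Local Notation V := (drift_fun alpha mu w k).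

Definition cN e om : R := (N e om)%:R.
Definition cS e om : R := \sum_(i < N e om) D e i om.
Definition cF l j om : R := \sum_(i < N (inr l) om) (Phi l i om == Some j)%:R.
Definition emptied om : Prop := visits_empty Te Ts Phi alpha mu x 1 k om.
Definition cH om : R := \1_[set om | emptied om] om.

Let mN e : dmeas (N e). Proof. exact: (dmeas_Nt Hprim). Qed.

Lemma measurable_cN e : measurable_fun setT (cN e).
Proof. by apply: (mfun_case (g := fun n _ => n%:R : R) (mN e)) => n; exact: measurable_cst. Qed.

Lemma measurable_cS e : measurable_fun setT (cS e).
Proof.
by apply: (@measurable_Nsum _ _ _ (N e) (mN e) (D e)) => i; exact: (measurable_D Hprim).
Qed.

Lemma measurable_cF l j : measurable_fun setT (cF l j).
Proof.
apply: (@measurable_Nsum _ _ _ (N (inr l)) (mN (inr l)) (fun i om => (Phi l i om == Some j)%:R)) => i.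
rewrite (_ : (fun om => _) = \1_[set om | Phi l i om = Some j]).
  by apply: measurable_indic; exact: (dmeas_Phi Hprim).
apply/funext => om; rewrite indicE; case: eqP => h; first by rewrite mem_set.
by rewrite memNset.
Qed.

Lemma measurable_emptied : measurable [set om | emptied om].
Proof.
apply: (mset_empties alpha mu (x0 := fun=> x)); [exact: measurable_Te Hprim|exact: measurable_Ts Hprim|exact: dmeas_Phi Hprim|exact: mstate_x0].
Qed.

Lemma cN_ge0 e om : 0 <= cN e om. Proof. exact: ler0n. Qed.
Lemma cS_ge0 e om : 0 <= cS e om.
Proof. by apply: sumr_ge0 => i _; exact: (Dge0 Hprim). Qed.
Lemma cF_ge0 l j om : 0 <= cF l j om.
Proof. by apply: sumr_ge0 => i _. Qed.
Lemma cF_le l j om : cF l j om <= cN (inr l) om.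
Proof.
rewrite /cF /cN -[N (inr l) om in leRHS]card_ord -sumr_const.
by apply: ler_sum => i _; rewrite lern1 leq_b1.
Qed.
Lemma cH01 om : 0 <= cH om <= 1.
Proof. by rewrite /cH indicE lern1 leq_b1 ler0n. Qed.

(** All data have mean 1, so by Wald a count and the sum of its data have the same mean. The unknown
    means [n e] cancel in the drift. *)
Lemma count_means : exists n : event J -> R,
  [/\ forall e, has_mean P (cN e) (n e), forall e, has_mean P (cS e) (n e) &
      forall l j, has_mean P (cF l j) (Pm l j * n (inr l))].
Proof.
have H e : exists n, has_mean P (cN e) n.
  have [n h _] := has_mean_ge0 (measurable_cN e) (cN_ge0 e) (N_mean_le Hprim Hnet mu_gt0 alpha_pos e Vx t1).
  by exists n.
have [n hn] := boolp.choice H; exists n; split => // [e|l j].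
  have [hi he] := hn e.
  have E : (\int[P]_om (cS e om)%:E = (n e)%:E)%E.
    have := D_moment_wald Hprim Hnet mu_gt0 alpha_pos Vx t1 (e := e) (p := 1) (gam := 1).
    under eq_integral do rewrite expr1.
    move=> /(_ (D_mean Hprim e)); rewrite mul1e he => <-.
    by apply: eq_integral => om _; congr EFin; apply: eq_bigr => i _; rewrite expr1.
  have [q hq _] : exists2 q, has_mean P (cS e) q & 0 <= q <= n e.
    by apply: has_mean_ge0; [exact: measurable_cS|exact: cS_ge0|rewrite E].
  by have [hqi _] := hq; split.
have [hi he] := hn (inr l).
have E : (\int[P]_om (cF l j om)%:E = (Pm l j * n (inr l))%:E)%E.
  by rewrite (Nt_wald_ph Hprim alpha0 mu_gt0 alpha_pos Vx t1 l j) he EFinM.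
have [q hq _] : exists2 q, has_mean P (cF l j) q & 0 <= q <= Pm l j * n (inr l).
  by apply: has_mean_ge0; [exact: measurable_cF|exact: cF_ge0|rewrite E].
by have [hqi _] := hq; split.
Qed.

(** A majorant of the increment of [drift_fun] over one unit of time that involves only counts, sums
    of data and the indicator [cH], so that its mean can be computed. The summand [mu k * cH] makes
    up for the time during which the clock of [k] may stand still. *)
Definition incr om : R :=
  \sum_j u j * (cN (inl j) om - cN (inr j) om + \sum_l cF l j om + alpha j - cS (inl j) om)
  + y * (cS (inr k) om - mu k + mu k * cH om)
  + \sum_j v j * (mu j - cS (inr j) om).

Lemma incr_path om : Good om -> V (X om) <= V x + incr om.
Proof.
move=> G.
have Z j : (Zof (X om) j)%:R = (Zof x j)%:R + cN (inl j) om + \sum_l cF l j om - cN (inr j) om.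
  have := X_balance Te Ts Phi mu alpha_pos x 1 om j.
  move/(congr1 (fun n => n%:R : R)); rewrite !natrD natr_sum /cN => E.
  have -> : \sum_l cF l j om = \sum_l (\sum_(i < N (inr l) om) (Phi l i om == Some j))%:R.
    by apply: eq_bigr => l _; rewrite natr_sum.
  lra.
have L e := X_lower Hprim alpha0 mu_gt0 alpha_pos Vx G e.
have s1 : \sum_j u j * (Zof (X om) j)%:R = \sum_j u j * (Zof x j)%:R +
    \sum_j u j * (cN (inl j) om - cN (inr j) om + \sum_l cF l j om).
  rewrite -big_split /=; apply: eq_bigr => j _; rewrite Z; ring.
have s2 : - \sum_j u j * (alpha j * Reof (X om) j) <= - \sum_j u j * (alpha j * Reof x j) +
    \sum_j u j * (alpha j - cS (inl j) om).
  rewrite -!sumrN -big_split /=; apply: ler_sum => j _; have /andP[u0 _] := wup01 k Hw j.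
  have := L (inl j); rewrite /= mulr1 -/(cS (inl j) om) => h.
  have := ler_wpM2l u0 h; lra.
have s3 : y * (mu k * Rsof (X om) k) <= y * (mu k * Rsof x k) + y * (cS (inr k) om - mu k + mu k * cH om).
  have /andP[y0 _] := wk01 k Hw.
  rewrite -mulrDr; apply: ler_wpM2l => //.
  rewrite /cH indicE; have [h|h] := pselect (emptied om).
    rewrite mem_set // mulr1; have := X_upper_sum Hprim alpha0 mu_gt0 alpha_pos Vx G (inr k).
    rewrite /= -/(cS (inr k) om); lra.
  rewrite memNset //= mulr0 (X_busy Hprim alpha0 mu_gt0 alpha_pos Vx G h) -/(cS (inr k) om); lra.
have s4 : - \sum_j v j * (mu j * Rsof (X om) j) <= - \sum_j v j * (mu j * Rsof x j) +
    \sum_j v j * (mu j - cS (inr j) om).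
  rewrite -!sumrN -big_split /=; apply: ler_sum => j _; have /andP[v0 _] := wdn01 k Hw j.
  have := L (inr j); rewrite /= mulr1 -/(cS (inr j) om) => h.
  have := ler_wpM2l v0 h; lra.
have s5 : \sum_j u j * (cN (inl j) om - cN (inr j) om + \sum_l cF l j om + alpha j - cS (inl j) om) =
  \sum_j u j * (cN (inl j) om - cN (inr j) om + \sum_l cF l j om) + \sum_j u j * (alpha j - cS (inl j) om).
  rewrite -big_split /=; apply: eq_bigr => j _; ring.
rewrite /drift_fun /incr s1 s5; move: s2 s3 s4; lra.
Qed.

(** External counts cancel against the sums of their data, and completion counts cancel by
    [weight_balance]; [weighted_arrivals] expresses what remains of [alpha] through [lambda]. *)
Lemma incr_mean (h : R) : has_mean P cH h -> has_mean P incr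
  (\sum_j v j * (mu j - lambda j) - y * (mu k - lambda k) + y * mu k * h).
Proof.
move=> hH; have [n [hN hS hF]] := count_means.
have H : has_mean P incr
  (\sum_j u j * (n (inl j) - n (inr j) + \sum_l Pm l j * n (inr l) + alpha j - n (inl j))
  + y * (n (inr k) - mu k + mu k * h) + \sum_j v j * (mu j - n (inr j))).
  apply: has_meanD; first apply: has_meanD.
  - apply: has_mean_sum => j; apply: has_meanZ; apply: has_meanB => //; apply: has_meanD; last exact: has_mean_cst.
    by apply: has_meanD; [exact: has_meanB|exact: has_mean_sum].
  - apply: has_meanZ; apply: has_meanD; last exact: has_meanZ.
    by apply: has_meanB => //; exact: has_mean_cst.
  - by apply: has_mean_sum => j; apply: has_meanZ; apply: has_meanB => //; exact: has_mean_cst.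
move: H; congr has_mean.
have E1 : \sum_j u j * (n (inl j) - n (inr j) + \sum_l Pm l j * n (inr l) + alpha j - n (inl j)) =
  \sum_j u j * alpha j - \sum_j u j * n (inr j) + \sum_j w j k * n (inr j).
  have -> : \sum_j w j k * n (inr j) = \sum_j u j * \sum_l Pm l j * n (inr l).
    under [RHS]eq_bigr do rewrite mulr_sumr.
    rewrite exchange_big /=; apply: eq_bigr => l _.
    rewrite -(routed_weight k Hw) mulr_suml; apply: eq_bigr => j _; ring.
  rewrite -sumrB -big_split /=; apply: eq_bigr => j _; ring.
have E2 : \sum_j w j k * n (inr j) = \sum_j u j * n (inr j) - y * n (inr k) + \sum_j v j * n (inr j).
  have -> : y * n (inr k) = \sum_j (if j == k then y else 0) * n (inr j).
    by rewrite (bigD1 k) //= eqxx big1 ?addr0 // => i /negbTE ->; rewrite mul0r.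
  rewrite -sumrB -big_split /=; apply: eq_bigr => j _; rewrite -(weight_balance w k j); case: eqP => _; ring.
have E3 : \sum_j v j * (mu j - n (inr j)) = \sum_j v j * mu j - \sum_j v j * n (inr j).
  by rewrite -sumrB; apply: eq_bigr => j _; ring.
have E4 : \sum_j v j * (mu j - lambda j) = \sum_j v j * mu j - \sum_j v j * lambda j.
  by rewrite -sumrB; apply: eq_bigr => j _; ring.
rewrite E1 E2 E3 E4 (weighted_arrivals k Hnet Hw); ring.
Qed.

(** One variable dominating all random terms of the step. The leading 1 makes its powers increasing
    in the exponent, so a single moment controls everything. *)
Definition activity om : R := 1 + \sum_(e : event J) (active k e)%:R * (cN e om + cS e om).

Lemma activity_ge e om : active k e -> cN e om + cS e om <= activity om.
Proof.
move=> ae; rewrite /activity (bigD1 e) //= ae mul1r addrCA lerDl addr_ge0 // sumr_ge0 // => f _.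
by rewrite mulr_ge0 // addr_ge0 ?cN_ge0 ?cS_ge0.
Qed.

Lemma activity_ge1 om : 1 <= activity om.
Proof. by rewrite lerDl sumr_ge0 // => f _; rewrite mulr_ge0 // addr_ge0 ?cN_ge0 ?cS_ge0. Qed.

Lemma activityE om : activity om = 1 +
  (\sum_(j < J) ((j <= k)%N)%:R * (cN (inl j) om + cS (inl j) om) + \sum_j (cN (inr j) om + cS (inr j) om)).
Proof.
rewrite /activity big_sumType /=; congr (1 + (_ + _)).
by apply: eq_bigr => j _; rewrite mul1r.
Qed.

Definition incr_bound : R := J%:R + 3 + \sum_j alpha j + 3 * \sum_j (lambda j + 1).

Lemma lambda1_ge0 j : 0 <= lambda j + 1.
Proof. exact: le_trans (ltW (mu_gt0 j)) (mu_le j). Qed.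

Lemma incr_bound_ge0 : 0 <= incr_bound.
Proof.
rewrite !addr_ge0 // ?sumr_ge0 // mulr_ge0 // sumr_ge0 // => j _; exact: lambda1_ge0.
Qed.

Lemma incr_le om : `|incr om| <= incr_bound * activity om.
Proof.
rewrite activityE.
set wl := \sum_(j < J) ((j <= k)%N)%:R * _; set wr := \sum_j (cN (inr j) om + _).
set sa := \sum_j alpha j; set sl := \sum_j (lambda j + 1).
have sl0 : 0 <= sl by apply: sumr_ge0 => j _; exact: lambda1_ge0.
have sa0 : 0 <= sa by apply: sumr_ge0 => j _; exact: alpha0.
have wl0 : 0 <= wl by apply: sumr_ge0 => j _; rewrite mulr_ge0 // addr_ge0 ?cN_ge0 ?cS_ge0.
have wr0 : 0 <= wr by apply: sumr_ge0 => j _; rewrite addr_ge0 ?cN_ge0 ?cS_ge0.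
have J0 : 0 <= J%:R :> R by [].
have mul01 (a b : R) : 0 <= a <= 1 -> `|a * b| <= `|b|.
  by move=> /andP[a0 a1]; rewrite normrM (ger0_norm a0) ler_piMl.
have h1 : `|\sum_j u j * (cN (inl j) om - cN (inr j) om + \sum_l cF l j om + alpha j - cS (inl j) om)|
   <= wl + wr + J%:R * wr + sa.
  apply: (le_trans (ler_norm_sum _ _ _)).
  have -> : wl + wr + J%:R * wr + sa = \sum_(j < J) (((j <= k)%N)%:R * (cN (inl j) om + cS (inl j) om)
     + (cN (inr j) om + cS (inr j) om) + wr + alpha j).
    by rewrite !big_split /= sumr_const card_ord -[wr *+ J]mulr_natl /wl /wr !big_split.
  apply: ler_sum => j _.
  have F0 : 0 <= \sum_l cF l j om by apply: sumr_ge0 => l _; exact: cF_ge0.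
  have Fw : \sum_l cF l j om <= wr.
    by apply: ler_sum => l _; apply: (le_trans (cF_le l j om)); rewrite lerDl cS_ge0.
  have a0 := alpha0 j.
  have p1 := cN_ge0 (inl j) om; have p2 := cN_ge0 (inr j) om; have p3 := cS_ge0 (inl j) om; have p4 := cS_ge0 (inr j) om.
  have [jk|kj] := leqP j k.
    apply: (le_trans (mul01 _ _ (wup01 k Hw j))); rewrite mul1r ler_norml; apply/andP; split; lra.
  rewrite (_ : u j = 0); last first.
    by rewrite /wup ltnNge (ltnW kj) /=; case: eqP => // E; move: kj; rewrite E ltnn.
  rewrite mul0r normr0 (_ : false%:R = 0 :> R) // mul0r; lra.
have h2 : `|y * (cS (inr k) om - mu k + mu k * cH om)| <= wr + 2 * sl.
  apply: (le_trans (mul01 _ _ (wk01 k Hw))).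
  have /andP[H0 H1] := cH01 om.
  have m0 := mu_gt0 k.
  have mk : mu k <= sl.
    by apply: (le_trans (mu_le k)); rewrite /sl (bigD1 k) //= lerDl sumr_ge0 // => j _; exact: lambda1_ge0.
  have sk : cS (inr k) om <= wr.
    rewrite /wr (bigD1 k) //= addrAC lerDr addr_ge0 ?cN_ge0 // sumr_ge0 // => j _.
    by rewrite addr_ge0 ?cN_ge0 ?cS_ge0.
  have s0 := cS_ge0 (inr k) om.
  have hm : mu k * cH om <= mu k by rewrite ler_piMr // ltW.
  have hm0 : 0 <= mu k * cH om by rewrite mulr_ge0 // ltW.
  rewrite ler_norml; apply/andP; split; lra.
have h3 : `|\sum_j v j * (mu j - cS (inr j) om)| <= sl + wr.
  apply: (le_trans (ler_norm_sum _ _ _)); rewrite -big_split /=; apply: ler_sum => j _.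
  apply: (le_trans (mul01 _ _ (wdn01 k Hw j))).
  have m0 := mu_gt0 j; have ml := mu_le j; have s0 := cS_ge0 (inr j) om; have n0 := cN_ge0 (inr j) om.
  rewrite ler_norml; apply/andP; split; lra.
have -> : incr_bound * (1 + (wl + wr)) = (J%:R + 3) * wl + (J%:R + 3) * wr + (J%:R + 3) + (sa + 3 * sl)
   + (sa + 3 * sl) * (wl + wr) by rewrite /incr_bound -/sa -/sl; ring.
have w1 : 0 <= (sa + 3 * sl) * (wl + wr) by rewrite mulr_ge0 // ?addr_ge0 // mulr_ge0.
have w2 : 0 <= J%:R * wl by rewrite mulr_ge0.
have w3 : 0 <= J%:R * wr by rewrite mulr_ge0.
rewrite /incr; apply: (le_trans (ler_normD _ _)); apply: (le_trans (lerD (ler_normD _ _) (lexx _))).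
lra.
Qed.

Lemma add_power_le (a b : R) p : 0 <= a -> 0 <= b ->
  (a + b) ^+ p.+1 <= 2 ^+ p.+1 * (a ^+ p.+1 + b ^+ p.+1).
Proof.
move=> a0 b0; have := @sum_power_le R bool p (fun c : bool => if c then a else b).
rewrite !big_bool card_bool; apply; by case.
Qed.

(** All data but the last sum to at most [rate e], so only one datum has to be raised to a power,
    and it is dominated by the sum of powers, to which Wald applies. *)
Lemma cS_power e om p : cS e om ^+ p.+1 <=
  2 ^+ p.+1 * (rate e ^+ p.+1 + \sum_(i < N e om) D e i om ^+ p.+1).
Proof.
have r0 : 0 <= rate e by exact: rate_ge0.
rewrite /cS; case EN : (N e om) => [|n].
  by rewrite !big_ord0 expr0n /= addr0 mulr_ge0 // exprn_ge0.
have le : \sum_(i < n) D e i om <= rate e.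
  have := Nt_path0 Hprim alpha0 mu_gt0 alpha_pos Vx (t := 1) (e := e) (om := om) (n := n).
  by rewrite EN ltnSn mulr1; apply.
rewrite !big_ord_recr /=.
have D0 i : 0 <= D e i om by exact: (Dge0 Hprim).
have s0 : 0 <= \sum_(i < n) D e i om by apply: sumr_ge0.
apply: (@le_trans _ _ ((rate e + D e n om) ^+ p.+1)).
  by rewrite lerXn2r ?nnegrE ?addr_ge0 // lerD2r.
apply: (le_trans (add_power_le p r0 (D0 n))).
rewrite ler_wpM2l ?exprn_ge0 // lerD2l lerDr sumr_ge0 // => i _.
by rewrite exprn_ge0.
Qed.


Lemma cN_moment e p : (\int[P]_om (cN e om ^+ p)%:E <= (p`!%:R * ((rate e + 1) / tau e) ^+ p)%:E)%E.
Proof.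
by have := Nt_moment Hprim alpha0 mu_gt0 alpha_pos Vx t1 e p; rewrite mulr1.
Qed.

Lemma cS_moment e : active k e -> (\int[P]_om (cS e om ^+ m.+2)%:E <=
  (2 ^+ m.+2 * (rate e ^+ m.+2 + gam e * ((rate e + 1) / tau e)))%:E)%E.
Proof.
move=> ae; have D0 i om : 0 <= D e i om by exact: (Dge0 Hprim).
have r0 : 0 <= rate e by exact: rate_ge0.
have g0 : 0 <= gam e.
  by rewrite -lee_fin -Hgam //; apply: integral_ge0 => om _; rewrite lee_fin exprn_ge0.
have mF : measurable_fun setT (fun om => \sum_(i < N e om) D e i om ^+ m.+2).
  apply: (@measurable_Nsum _ _ _ (N e) (mN e) (fun i om => D e i om ^+ m.+2)) => i.
  by apply: measurable_funX; exact: (measurable_D Hprim).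
have F0 om : 0 <= \sum_(i < N e om) D e i om ^+ m.+2 by apply: sumr_ge0 => i _; rewrite exprn_ge0.
have [q hq /andP[_ qb]] : exists2 q, has_mean P (fun om => \sum_(i < N e om) D e i om ^+ m.+2) q
    & 0 <= q <= gam e * ((rate e + 1) / tau e).
  apply: has_mean_ge0 => //.
  rewrite (D_moment_wald Hprim Hnet mu_gt0 alpha_pos Vx t1 (Hgam ae)) EFinM.
  apply: lee_wpmul2l; first by rewrite lee_fin.
  by have := N_mean_le Hprim Hnet mu_gt0 alpha_pos e Vx t1; rewrite mulr1.
have [_ E] := has_meanZ (2 ^+ m.+2) (has_meanD (has_mean_cst P (rate e ^+ m.+2)) hq).
apply: (@le_trans _ _ (\int[P]_om (2 ^+ m.+2 * (rate e ^+ m.+2 + \sum_(i < N e om) D e i om ^+ m.+2))%:E)%E).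
  apply: ge0_le_integral => //.
  - by move=> om _; rewrite lee_fin exprn_ge0 // cS_ge0.
  - by apply/measurable_EFinP; apply: measurable_funX; exact: measurable_cS.
  - apply/measurable_EFinP; apply: measurable_funM; first exact: measurable_cst.
    by apply: measurable_funD => //; exact: measurable_cst.
  - by move=> om _; rewrite lee_fin cS_power.
by rewrite E lee_fin ler_wpM2l ?exprn_ge0 // lerD2l.
Qed.

Lemma measurable_activity : measurable_fun setT activity.
Proof.
apply: measurable_funD; first exact: measurable_cst.
apply: measurable_sum => e; apply: measurable_funM; first exact: measurable_cst.
by apply: measurable_funD; [exact: measurable_cN|exact: measurable_cS].
Qed.

Lemma activity_moment : (\int[P]_om (activity om ^+ m.+2)%:E <=
  (2 ^+ m.+2 * (1 + #|{: event J}|%:R ^+ m.+2 * \sum_(e : event J) (active k e)%:R *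
     (2 ^+ m.+2 * ((m.+2)`!%:R * ((rate e + 1) / tau e) ^+ m.+2
        + 2 ^+ m.+2 * (rate e ^+ m.+2 + gam e * ((rate e + 1) / tau e))))))%:E)%E.
Proof.
have H e : exists q, has_mean P (fun om => (active k e)%:R * (2 ^+ m.+2 * (cN e om ^+ m.+2 + cS e om ^+ m.+2))) q
   /\ q <= (active k e)%:R * (2 ^+ m.+2 * ((m.+2)`!%:R * ((rate e + 1) / tau e) ^+ m.+2
        + 2 ^+ m.+2 * (rate e ^+ m.+2 + gam e * ((rate e + 1) / tau e)))).
  case ae : (active k e); last first.
    exists 0; split; last by rewrite (_ : false%:R = 0 :> R) // mul0r.
    rewrite (_ : (fun om => _) = fun=> 0); first exact: has_mean_cst.
    by apply/funext => om; rewrite (_ : false%:R = 0 :> R) // mul0r.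
  have [q1 h1 /andP[_ b1]] := has_mean_ge0 (measurable_funX m.+2 (measurable_cN e))
    (fun om => exprn_ge0 m.+2 (cN_ge0 e om)) (cN_moment e m.+2).
  have [q2 h2 /andP[_ b2]] := has_mean_ge0 (measurable_funX m.+2 (measurable_cS e))
    (fun om => exprn_ge0 m.+2 (cS_ge0 e om)) (cS_moment ae).
  exists (true%:R * (2 ^+ m.+2 * (q1 + q2))); split.
    by apply: has_meanZ; apply: has_meanZ; exact: has_meanD.
  by rewrite !ler_wpM2l ?exprn_ge0 // lerD.
have [q hqb] := boolp.choice H.
have hq e : has_mean P (fun om => (active k e)%:R * (2 ^+ m.+2 * (cN e om ^+ m.+2 + cS e om ^+ m.+2))) (q e) by have [] := hqb e.
pose F om := 2 ^+ m.+2 * (1 + #|{: event J}|%:R ^+ m.+2 * \sum_(e : event J) (active k e)%:R *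
  (2 ^+ m.+2 * (cN e om ^+ m.+2 + cS e om ^+ m.+2))).
have [_ E] : has_mean P F (2 ^+ m.+2 * (1 + #|{: event J}|%:R ^+ m.+2 * \sum_e q e)).
  apply: has_meanZ; apply: has_meanD; first exact: has_mean_cst.
  by apply: has_meanZ; exact: has_mean_sum.
have mF : measurable_fun setT F.
  apply: measurable_funM; first exact: measurable_cst.
  apply: measurable_funD; first exact: measurable_cst.
  apply: measurable_funM; first exact: measurable_cst.
  apply: measurable_sum => e; do 2 (apply: measurable_funM; first exact: measurable_cst).
  by apply: measurable_funD; apply: measurable_funX; [exact: measurable_cN|exact: measurable_cS].
have act0 om e : 0 <= (active k e)%:R * (cN e om + cS e om).
  by rewrite mulr_ge0 // addr_ge0 ?cN_ge0 ?cS_ge0.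
apply: (@le_trans _ _ (\int[P]_om (F om)%:E)%E).
  apply: ge0_le_integral => //.
  - by move=> om _; rewrite lee_fin exprn_ge0 // (le_trans _ (activity_ge1 om)).
  - by apply/measurable_EFinP; apply: measurable_funX; exact: measurable_activity.
  - exact/measurable_EFinP.
  move=> om _; rewrite lee_fin /activity.
  apply: (le_trans (add_power_le _ ler01 _)); first by apply: sumr_ge0.
  rewrite ler_wpM2l ?exprn_ge0 // expr1n lerD2l.
  apply: (le_trans (sum_power_le _ (act0 om))).
  rewrite ler_wpM2l ?exprn_ge0 //; apply: ler_sum => e _.
  case: (active k e) => /=; last by rewrite mulr0n !mul0r expr0n.
  by rewrite !mul1r add_power_le ?cN_ge0 ?cS_ge0.
rewrite E lee_fin ler_wpM2l ?exprn_ge0 // lerD2l ler_wpM2l ?exprn_ge0 //.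
by apply: ler_sum => e _; have [] := hqb e.
Qed.

End Drift.

Definition lower_jobs {R : realType} {J : nat} (k : 'I_J) (M : nat) (x : state R J) : R :=
  \sum_(j < J) (((j < k)%N)%:R * (Zof x j)%:R) ^+ M.

Definition idle_power {R : realType} {J : nat} (alpha mu : 'I_J -> R) (k : 'I_J) (M : nat)
  (x : state R J) : R := rho alpha mu (inr k) x ^+ M * (Zof x k == 0%N)%:R.

(** Cost of raising the bound of [emptied_drift_fun] to the power [M]: [4 ^+ M] from splitting three
    summands in two rounds, and one summand for each kind of term. *)
Definition hit_factor {R : realType} {J : nat} (lambda : 'I_J -> R) (k : 'I_J) (M : nat) : R :=
  4 ^+ M * (J%:R ^+ M + (lambda k + 2) ^+ M + 1).

Lemma measurable_jobs {R : realType} {J : nat} j :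
  measurable_fun setT (fun x : stateM R J => (Zof x j)%:R : R).
Proof.
have [mz _ _] := @mstate_id R J.
by apply: (mfun_case (g := fun n _ => n%:R : R) (mz j)) => n; exact: measurable_cst.
Qed.

(** * Drift of a power of the positive part *)

Section DriftStep.
Context {R : realType} {J : nat} {d : measure_display} {Om : measurableType d}.
Variables (P : probability Om R) (Pm w : 'M[R]_J).
Variables (Te Ts : 'I_J -> nat -> Om -> R) (Phi : 'I_J -> nat -> Om -> option 'I_J).
Hypothesis Hprim : gjn_primitives P Pm Te Ts Phi.
Variables (alpha mu lambda : 'I_J -> R).
Hypothesis Hnet : network_data alpha Pm lambda.
Hypothesis Hw : w_matrix Pm w.
Hypothesis mu_gt0 : forall j, 0 < mu j.
Hypothesis mu_le : forall j, mu j <= lambda j + 1.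
Hypothesis alpha_pos : exists i, 0 < alpha i.
Variables (k : 'I_J) (m : nat).
Variable x : state R J.
Hypothesis Vx : valid_state x.

Let alpha0 := alpha_ge0 Hnet.
Let t1 : 0 <= 1 :> R := ler01.

Local Notation X om := (gpath alpha mu (fun j n => Te j n om) (fun j n => Ts j n om)
                          (fun j n => Phi j n om) x 1).
Local Notation N := (nb_events Te Ts Phi alpha mu x 1).
Local Notation Good := (nonexplosive_at Te Ts Phi alpha mu x 1).
Local Notation V := (drift_fun alpha mu w k).
Local Notation vp := (Num.max (V x) 0).
Local Notation act := (activity Te Ts Phi alpha mu k x).
Local Notation cH := (cH Te Ts Phi alpha mu k x).

Lemma lambda2_ge0 : 0 <= lambda k + 2.
Proof. have := mu_gt0 k; have := mu_le k; lra. Qed.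

Lemma drift_fun_le : V x <= \sum_(j < J) ((j < k)%N)%:R * (Zof x j)%:R + (Zof x k)%:R + rho alpha mu (inr k) x.
Proof.
rewrite (rhoE Hnet mu_gt0) //=.
have s1 : \sum_j wup w k j * (Zof x j)%:R <= \sum_(j < J) ((j < k)%N)%:R * (Zof x j)%:R + (Zof x k)%:R.
  have -> : (Zof x k)%:R = \sum_(j < J) (if j == k then (Zof x j)%:R else 0) :> R.
    by rewrite (bigD1 k) //= eqxx big1 ?addr0 // => i /negbTE ->.
  rewrite -big_split /=; apply: ler_sum => j _; rewrite /wup.
  case: eqP => [->|_]; first by rewrite ltnn mulr0n mul0r mul1r add0r.
  rewrite addr0; case: ifP => _; last by rewrite !mul0r.
  by rewrite ler_wpM2r //; have /andP[] := w01 Hw j k.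
have s2 : 0 <= \sum_j wup w k j * (alpha j * Reof x j).
  apply: sumr_ge0 => j _; have /andP[u0 _] := wup01 k Hw j; have [Re0 _] := Vx j.
  by rewrite !mulr_ge0.
have s3 : 0 <= \sum_j wdn w k j * (mu j * Rsof x j).
  apply: sumr_ge0 => j _; have /andP[u0 _] := wdn01 k Hw j; have [_ Rs0] := Vx j.
  by rewrite !mulr_ge0 // ltW.
have s4 : wk w k * (mu k * Rsof x k) <= mu k * Rsof x k.
  have /andP[_ y1] := wk01 k Hw; have [_ Rs0] := Vx k.
  by rewrite ler_piMl // mulr_ge0 // ltW.
rewrite /drift_fun; lra.
Qed.

(** If [k] starts nonempty, emptying it requires serving all initial jobs, so [Zof x k] is at most
    the number of completions, and the first completion within time 1 forces the unitized residual
    below [mu k <= lambda k + 1]; together this gives the factor [lambda k + 2]. If [k] starts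
    empty, its residual is that of an idle station. *)
Lemma emptied_drift_fun om : Good om -> emptied Te Ts Phi alpha mu k x om ->
  vp <= \sum_(j < J) ((j < k)%N)%:R * (Zof x j)%:R + (lambda k + 2) * act om
        + rho alpha mu (inr k) x * (Zof x k == 0%N)%:R.
Proof.
move=> G E.
have zN := X_emptied Hprim alpha0 mu_gt0 alpha_pos Vx G E.
have a1 := activity_ge1 Hprim alpha mu k x om.
have aN : (N (inr k) om)%:R <= act om.
  apply: le_trans (activity_ge Hprim alpha mu x om (k := k) (e := inr k) isT).
  by rewrite lerDl (cS_ge0 Hprim).
have m1 := mu_le k; have l2 := lambda2_ge0.
have r0 := rho_ge0 alpha mu (inr k) x.
have S0 : 0 <= \sum_(j < J) ((j < k)%N)%:R * (Zof x j)%:R :> R.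
  by apply: sumr_ge0 => j _; rewrite mulr_ge0.
rewrite ge_max; apply/andP; split; last first.
  by rewrite !addr_ge0 // mulr_ge0 // (le_trans _ a1).
apply: (le_trans drift_fun_le).
have m0 := mu_gt0 k.
case: eqP => [->|/eqP z0]; rewrite ?mulr1 ?mulr0.
  rewrite addr0 -addrA lerD2l lerDr mulr_ge0 //; lra.
have N1 : (0 < N (inr k) om)%N by rewrite (leq_trans _ zN) // lt0n.
have rk : rho alpha mu (inr k) x <= mu k.
  rewrite (rhoE Hnet mu_gt0) //; have := Nt_path Hprim alpha0 mu_gt0 alpha_pos Vx (t := 1) N1.
  by rewrite big_ord0 addr0 mulr1.
have zN' : (Zof x k)%:R <= act om by apply: le_trans aN; rewrite ler_nat.
have : mu k * 1 <= (lambda k + 1) * act om by rewrite ler_pM // ltW.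
lra.
Qed.

Lemma emptied_power om : Good om -> cH om * vp ^+ m.+1 <=
  hit_factor lambda k m.+1 * (lower_jobs k m.+1 x + act om ^+ m.+2 + idle_power alpha mu k m.+1 x).
Proof.
move=> G.
have a1 := activity_ge1 Hprim alpha mu k x om.
have a0 : 0 <= act om by apply: le_trans a1.
have l2 := lambda2_ge0.
have r0 := rho_ge0 alpha mu (inr k) x.
have S0 (j : 'I_J) : 0 <= ((j < k)%N)%:R * (Zof x j)%:R :> R by rewrite mulr_ge0.
have L0 : 0 <= lower_jobs k m.+1 x.
  by apply: sumr_ge0 => j _; rewrite exprn_ge0.
have I0 : 0 <= idle_power alpha mu k m.+1 x by rewrite mulr_ge0 ?exprn_ge0.
have K0 : 0 <= hit_factor lambda k m.+1.
  by rewrite mulr_ge0 ?exprn_ge0 // !addr_ge0 // exprn_ge0.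
rewrite /cH indicE; case: (boolP (_ \in _)) => [|_]; last first.
  by rewrite mulr0n mul0r mulr_ge0 // !addr_ge0 // exprn_ge0.
rewrite inE => /(emptied_drift_fun G) h; rewrite mul1r.
have SS0 : 0 <= \sum_(j < J) ((j < k)%N)%:R * (Zof x j)%:R :> R by apply: sumr_ge0.
have b0 : 0 <= (lambda k + 2) * act om by rewrite mulr_ge0.
have c0 : 0 <= rho alpha mu (inr k) x * (Zof x k == 0%N)%:R by rewrite mulr_ge0.
have v0 : 0 <= vp by rewrite le_max lexx orbT.
apply: (@le_trans _ _ ((\sum_(j < J) ((j < k)%N)%:R * (Zof x j)%:R + (lambda k + 2) * act om
        + rho alpha mu (inr k) x * (Zof x k == 0%N)%:R) ^+ m.+1)).
  by rewrite lerXn2r ?nnegrE // !addr_ge0.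
apply: (le_trans (add_power_le _ (addr_ge0 SS0 b0) c0)).
have ab := add_power_le m SS0 b0.
have aS := sum_power_le m S0; rewrite card_ord -/(lower_jobs k m.+1 x) in aS.
(* Since [act om >= 1], the exponent may be raised to the one moment of [activity] that is
   controlled. *)
have bA : ((lambda k + 2) * act om) ^+ m.+1 <= (lambda k + 2) ^+ m.+1 * act om ^+ m.+2.
  by rewrite exprMn ler_wpM2l ?exprn_ge0 // [leRHS]exprS ler_peMl ?exprn_ge0.
have cI : (rho alpha mu (inr k) x * (Zof x k == 0%N)%:R) ^+ m.+1 = idle_power alpha mu k m.+1 x.
  by rewrite exprMn /idle_power; case: eqP => _; rewrite ?expr1n ?expr0n.
rewrite cI /hit_factor (_ : 4 = 2 * 2 :> R); last by ring.
rewrite exprMn -!mulrA ler_wpM2l ?exprn_ge0 //.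
have t0 : 1 <= 2 ^+ m.+1 :> R by rewrite exprn_ege1 // ler1n.
move: t0 ab aS bA; set T := 2 ^+ m.+1; set A := act om ^+ m.+2.
have A0 : 0 <= A by rewrite exprn_ge0.
move=> t0 ab aS bA.
have JL : 0 <= J%:R ^+ m.+1 :> R by rewrite exprn_ge0.
have lL : 0 <= (lambda k + 2) ^+ m.+1 by rewrite exprn_ge0.
apply: (le_trans (lerD ab (lexx _))).
apply: (@le_trans _ _ (T * (J%:R ^+ m.+1 * lower_jobs k m.+1 x + (lambda k + 2) ^+ m.+1 * A) + T * idle_power alpha mu k m.+1 x)).
  apply: lerD; first by rewrite ler_wpM2l ?lerD // (le_trans _ t0).
  by rewrite ler_peMl.
rewrite -mulrDr ler_wpM2l ?(le_trans _ t0) //.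
move: JL lL L0 I0 A0; set a := _ ^+ _; set b := _ ^+ _; set L := lower_jobs _ _ _; set I := idle_power _ _ _ _ _.
nra.
Qed.


Lemma measurable_drift_fun : measurable_fun setT (fun x : stateM R J => V x).
Proof.
have mZ := @measurable_jobs R J.
have mc (c : R) f : measurable_fun setT f -> measurable_fun setT (fun x : stateM R J => c * f x).
  by move=> mf; apply: measurable_funM => //; exact: measurable_cst.
apply: measurable_funB; last first.
  apply: measurable_sum => j; do 2 apply: (mc).
  exact: (mfun_ev_time (inr j) mstate_id).
apply: measurable_funD; last by do 2 apply: (mc); exact: (mfun_ev_time (inr k) mstate_id).
apply: measurable_funB; apply: measurable_sum => j; first exact: mc.
do 2 apply: (mc); exact: (mfun_ev_time (inl j) mstate_id).
Qed.

Lemma drift_moment (A : R) : (\int[P]_om (act om ^+ m.+2)%:E <= A%:E)%E ->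
  (\int[P]_om (Num.max (V (X om)) 0 ^+ m.+2)%:E <=
   (vp ^+ m.+2 + m.+2%:R * vp ^+ m.+1 *
       (\sum_j wdn w k j * (mu j - lambda j) - wk w k * (mu k - lambda k))
    + m.+2%:R * ((lambda k + 1) * (hit_factor lambda k m.+1 *
       (lower_jobs k m.+1 x + A + idle_power alpha mu k m.+1 x)))
    + taylor_cst m * (vp ^+ m * (incr_bound alpha lambda ^+ 2 * A)
        + incr_bound alpha lambda ^+ m.+2 * A))%:E)%E.
Proof.
move=> HA.
have a1 om : 1 <= act om := activity_ge1 Hprim alpha mu k x om.
have a0 om : 0 <= act om by apply: le_trans (a1 om).
have v0 : 0 <= vp by rewrite le_max lexx orbT.
have B0 : 0 <= incr_bound alpha lambda := incr_bound_ge0 Hnet mu_gt0 mu_le.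
have tc0 : 0 <= taylor_cst m :> R by apply: le_trans (taylor_cst_ge m).
have mact : measurable_fun setT act by exact: (measurable_activity Hprim).
have [a ha /andP[a_ge0 aA]] := has_mean_ge0 (measurable_funX m.+2 mact) (fun om => exprn_ge0 m.+2 (a0 om)) HA.
have [h hh /andP[h0 _]] : exists2 h, has_mean P cH h & 0 <= h <= 1.
  apply: has_mean_ge0; first by apply: measurable_indic; exact: (measurable_emptied Hprim).
    by move=> om; have /andP[] := cH01 Te Ts Phi alpha mu k x om.
  rewrite -(integral_prob_cst P 1); apply: ge0_le_integral => //.
  - by move=> om _; rewrite lee_fin; have /andP[] := cH01 Te Ts Phi alpha mu k x om.
  - by apply/measurable_EFinP; apply: measurable_indic; exact: (measurable_emptied Hprim).
  - by move=> om _; rewrite lee_fin; have /andP[] := cH01 Te Ts Phi alpha mu k x om.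
have hi := incr_mean Hprim Hnet Hw mu_gt0 alpha_pos Vx hh.
set dr := _ - _ * (mu k - lambda k) in hi *.
set K := hit_factor lambda k m.+1 * _.
(* [vp] is a constant of the initial state, so this product is the mean of [cH * vp ^+ m.+1], to
   which the pathwise bound [emptied_power] applies. *)
have hK : h * vp ^+ m.+1 <= K.
  pose r := hit_factor lambda k m.+1.
  have r0 : 0 <= r.
    by rewrite mulr_ge0 ?exprn_ge0 // !addr_ge0 // exprn_ge0 // lambda2_ge0.
  apply: (@le_trans _ _ (r * (lower_jobs k m.+1 x + a + idle_power alpha mu k m.+1 x))); last first.
    by rewrite ler_wpM2l // lerD2r lerD2l.
  have e1 := has_meanZ (vp ^+ m.+1) hh.
  have e2 := has_meanZ r (has_meanD (has_meanD (has_mean_cst P (lower_jobs k m.+1 x)) ha)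
    (has_mean_cst P (idle_power alpha mu k m.+1 x))).
  rewrite mulrC; apply: (has_mean_le_ae e1 e2).
  have := Xprime_ae Hprim Hnet mu_gt0 alpha_pos Vx t1.
  apply: filterS => om G; rewrite mulrC; exact: emptied_power.
pose B := incr_bound alpha lambda.
pose inc := incr w Te Ts Phi alpha mu k x.
pose F om := vp ^+ m.+2 + m.+2%:R * vp ^+ m.+1 * inc om
  + taylor_cst m * (vp ^+ m * (B ^+ 2 * act om ^+ m.+2) + B ^+ m.+2 * act om ^+ m.+2).
have hF : has_mean P F (vp ^+ m.+2 + m.+2%:R * vp ^+ m.+1 * (dr + wk w k * mu k * h)
  + taylor_cst m * (vp ^+ m * (B ^+ 2 * a) + B ^+ m.+2 * a)).
  apply: has_meanD; first by apply: has_meanD; [exact: has_mean_cst|exact: has_meanZ].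
  by apply: has_meanZ; apply: has_meanD; repeat apply: has_meanZ.
have le1 om : Num.max (V x + inc om) 0 ^+ m.+2 <= F om.
  have ib := incr_le Hprim Hnet Hw mu_gt0 mu_le k x om.
  have ba : 0 <= B * act om by rewrite mulr_ge0.
  rewrite -/inc -/B in ib.
  apply: (le_trans (taylor_max m (V x) (inc om))); rewrite /F lerD2l ler_wpM2l //.
  apply: lerD; last by rewrite -exprMn lerXn2r ?nnegrE.
  rewrite ler_wpM2l ?exprn_ge0 // -real_normK ?num_real //.
  apply: (@le_trans _ _ ((B * act om) ^+ 2)); first by rewrite lerXn2r ?nnegrE.
  by rewrite exprMn ler_wpM2l ?exprn_ge0 // ler_weXn2l.
have [iF EF] := hF.
have mF : measurable_fun setT F by apply/measurable_EFinP; exact: measurable_int iF.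
apply: (@le_trans _ _ (\int[P]_om (F om)%:E)%E).
  apply: (ge0_integral_le_ae (V := Good)).
  - by apply: measurable_Good; exact: Hprim.
  - exact: (Good_ae Hprim alpha0 mu_gt0 alpha_pos Vx t1).
  - by move=> om; rewrite lee_fin exprn_ge0 // le_max lexx orbT.
  - by move=> om; rewrite lee_fin (le_trans _ (le1 om)) // exprn_ge0 // le_max lexx orbT.
  - exact/measurable_EFinP.
  move=> om G; rewrite lee_fin; apply: le_trans (le1 om).
  have ip := incr_path Hprim Hnet Hw mu_gt0 alpha_pos k Vx G.
  have n0 (z : R) : 0 <= Num.max z 0 by rewrite le_max lexx orbT.
  rewrite lerXn2r ?nnegrE ?n0 // ge_max n0 andbT le_max.
  by rewrite ip.
rewrite EF lee_fin.
have /andP[y0 y1] := wk01 k Hw.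
have m0 := mu_gt0 k; have ml := mu_le k.
have K0 : 0 <= h * vp ^+ m.+1 by rewrite mulr_ge0 ?exprn_ge0.
have ym : wk w k * mu k * (h * vp ^+ m.+1) <= (lambda k + 1) * K.
  apply: ler_pM => //; first by rewrite mulr_ge0 // ltW.
  by apply: le_trans ml; rewrite ler_piMl // ltW.
have s1 : m.+2%:R * vp ^+ m.+1 * (dr + wk w k * mu k * h) <=
  m.+2%:R * vp ^+ m.+1 * dr + m.+2%:R * ((lambda k + 1) * K).
  have -> : m.+2%:R * vp ^+ m.+1 * (dr + wk w k * mu k * h) = m.+2%:R * vp ^+ m.+1 * dr +
    m.+2%:R * (wk w k * mu k * (h * vp ^+ m.+1)) by ring.
  by rewrite lerD2l ler_wpM2l.
have s2 : vp ^+ m * (B ^+ 2 * a) + B ^+ m.+2 * a <= vp ^+ m * (B ^+ 2 * A) + B ^+ m.+2 * A.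
  by apply: lerD; rewrite ?ler_wpM2l ?exprn_ge0 // ler_wpM2l ?exprn_ge0.
have := ler_wpM2l tc0 s2; move: s1; rewrite -/B; lra.
Qed.

End DriftStep.

(** * Bounds uniform in the service rates and the induction step *)

Section Uniform.
Context {R : realType} {J : nat} {d : measure_display} {Om : measurableType d}.
Variables (P : probability Om R) (Pm w : 'M[R]_J).
Variables (Te Ts : 'I_J -> nat -> Om -> R) (Phi : 'I_J -> nat -> Om -> option 'I_J).
Hypothesis Hprim : gjn_primitives P Pm Te Ts Phi.
Variables (alpha lambda : 'I_J -> R).
Hypothesis Hnet : network_data alpha Pm lambda.
Hypothesis Hw : w_matrix Pm w.
Hypothesis alpha_pos : exists i, 0 < alpha i.
Variables (k : 'I_J) (m : nat) (gam : event J -> R).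
Hypothesis Hgam : forall e, active k e ->
  (\int[P]_om (dat Te Ts e 0%N om ^+ m.+2)%:E = (gam e)%:E)%E.

Local Notation tau e := (tau P Te Ts e).
Local Notation X mu x om := (gpath alpha mu (fun j n => Te j n om) (fun j n => Ts j n om)
                          (fun j n => Phi j n om) x 1).
Local Notation vp mu x := (Num.max (drift_fun alpha mu w k x) 0).

Let alpha0 := alpha_ge0 Hnet.

Lemma lambda_gt0 j : 0 < lambda j. Proof. by case: Hnet => _ _ _ _ /(_ j)[]. Qed.

Lemma gam_ge0 e : active k e -> 0 <= gam e.
Proof.
move=> ae; rewrite -lee_fin -Hgam //; apply: integral_ge0 => om _.
by rewrite lee_fin exprn_ge0 // (Dge0 Hprim).
Qed.

Lemma rate_bound_ge0 e : 0 <= rate_bound alpha lambda e.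
Proof. by case: e => j /=; rewrite ?alpha0 // addr_ge0 // ltW // lambda_gt0. Qed.

Lemma rate_le_bound (mu : 'I_J -> R) e : (forall j, mu j <= lambda j + 1) -> rate alpha mu e <= rate_bound alpha lambda e.
Proof. by move=> h; case: e => j /=. Qed.

Lemma rate_div_tau_le (mu : 'I_J -> R) e : (forall j, mu j <= lambda j + 1) ->
  (rate alpha mu e + 1) / tau e <= (rate_bound alpha lambda e + 1) / tau e.
Proof.
move=> ml; rewrite ler_wpM2r ?invr_ge0 ?(ltW (tau_gt0 Hprim e)) // lerD2r.
exact: rate_le_bound.
Qed.

(** The rates enter the moment bound monotonically and are replaced by [rate_bound], whereas [tau]
    depends only on the laws of the data. *)
Lemma activity_moment_uniform : exists2 A : R, 0 <= A & forall mu : 'I_J -> R, (forall j, 0 < mu j) ->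
  (forall j, mu j <= lambda j + 1) -> forall x, valid_state x ->
  (\int[P]_om (activity Te Ts Phi alpha mu k x om ^+ m.+2)%:E <= A%:E)%E.
Proof.
pose q e := (rate_bound alpha lambda e + 1) / tau e.
have q0 e : 0 <= q e.
  by rewrite divr_ge0 ?addr_ge0 ?rate_bound_ge0 // ltW // (tau_gt0 Hprim).
pose b e := 2 ^+ m.+2 * ((m.+2)`!%:R * q e ^+ m.+2
        + 2 ^+ m.+2 * (rate_bound alpha lambda e ^+ m.+2 + gam e * q e)).
exists (2 ^+ m.+2 * (1 + #|{: event J}|%:R ^+ m.+2 * \sum_(e : event J) (active k e)%:R * b e)).
  rewrite mulr_ge0 ?exprn_ge0 // addr_ge0 // mulr_ge0 ?exprn_ge0 // sumr_ge0 // => e _.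
  case ae : (active k e); rewrite ?mulr0n ?mul0r // mul1r.
  by rewrite mulr_ge0 ?exprn_ge0 // addr_ge0 // mulr_ge0 ?exprn_ge0 // addr_ge0 ?exprn_ge0 ?rate_bound_ge0 // mulr_ge0 ?gam_ge0.
move=> mu mu0 ml x Vx.
apply: (le_trans (activity_moment Hprim Hnet mu0 alpha_pos Hgam Vx)).
rewrite lee_fin ler_wpM2l ?exprn_ge0 // lerD2l ler_wpM2l ?exprn_ge0 //.
apply: ler_sum => e _; case ae : (active k e); rewrite ?mulr0n ?mul0r // !mul1r.
have r0 : 0 <= rate alpha mu e by exact: rate_ge0.
have qe : 0 <= (rate alpha mu e + 1) / tau e.
  by rewrite divr_ge0 ?addr_ge0 // ltW // (tau_gt0 Hprim).
have le := rate_div_tau_le e ml.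
rewrite ler_wpM2l ?exprn_ge0 //; apply: lerD.
  by rewrite ler_wpM2l // lerXn2r ?nnegrE.
rewrite ler_wpM2l ?exprn_ge0 //; apply: lerD; last by rewrite ler_wpM2l // gam_ge0.
by rewrite lerXn2r ?nnegrE ?rate_bound_ge0 // rate_le_bound.
Qed.

Lemma drift_uniform (c : R) : 0 < c -> exists2 C : R, 0 <= C & forall mu : 'I_J -> R, (forall j, 0 < mu j) ->
  (forall j, mu j <= lambda j + 1) -> forall (s : R) x, valid_state x -> 0 < s <= 1 ->
  \sum_j wdn w k j * (mu j - lambda j) - wk w k * (mu k - lambda k) <= - (c * s) ->
  (\int[P]_om (vp mu (X mu x om) ^+ m.+2)%:E + (c * s * vp mu x ^+ m.+1)%:E <=
   (vp mu x ^+ m.+2 + C * (lower_jobs k m.+1 x + idle_power alpha mu k m.+1 x + s^-1 ^+ m))%:E)%E.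
Proof.
move=> c0; have [A A0 HA] := activity_moment_uniform.
pose B := incr_bound alpha lambda.
pose E := m.+2%:R * ((lambda k + 1) * hit_factor lambda k m.+1).
pose a := taylor_cst m * (B ^+ 2 * A).
pose b := taylor_cst m * (B ^+ m.+2 * A).
have l0 := ltW (lambda_gt0 k).
have B0 : 0 <= B.
  rewrite /B /incr_bound !addr_ge0 // ?sumr_ge0 // mulr_ge0 // sumr_ge0 // => j _.
  by rewrite addr_ge0 // ltW // lambda_gt0.
have tc0 : 0 <= taylor_cst m :> R by apply: le_trans (taylor_cst_ge m).
have E0 : 0 <= E.
  by rewrite mulr_ge0 // mulr_ge0 ?addr_ge0 // mulr_ge0 ?exprn_ge0 // !addr_ge0 // exprn_ge0 // addr_ge0.
have a0 : 0 <= a by rewrite mulr_ge0 // mulr_ge0 // exprn_ge0.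
have b0 : 0 <= b by rewrite mulr_ge0 // mulr_ge0 // exprn_ge0.
have y0 : 0 <= a * (a / c) ^+ m by rewrite mulr_ge0 // exprn_ge0 // divr_ge0 // ltW.
exists (E * (1 + A) + a * (a / c) ^+ m + b).
  by rewrite !addr_ge0 // mulr_ge0 // addr_ge0.
move=> mu mu0 ml s x Vx /andP[s0 s1] dr.
have L0 : 0 <= lower_jobs k m.+1 x.
  by apply: sumr_ge0 => j _; rewrite exprn_ge0 // mulr_ge0.
have I0 : 0 <= idle_power alpha mu k m.+1 x.
  by rewrite mulr_ge0 // exprn_ge0 // rho_ge0.
have v0 : 0 <= vp mu x by rewrite le_max lexx orbT.
have H := drift_moment Hprim Hnet Hw mu0 ml alpha_pos Vx (HA mu mu0 ml x Vx).
apply: (le_trans (leeD H (lexx _))); rewrite -EFinD lee_fin.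
have Y := young_power m a0 c0 s0 v0.
(* The Taylor factor [m.+2] is at least 2: one copy of the drift absorbs the second-order term
   through [young_power], the other remains as the gain. *)
have D : m.+2%:R * vp mu x ^+ m.+1 * (\sum_j wdn w k j * (mu j - lambda j) - wk w k * (mu k - lambda k))
   <= - (2 * (c * s * vp mu x ^+ m.+1)).
  have m2 : 2 <= m.+2%:R :> R by rewrite ler_nat.
  have p0 : 0 <= m.+2%:R * vp mu x ^+ m.+1 by rewrite mulr_ge0 ?exprn_ge0.
  apply: (le_trans (ler_wpM2l p0 dr)); rewrite mulrN lerN2.
  have -> : m.+2%:R * vp mu x ^+ m.+1 * (c * s) = m.+2%:R * (c * s * vp mu x ^+ m.+1) by ring.
  by rewrite ler_wpM2r // mulr_ge0 ?exprn_ge0 // mulr_ge0 // ltW.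
have si : 1 <= s^-1 ^+ m by rewrite exprn_ege1 // invf_ge1.
have F : E * (lower_jobs k m.+1 x + A + idle_power alpha mu k m.+1 x) <=
  E * (1 + A) * (lower_jobs k m.+1 x + idle_power alpha mu k m.+1 x + s^-1 ^+ m).
  rewrite -mulrA ler_wpM2l //.
  have : A * 1 <= A * s^-1 ^+ m by rewrite ler_wpM2l.
  have : 0 <= A * lower_jobs k m.+1 x by rewrite mulr_ge0.
  have : 0 <= A * idle_power alpha mu k m.+1 x by rewrite mulr_ge0.
  lra.
move: D Y F; rewrite -/B; set dd := (_ - _ * (mu k - lambda k)).
set z := s^-1 ^+ m in si *; set L := lower_jobs _ _ _ in L0 *; set I := idle_power _ _ _ _ _ in I0 *.
have -> : m.+2%:R * ((lambda k + 1) * (hit_factor lambda k m.+1 * (L + A + I))) = E * (L + A + I).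
  by rewrite /E; ring.
have -> : taylor_cst m * (vp mu x ^+ m * (B ^+ 2 * A) + B ^+ m.+2 * A) = a * vp mu x ^+ m + b.
  by rewrite /a /b; ring.
have : 0 <= (a * (a / c) ^+ m + b) * (L + I) by rewrite mulr_ge0 // addr_ge0.
have : b * 1 <= b * z by rewrite ler_wpM2l.
lra.
Qed.


Lemma idle_power_moment mu pi j : (forall j, 0 < mu j) -> is_stationary P alpha mu Te Ts Phi pi ->
  (\int[pi]_x (idle_power alpha mu j m.+1 x)%:E <= (1 + gam (inr j))%:E)%E.
Proof.
move=> mu0 Hpi.
have T0 om : 0 <= Ts j 0%N om by exact: (Ts_ge0 Hprim).
have mT := measurable_Ts Hprim j 0%N.
have [q1 h1 /andP[_ b1]] : exists2 q, has_mean P (fun om => Ts j 0%N om ^+ m.+2) q & 0 <= q <= gam (inr j).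
  apply: has_mean_ge0 => [|om|]; [exact: measurable_funX|by rewrite exprn_ge0|].
  by rewrite -(Hgam (e := inr j) isT).
have hb := has_meanD (has_mean_cst P 1) h1.
have [q2 h2 /andP[_ b2]] : exists2 q, has_mean P (fun om => Ts j 0%N om ^+ m.+1) q & 0 <= q <= 1 + q1.
  apply: has_mean_ge0 => [|om|]; [exact: measurable_funX|by rewrite exprn_ge0|].
  have [_ <-] := hb; apply: ge0_le_integral => //.
  - by move=> om _; rewrite lee_fin exprn_ge0.
  - by apply/measurable_EFinP; exact: measurable_funX.
  - by apply/measurable_EFinP; apply: measurable_funD; [exact: measurable_cst|exact: measurable_funX].
  move=> om _; rewrite lee_fin; have [h|/ltW h] := leP (Ts j 0%N om) 1.
    by rewrite -[leLHS]addr0 lerD ?exprn_ge0 // exprn_ile1.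
  by rewrite -[leLHS]add0r lerD // ler_weXn2l.
have [_ E2] := h2.
apply: (le_trans (idle_residual_moment Hprim Hnet mu0 alpha_pos Hpi E2)).
by rewrite lee_fin (le_trans b2) // lerD2l.
Qed.

(** A running clock is handled by [enabled_residual_moment], an idle one by [idle_power_moment].
    Dividing by the rate is uniform because [mu j] stays above [lambda j]. *)
Lemma residual_uniform : exists2 G : event J -> R, (forall e, active k e -> 0 <= G e) &
  forall mu : 'I_J -> R, (forall j, lambda j <= mu j) -> (forall j, mu j <= lambda j + 1) ->
  forall pi, is_stationary P alpha mu Te Ts Phi pi -> forall e, active k e ->
  (\int[pi]_x (rho alpha mu e x ^+ m.+1)%:E <= (G e)%:E)%E.
Proof.
pose low (e : event J) := match e with inl j => alpha j | inr j => lambda j end.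
have low0 e : 0 <= low e by case: e => j /=; rewrite ?alpha0 // ltW ?lambda_gt0.
pose b e := rate_bound alpha lambda e ^+ m.+2 + gam e * ((rate_bound alpha lambda e + 1) / tau e).
have b0 e : active k e -> 0 <= b e.
  move=> ae; rewrite addr_ge0 ?exprn_ge0 ?rate_bound_ge0 // mulr_ge0 ?gam_ge0 //.
  by rewrite divr_ge0 ?addr_ge0 ?rate_bound_ge0 // ltW // (tau_gt0 Hprim).
pose g (e : event J) := match e with inl j => 0 | inr j => 1 + gam (inr j) end.
exists (fun e => (low e)^-1 * b e + g e).
  move=> e ae; rewrite addr_ge0 // ?mulr_ge0 ?invr_ge0 ?b0 //.
  by case: e ae => j //= _; rewrite addr_ge0 // gam_ge0.
move=> mu lm ml pi Hpi e ae.
have mu0 j : 0 < mu j by exact: lt_le_trans (lambda_gt0 j) (lm j).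
have mr : measurable_fun setT (fun x : stateM R J => rho alpha mu e x ^+ m.+1).
  by apply: measurable_funX; exact: measurable_rho.
have r0 x := rho_ge0 alpha mu e x.
have rt0 : 0 <= rate alpha mu e by exact: rate_ge0.
pose f (x : stateM R J) : R := (ev_enabled alpha x e)%:R * (rate alpha mu e * rho alpha mu e x ^+ m.+1).
have f0 x : 0 <= f x by rewrite !mulr_ge0 ?exprn_ge0.
have [q1 h1 /andP[_ b1]] : exists2 q, has_mean pi f q & 0 <= q <= b e.
  apply: has_mean_ge0 => //.
    apply: measurable_funM; first exact: measurable_enabled.
    by apply: measurable_funM => //; exact: measurable_cst.
  apply: (le_trans (enabled_residual_moment Hprim Hnet mu0 alpha_pos Hpi (Hgam ae))).
  rewrite lee_fin; apply: lerD.
    by rewrite lerXn2r ?nnegrE ?rate_bound_ge0 // rate_le_bound.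
  by rewrite ler_wpM2l ?gam_ge0 // rate_div_tau_le.
pose h (x : stateM R J) : R := match e with inl j => 0 | inr j => idle_power alpha mu j m.+1 x end.
have [q2 h2 /andP[_ b2]] : exists2 q, has_mean pi h q & 0 <= q <= g e.
  apply: has_mean_ge0.
  - rewrite /h; case: (e) => j; first exact: measurable_cst.
    apply: measurable_funM; first by apply: measurable_funX; exact: measurable_rho.
    by rewrite empty_indicE; apply: measurable_indic; exact: measurable_empty.
  - by rewrite /h; case: (e) => j // x; rewrite mulr_ge0 // exprn_ge0 ?rho_ge0.
  - rewrite /h /g; case: (e) => j; first by rewrite integral0.
    exact: idle_power_moment.
have [hi E] := has_meanD (has_meanZ (low e)^-1 h1) h2.
apply: (@le_trans _ _ (\int[pi]_x ((low e)^-1 * f x + h x)%:E)%E); last first.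
  by rewrite E lee_fin lerD // ler_wpM2l ?invr_ge0.
apply: ge0_le_integral => //.
- by move=> x _; rewrite lee_fin exprn_ge0.
- exact/measurable_EFinP.
- exact: measurable_int hi.
move=> x _; rewrite lee_fin /f /h.
case: e @low low0 b b0 g ae mr r0 rt0 f f0 q1 h1 b1 h h2 b2 hi E => j /= *.
  rewrite addr0; have [a0|a0] := ltP 0 (alpha j).
    by rewrite mul1r mulrA mulVf ?mul1r // gt_eqF.
  (* A stream of rate 0 has [rho = 0], and the conventional value of the inverse of 0 is multiplied
     by 0. *)
  have az : alpha j = 0 by apply/eqP; rewrite eq_le a0 alpha0.
  by rewrite /rho /= az mul0r normr0 expr0n /= !mulr0.
rewrite /idle_power; case: (posnP (Zof x j)) => [_|z].
  by rewrite mulr0n mul0r mulr0 add0r mulr1.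
rewrite mul1r mulr0n mulr0 addr0 mulrA ler_peMl ?exprn_ge0 ?rho_ge0 //.
by rewrite mulrC ler_pdivlMr ?mul1r // lambda_gt0.
Qed.


(** [drift_fun] differs from a weighted job count that includes [Zof x k] only by residuals, and
    those subtracted in it are active and have weight at most 1. *)
Lemma station_le (mu : 'I_J -> R) (x : state R J) : (forall j, 0 < mu j) -> valid_state x ->
  (Zof x k)%:R <= vp mu x + \sum_(e : event J) (active k e)%:R * rho alpha mu e x.
Proof.
move=> mu0 Vx.
have rE e := rhoE Hnet mu0 e Vx.
have r0 e := rho_ge0 alpha mu e x.
have vV : drift_fun alpha mu w k x <= vp mu x by rewrite le_max lexx.
apply: le_trans (lerD vV (lexx _)).
rewrite big_sumType /=.
have s1 : (Zof x k)%:R <= \sum_j wup w k j * (Zof x j)%:R.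
  rewrite (bigD1 k) //= /wup eqxx mul1r lerDl sumr_ge0 // => j _.
  by rewrite mulr_ge0 //; have /andP[] := wup01 k Hw j.
have s2 : \sum_j wup w k j * (alpha j * Reof x j) <= \sum_(j < J) ((j <= k)%N)%:R * rho alpha mu (inl j) x.
  apply: ler_sum => j _; rewrite -(rE (inl j)).
  have /andP[_ u1] := wup01 k Hw j.
  case: leqP => kj; first by rewrite ler_wpM2r.
  rewrite /wup ltnNge (ltnW kj) /=; case: eqP => [E|_]; first by move: kj; rewrite E ltnn.
  by rewrite mul0r.
have s3 : \sum_j wdn w k j * (mu j * Rsof x j) <= \sum_(j < J) 1 * rho alpha mu (inr j) x.
  apply: ler_sum => j _; rewrite -(rE (inr j)) ler_wpM2r //.
  by have /andP[_] := wdn01 k Hw j.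
have s4 : 0 <= wk w k * (mu k * Rsof x k).
  by rewrite -(rE (inr k)) mulr_ge0 //; have /andP[] := wk01 k Hw.
rewrite /drift_fun; lra.
Qed.

Lemma station_moment_step (Cj : 'I_J -> R) : (k <= m)%N ->
  exists2 C : R, 0 < C & forall (r : R) (pi : probability (stateM R J) R), 0 < r < 1 -> r < r0 w ->
  is_stationary P alpha (mu_r lambda r) Te Ts Phi pi ->
  (forall j : 'I_J, (j < k)%N -> (\int[pi]_x ((r ^+ j.+1 * (Zof x j)%:R) ^+ m.+1)%:E <= (Cj j)%:E)%E) ->
  (\int[pi]_x ((r ^+ k.+1 * (Zof x k)%:R) ^+ m.+1)%:E <= C%:E)%E.
Proof.
move=> km.
have J0 : 0 < J%:R :> R by rewrite ltr0n (leq_ltn_trans (leq0n k)).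
have c0 : 0 < wk w k / J%:R by rewrite divr_gt0 // (wk_gt0 k Hnet Hw).
have [C C0 HC] := drift_uniform c0.
have [G G0 HG] := residual_uniform.
set c := wk w k / J%:R in c0 HC.
(* [Kv] will bound the moment of [s * vp] and [Kr] that of the sum of the active residuals. The
   final 1 in [Kv] comes from [s ^+ m * s^-1 ^+ m]; absolute values are used because nothing is
   known about the sign of [Cj]. *)
pose Kv := C / c * (\sum_(j < J) ((j < k)%N)%:R * `|Cj j| + (1 + gam (inr k)) + 1).
pose Kr := #|{: event J}|%:R ^+ m.+1 * \sum_(e : event J) (active k e)%:R * G e.
have gk0 : 0 <= gam (inr k) by exact: gam_ge0.
have Kv0 : 0 <= Kv.
  apply: mulr_ge0; first by rewrite divr_ge0 // ltW.
  apply: addr_ge0 => //; apply: addr_ge0; last exact: addr_ge0.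
  by apply: sumr_ge0 => j _; rewrite mulr_ge0.
have Kr0 : 0 <= Kr.
  rewrite mulr_ge0 ?exprn_ge0 // sumr_ge0 // => e _.
  by case ae : (active k e); rewrite ?mulr0n ?mul0r // mul1r G0.
exists (1 + 2 ^+ m.+1 * (Kv + Kr)).
  by rewrite ltr_pwDl // mulr_ge0 ?exprn_ge0 // addr_ge0.
move=> r pi r01 rr0 Hpi IH; have /andP[r0 r1] := r01.
pose mu := mu_r lambda r.
have rp j : 0 < r ^+ j by rewrite exprn_gt0.
have lm j : lambda j <= mu j by rewrite lerDl ltW.
have ml j : mu j <= lambda j + 1 by rewrite lerD2l exprn_ile1 // ltW.
have mu0 j : 0 < mu j by exact: lt_le_trans (lambda_gt0 j) (lm j).
pose s := r ^+ k.+1.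
have s0 : 0 < s by exact: rp.
have s1 : s <= 1 by rewrite exprn_ile1 // ltW.
have dr : \sum_j wdn w k j * (mu j - lambda j) - wk w k * (mu k - lambda k) <= - (c * s).
  apply: le_trans (heavy_traffic_drift k Hnet Hw r01 rr0).
  rewrite /mu /mu_r (addrC (lambda k)) addrK lerD2r; apply: ler_sum => j _.
  by rewrite (addrC (lambda j)) addrK.
have v0 (x : stateM R J) : 0 <= vp mu x by rewrite le_max lexx orbT.
have mv : measurable_fun setT (fun x : stateM R J => vp mu x).
  by apply: measurable_maxr; [exact: measurable_drift_fun|exact: measurable_cst].
have Hq (j : 'I_J) : exists qj : R,
    has_mean pi (fun x : stateM R J => (((j < k)%N)%:R * (Zof x j)%:R) ^+ m.+1) qj /\
    s ^+ m * qj <= ((j < k)%N)%:R * `|Cj j|.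
  case: ltnP => jk; last first.
    exists 0; split; last by rewrite mulr0 mul0r.
    rewrite (_ : (fun x => _) = fun=> 0); first exact: has_mean_cst.
    by apply/funext => x; rewrite mul0r expr0n.
  have [a ha /andP[a0 ab]] : exists2 a, has_mean pi (fun x : stateM R J => (r ^+ j.+1 * (Zof x j)%:R) ^+ m.+1) a
      & 0 <= a <= Cj j.
    apply: has_mean_ge0; last exact: IH.
    - by apply: measurable_funX; apply: measurable_funM; [exact: measurable_cst|exact: measurable_jobs].
    - by move=> x; rewrite exprn_ge0 // mulr_ge0 // ltW.
  exists ((r ^+ j.+1 ^+ m.+1)^-1 * a); split.
    rewrite (_ : (fun x => _) = (fun x : stateM R J => (r ^+ j.+1 ^+ m.+1)^-1 * (r ^+ j.+1 * (Zof x j)%:R) ^+ m.+1)).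
      exact: has_meanZ.
    apply/funext => x; rewrite mul1r [in RHS]exprMn mulrA mulVf ?mul1r //.
    by rewrite expf_neq0 // gt_eqF.
  rewrite mul1r mulrA; apply: (@le_trans _ _ a); last by rewrite (le_trans ab) // ler_norm.
  (* The exponents compared are [(k+1) m] and [(j+1) (m+1)]. With indices from 0, [j + 1 <= k <= m]
     gives [(j+1) (m+1) <= k m + k <= (k+1) m]; this is where [k <= m] enters. *)
  rewrite ler_piMl // ler_pdivrMr ?exprn_gt0 // mul1r -!exprM.
  rewrite ler_wiXn2l ?ltW //; apply: (@leq_trans (k * m.+1)); first by rewrite leq_mul2r jk orbT.
  by rewrite mulnS mulSn leq_add2r.
have [q hq] := boolp.choice Hq.
have hL : has_mean pi (fun x : stateM R J => lower_jobs k m.+1 x) (\sum_j q j).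
  by apply: has_mean_sum => j; have [] := hq j.
have [i hi /andP[i0 ib]] : exists2 i, has_mean pi (fun x : stateM R J => idle_power alpha mu k m.+1 x) i
    & 0 <= i <= 1 + gam (inr k).
  apply: has_mean_ge0.
  - apply: measurable_funM; first by apply: measurable_funX; exact: measurable_rho.
    by rewrite empty_indicE; apply: measurable_indic; exact: measurable_empty.
  - by move=> x; rewrite mulr_ge0 // exprn_ge0 // rho_ge0.
  - exact: idle_power_moment.
have hb := has_meanZ C (has_meanD (has_meanD hL hi) (has_mean_cst pi (s^-1 ^+ m))).
have ma : measurable_fun setT (fun x : stateM R J => c * s * vp mu x ^+ m.+1).
  by apply: measurable_funM; [exact: measurable_cst|exact: measurable_funX].
have a_ge0 (x : stateM R J) : 0 <= c * s * vp mu x ^+ m.+1.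
  by rewrite mulr_ge0 ?exprn_ge0 // mulr_ge0 // ltW.
have [a ha /andP[_ ab]] : exists2 a, has_mean pi (fun x : stateM R J => c * s * vp mu x ^+ m.+1) a
    & 0 <= a <= C * (\sum_j q j + i + s^-1 ^+ m).
  apply: has_mean_ge0 => //; have [hbi <-] := hb.
  apply: (stationary_drift Hprim alpha0 mu0 alpha_pos Hpi ler01 (G := fun x => vp mu x ^+ m.+2)).
  - exact: measurable_funX.
  - exact: ma.
  - by apply/measurable_EFinP; exact: measurable_int hbi.
  - by move=> x; rewrite exprn_ge0.
  - exact: a_ge0.
  - move=> x; apply: mulr_ge0 => //; apply: addr_ge0; last by rewrite exprn_ge0 // invr_ge0 ltW.
    apply: addr_ge0; last by rewrite mulr_ge0 // exprn_ge0 // rho_ge0.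
    by apply: sumr_ge0 => j _; rewrite exprn_ge0 // mulr_ge0.
  - by move=> x Vx; apply: HC => //; rewrite s0 s1.
(* The factor [s ^+ m / c] turns the gain of the drift inequality into the moment of [s * vp] and
   neutralizes the term [s^-1 ^+ m] of its bound. *)
have hv : has_mean pi (fun x : stateM R J => s ^+ m.+1 * vp mu x ^+ m.+1) (s ^+ m / c * a).
  rewrite (_ : (fun x => _) = (fun x : stateM R J => s ^+ m / c * (c * s * vp mu x ^+ m.+1))).
    exact: has_meanZ.
  by apply/funext => x; rewrite exprS; field; rewrite gt_eqF.
have vb : s ^+ m / c * a <= Kv.
  have sm : 0 <= s ^+ m / c by rewrite divr_ge0 ?exprn_ge0 // ltW.
  apply: (le_trans (ler_wpM2l sm ab)).
  have -> : s ^+ m / c * (C * (\sum_j q j + i + s^-1 ^+ m)) = C / c * (s ^+ m * \sum_j q j + s ^+ m * i + 1).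
    have : s ^+ m * s^-1 ^+ m = 1 by rewrite -exprMn divff ?expr1n // gt_eqF.
    move: (s ^+ m) (s^-1 ^+ m) => X Y XY; rewrite -XY; field; rewrite gt_eqF //.
  rewrite ler_wpM2l ?(divr_ge0 C0 (ltW c0)) // lerD2r; apply: lerD.
    by rewrite mulr_sumr; apply: ler_sum => j _; have [] := hq j.
  by apply: le_trans ib; rewrite ler_piMl // exprn_ile1 // (ltW s0).
have Hr (e : event J) : exists q : R,
    has_mean pi (fun x : stateM R J => (active k e)%:R * rho alpha mu e x ^+ m.+1) q /\
    q <= (active k e)%:R * G e.
  case ae : (active k e); last first.
    exists 0; split; last by rewrite mul0r.
    rewrite (_ : (fun x => _) = fun=> 0); first exact: has_mean_cst.
    by apply/funext => x; rewrite mul0r.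
  have [a' ha' /andP[_ ab']] : exists2 a, has_mean pi (fun x : stateM R J => rho alpha mu e x ^+ m.+1) a & 0 <= a <= G e.
    apply: has_mean_ge0; last exact: HG.
    - by apply: measurable_funX; exact: measurable_rho.
    - by move=> x; rewrite exprn_ge0 // rho_ge0.
  by exists (true%:R * a'); split; [exact: has_meanZ|rewrite ler_wpM2l].
have [rr hrr] := boolp.choice Hr.
have hR : has_mean pi (fun x : stateM R J => \sum_e (active k e)%:R * rho alpha mu e x ^+ m.+1) (\sum_e rr e).
  by apply: has_mean_sum => e; have [] := hrr e.
have hF := has_meanZ (2 ^+ m.+1) (has_meanD hv (has_meanZ (#|{: event J}|%:R ^+ m.+1) hR)).
have [hFi EF] := hF.
have mF := measurable_int pi hFi.
apply: (@le_trans _ _ (2 ^+ m.+1 * (s ^+ m / c * a + #|{: event J}|%:R ^+ m.+1 * \sum_e rr e))%:E); last first.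
  rewrite lee_fin -[leLHS]add0r lerD // ler_wpM2l ?exprn_ge0 // lerD // ler_wpM2l ?exprn_ge0 //.
  by apply: ler_sum => e _; have [] := hrr e.
rewrite -EF; apply: (ge0_integral_le_ae (V := [set x : stateM R J | valid_state x])).
- exact: measurable_valid.
- exact: piV Hpi.
- by move=> x; rewrite lee_fin exprn_ge0 // mulr_ge0 // ltW.
- move=> x; rewrite lee_fin mulr_ge0 ?exprn_ge0 // addr_ge0 //.
    by rewrite mulr_ge0 // exprn_ge0 // ltW.
  rewrite mulr_ge0 ?exprn_ge0 // sumr_ge0 // => e _.
  by rewrite mulr_ge0 // exprn_ge0 // rho_ge0.
- exact: mF.
move=> x Vx; rewrite lee_fin.
have R0 e : 0 <= (active k e)%:R * rho alpha mu e x by rewrite mulr_ge0 // rho_ge0.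
have S0 : 0 <= \sum_(e : event J) (active k e)%:R * rho alpha mu e x by rewrite sumr_ge0.
have h1 : (r ^+ k.+1 * (Zof x k)%:R) ^+ m.+1 <=
  (s * vp mu x + \sum_(e : event J) (active k e)%:R * rho alpha mu e x) ^+ m.+1.
  have sv : 0 <= s * vp mu x by rewrite mulr_ge0 // (ltW s0).
  have sZ : 0 <= r ^+ k.+1 * (Zof x k)%:R by rewrite mulr_ge0 // (ltW s0).
  rewrite lerXn2r ?nnegrE ?(addr_ge0 sv S0) //.
  apply: (le_trans (ler_wpM2l (ltW s0) (station_le mu0 Vx))).
  by rewrite mulrDr lerD2l ler_piMl.
apply: (le_trans h1); apply: (le_trans (add_power_le _ (mulr_ge0 (ltW s0) (v0 x)) S0)).
rewrite ler_wpM2l ?exprn_ge0 // exprMn lerD2l.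
apply: (le_trans (sum_power_le _ R0)); rewrite ler_wpM2l ?exprn_ge0 //.
apply: ler_sum => e _; case: (active k e); first by rewrite !mul1r.
by rewrite !mul0r expr0n.
Qed.

End Uniform.

(** Without external arrivals the empty class would satisfy the hypotheses of [closed_class_total]
    and would have to contain [k]. *)
Lemma external_arrivals {R : realType} {J : nat} (alpha lambda : 'I_J -> R) (Pm : 'M[R]_J) (k : 'I_J) :
  network_data alpha Pm lambda -> exists i, 0 < alpha i.
Proof.
move=> Hnet; apply: contrapT => H.
apply: (closed_class_total Hnet (S := fun=> False) _ _ k) => // j aj.
by apply: H; exists j.
Qed.

Theorem theorem1 (R : realType) (J M : nat) (d : measure_display)
  (Om : measurableType d) (P : probability Om R)
  (alpha lambda : 'I_J -> R) (Pm w : 'M[R]_J)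
  (Te Ts : 'I_J -> nat -> Om -> R) (Phi : 'I_J -> nat -> Om -> option 'I_J)
  (pi : R -> probability (stateM R J) R) :
  (1 <= M)%N ->
  network_data alpha Pm lambda ->
  w_matrix Pm w ->
  gjn_primitives P Pm Te Ts Phi ->
  (forall r : R, 0 < r < 1 ->
     stability P alpha (mu_r lambda r) Te Ts Phi (pi r)) ->
  (forall j : 'I_J, (j < M)%N ->
     (\int[P]_om ((Te j 0%N om) ^+ M.+1)%:E < +oo)%E) ->
  (forall j : 'I_J,
     (\int[P]_om ((Ts j 0%N om) ^+ M.+1)%:E < +oo)%E) ->
  forall k : 'I_J, (k < M)%N ->
    exists C : R, 0 < C /\
      forall r : R, 0 < r < 1 -> r < r0 w ->
        (\int[pi r]_x ((r ^+ k.+1 * (Zof x k)%:R) ^+ M)%:E <= C%:E)%E.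
Proof.
case: M => [//|m] _ Hnet Hw Hprim Hst HTe HTs.
(* [fine] returns 0 on an infinite integral; [gam e] represents the moment only for active [e],
   where the hypotheses make it finite. *)
pose gam (e : event J) : R := fine (\int[P]_om (dat Te Ts e 0%N om ^+ m.+2)%:E)%E.
have Hgam (k : 'I_J) e : (k < m.+1)%N -> active k e ->
    (\int[P]_om (dat Te Ts e 0%N om ^+ m.+2)%:E = (gam e)%:E)%E.
  move=> km ae; rewrite fineK // ge0_fin_numE; last first.
    by apply: integral_ge0 => om _; rewrite lee_fin exprn_ge0 // (Dge0 Hprim).
  by case: e ae => j /= jk; [apply: HTe; exact: leq_ltn_trans jk km|exact: HTs].
suff H n : forall k : 'I_J, (k < n)%N -> (k < m.+1)%N -> exists C : R, 0 < C /\
      forall r : R, 0 < r < 1 -> r < r0 w ->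
        (\int[pi r]_x ((r ^+ k.+1 * (Zof x k)%:R) ^+ m.+1)%:E <= C%:E)%E.
  by move=> k; exact: (H k.+1).
elim: n => [//|n IH] k kn km.
(* The constant is quantified outside the condition [j < k], so that choice yields one function on
   all stations, with the default 0 from [k] on. *)
have Hj (j : 'I_J) : exists C : R, (j < k)%N -> forall r : R, 0 < r < 1 -> r < r0 w ->
    (\int[pi r]_x ((r ^+ j.+1 * (Zof x j)%:R) ^+ m.+1)%:E <= C%:E)%E.
  case: (ltnP j k) => jk; last by exists 0.
  have [C [_ HC]] := IH j (leq_trans jk kn) (ltn_trans jk km).
  by exists C.
have [Cj HCj] := boolp.choice Hj.
have apos := external_arrivals k Hnet.
have [C C0 HC] := station_moment_step Hprim Hnet Hw apos (fun e => @Hgam k e km) Cj km.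
exists C; split => // r r01 rr0; apply: HC => //; first by have [] := Hst r r01.
by move=> j jk; exact: HCj.
Qed.
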